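(* For every nonempty graph $H$ (i.e. with at least one edge), all $p_0<1$, and every $\varepsilon>0$, there exists a constant $L>0$ such that the following holds. Let $n$ be a positive integer and let $p\in(0,1)$ satisfy $Ln^{-1/m_2(H)}\le p\le p_0$. Let $X=N_H(G(n,p))$. Then, for every $\eta\in[0,1]$, $$(1-\varepsilon)\,\Phi_{n,p}^H(\eta+\varepsilon)\ \le\ -\log\Pr\big(X\le\eta\,\mathbb E[X]\big)\ \le\ (1+\varepsilon)\,\Phi_{n,p}^H\big((1-\varepsilon)\eta\big).$$
   Context: Write $[n]=\{1,\dots,n\}$. For $q:\binom{[n]}{2}\to[0,1]$, $G(n,q)$ is the random graph on $[n]$ in which each edge $e$ of the complete graph on $[n]$ is retained independently with probability $q_e$; $G(n,p)$ is the case $q\equiv p$. For graphs $H,G$, $N_H(G)$ is the number of copies of $H$ in $G$ (subgraphs of $G$, not necessarily induced, isomorphic to $H$). For $p\in(0,1)$ and $q\in[0,1]$, $$i_p(q)=q\log\frac qp+(1-q)\log\frac{1-q}{1-p},$$ with natural logarithms and $0\log 0=0$. For real $\eta$, $$\Phi_{n,p}^H(\eta)=\min\Big\{\sum_{e\in\binom{[n]}{2}}i_p(q_e):\ q\in[0,1]^{\binom{[n]}{2}},\ \mathbb E\big[N_H(G(n,q))\big]\le\eta\cdot\mathbb E\big[N_H(G(n,p))\big]\Big\},$$ where the minimum over an empty set is $+\infty$. The $2$-density $m_2(H)$ is $\max\big\{\frac{e_F-1}{v_F-2}:F\subseteq H,\ e_F\ge2\big\}$ if $H$ has at least two edges ($F$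 ranges over subgraphs, with $v_F$ vertices and $e_F$ edges), and $m_2(H)=\frac12$ otherwise. *)

(* Defs.v *)
(* MathComp, with MathComp-Analysis. *)
From HB Require Import structures.
From mathcomp Require Import all_boot all_order all_algebra.
From mathcomp Require Import all_classical all_reals all_analysis ring lra.
Import Order.TTheory GRing.Theory Num.Theory numFieldNormedType.Exports.

Set Implicit Arguments.
Unset Strict Implicit.
Unset Printing Implicit Defensive.

Local Open Scope ring_scope.

Definition edge (V : finType) := {e : {set V} | #|e| == 2%N}.

(* A simple graph on the vertex set V (all of V, so isolated vertices count)
   is given by its set of edges. *)
Notation graph V := {set edge V}.

(* A subgraph of G : graph V is a pair S = (vertex set, edge set). *)
Definition subgraph (V : finType) (G : graph V) (S : {set V} * graph V) : bool :=
  (S.2 \subset G) && [forall e in S.2, val e \subset S.1].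

Definition isograph (V W : finType) (H : graph V) (S : {set W} * graph W) : bool :=
  [exists f : {ffun V -> W},
    [&& injectiveb f, S.1 == f @: [set: V] &
        [set val e | e : edge W in S.2] == [set f @: val e | e : edge V in H]]].

Definition copies (V W : finType) (H : graph V) (G : graph W) : nat :=
  #|[set S : {set W} * graph W | subgraph G S && isograph H S]|.

(* The 0 in the big maximum is harmless: a graph with at least two edges has
   at least three vertices, so all the terms are positive. *)
Definition m2 (R : realType) (V : finType) (H : graph V) : R :=
  if (2 <= #|H|)%N then
    \big[Num.max/0]_(S : {set V} * graph V | subgraph H S && (2 <= #|S.2|)%N)
      ((#|S.2|%:R - 1) / (#|S.1|%:R - 2))
  else 1 / 2.

(* The probability that G(n, q) is G, the vertex set [n] being 'I_n. *)
Definition gnq_law (R : realType) (n : nat) (q : edge 'I_n -> R)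
    (G : graph 'I_n) : R :=
  \prod_(e : edge 'I_n) (if e \in G then q e else 1 - q e).

Definition gnq_pr (R : realType) (n : nat) (q : edge 'I_n -> R)
    (A : pred (graph 'I_n)) : R :=
  \sum_(G : graph 'I_n | A G) gnq_law q G.

Definition gnq_mean (R : realType) (n : nat) (q : edge 'I_n -> R)
    (X : graph 'I_n -> R) : R :=
  \sum_(G : graph 'I_n) gnq_law q G * X G.

(* As ln 0 = 0 here, the convention 0 log 0 = 0 holds. *)
Definition relent (R : realType) (p q : R) : R :=
  q * ln (q / p) + (1 - q) * ln ((1 - q) / (1 - p)).

Definition Phi_feasible (R : realType) (V : finType) (H : graph V) (n : nat)
    (p eta : R) : set (edge 'I_n -> R) :=
  let N (G : graph 'I_n) : R := (copies H G)%:R in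
  [set q | (forall e, 0 <= q e <= 1) /\
           gnq_mean q N <= eta * gnq_mean (fun=> p) N]%classic.
Arguments Phi_feasible {R V} H n p eta.

(* The infimum is +oo when there is no feasible q, and is otherwise attained,
   see Phi_attained. *)
Definition Phi (R : realType) (V : finType) (H : graph V) (n : nat)
    (p eta : R) : \bar R :=
  ereal_inf [set (\sum_(e : edge 'I_n) relent p (q e))%:E
            | q in Phi_feasible H n p eta]%classic.

Import ArrowAsProduct.
Local Open Scope classical_set_scope.

Lemma xlnx_continuous (R : realType) : continuous (fun x : R => x * ln x).
Proof.
move=> x; rewrite /continuous_at; have [x0|x0|->] := ltgtP x 0.
- rewrite (ln0 (ltW x0)) mulr0.
  apply: cvg_near_cst; near=> y.
  rewrite ln0 ?mulr0//; apply/ltW; near: y; exact: lt_nbhsl.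
- by apply: continuousM; [exact: cvg_id|exact: continuous_ln].
- rewrite mul0r.
  have s0 : (fun x : R => 2 * Num.sqrt `|x|) @ (0 : R) --> (0 : R).
    have : {for (0 : R), continuous (fun x : R => 2 * Num.sqrt `|x|)}.
      apply: continuousM; first exact: cst_continuous.
      apply: continuous_comp; [exact: norm_continuous|exact: sqrt_continuous].
    by rewrite /prop_for /continuous_at normr0 sqrtr0 mulr0.
  apply/norm_cvg0P.
  apply: (squeeze_cvgr _ (cvg_cst 0) s0).
  near=> y; apply/andP; split; first exact: normr_ge0.
  have [y0|y0] := leP y 0; first by rewrite ln0// mulr0 normr0 mulr_ge0.
  have y1 : y < 1 by near: y; apply: lt_nbhsl; exact: ltr01.
  rewrite normrM.
  have yE : y = Num.sqrt y ^+ 2 by rewrite sqr_sqrtr// ltW.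
  have : 0 < Num.sqrt y by rewrite sqrtr_gt0.
  rewrite (ler0_norm (ln_le0 (ltW y1))) (gtr0_norm y0) {2 3}yE.
  move: (Num.sqrt y) => s s0'; rewrite lnXn//.
  have : ln s^-1 < s^-1 by apply: ln_sublinear; rewrite invr_gt0.
  rewrite lnV ?posrE// -(ltr_pM2l s0') mulfV ?gt_eqF// => h.
  have := ler_wpM2l (ltW s0') (ltW h); nra.
Unshelve. all: by end_near. Qed.

Lemma relent_continuous (R : realType) (p : R) : 0 < p < 1 ->
  continuous (relent p).
Proof.
move=> /andP[p0 p1].
have p1' : 0 < 1 - p by rewrite subr_gt0.
have -> : relent p = fun q => p * (q / p * ln (q / p)) +
    (1 - p) * ((1 - q) / (1 - p) * ln ((1 - q) / (1 - p))).
  apply/funext => q; rewrite /relent; congr (_ + _); field; exact: lt0r_neq0.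
have comp (f : R -> R) : continuous f -> continuous (fun q => f q * ln (f q)).
  move=> cf q; apply: (@continuous_comp _ _ _ f (fun x : R => x * ln x)).
    exact: cf.
  exact: xlnx_continuous.
move=> q; apply: cvgD; (apply: cvgM; first exact: cvg_cst).
  apply: (comp (fun q => q / p)) => {}q.
  by apply: cvgM; [exact: cvg_id|exact: cvg_cst].
apply: (comp (fun q => (1 - q) / (1 - p))) => {}q.
by apply: cvgM; [apply: cvgB; [exact: cvg_cst|exact: cvg_id]|exact: cvg_cst].
Qed.

Lemma gnq_law_continuous (R : realType) (n : nat) (G : graph 'I_n) :
  continuous ((fun q => gnq_law q G) : (edge 'I_n -> R) -> R).
Proof.
apply: continuous_big => [|e _]; first exact: mul_continuous.
have subC (T : topologicalType) (f : T -> R) (b : bool) :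
    continuous f -> continuous (fun x => if b then f x else 1 - f x).
  by case: b => // cf x; apply: cvgB; [exact: cvg_cst|exact: cf].
exact: (subC _ (fun q : edge 'I_n -> R => q e) _
  (@proj_continuous _ (fun=> R) e)).
Qed.

Lemma gnq_mean_continuous (R : realType) (n : nat) (X : graph 'I_n -> R) :
  continuous ((fun q => gnq_mean q X) : (edge 'I_n -> R) -> R).
Proof.
have mulC (T : topologicalType) (f : T -> R) c :
    continuous f -> continuous (fun x => f x * c).
  by move=> cf x; apply: cvgM; [exact: cf|exact: cvg_cst].
rewrite /gnq_mean; apply: continuous_big => [|G _]; first exact: add_continuous.
exact: (mulC _ (fun q => gnq_law q G) _ (@gnq_law_continuous R n G)).
Qed.

Lemma Phi_attained (R : realType) (V : finType) (H : graph V) (n : nat)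
    (p eta : R) : 0 < p < 1 -> Phi_feasible H n p eta !=set0 ->
  exists2 q, Phi_feasible H n p eta q &
    Phi H n p eta = (\sum_(e : edge 'I_n) relent p (q e))%:E.
Proof.
move=> p01 F0; pose T : topologicalType := edge 'I_n -> R.
have cF : compact (Phi_feasible H n p eta : set T).
  rewrite /Phi_feasible; apply: compact_closedI.
    have := @tychonoff _ (fun _ : edge 'I_n => R) (fun=> `[0, 1]%classic)
      (fun=> @segment_compact R 0 1).
    by congr compact; apply/seteqP; split => q /= + e => /(_ e); rewrite in_itv.
  apply: (@preimage_closed T R (fun q => gnq_mean q _) [set x | x <= _]).
    by move=> q _; exact: gnq_mean_continuous.
  exact: closed_le.
have cS : continuous (fun q : T => \sum_(e : edge 'I_n) relent p (q e)).
  apply: continuous_big => [|e _ q]; first exact: add_continuous.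
  apply: (@continuous_comp _ _ _ (fun q : T => q e) (relent p)).
    exact: (@proj_continuous _ (fun=> R)).
  exact: relent_continuous.
have [q Fq qmin] := @compact_EVT_min T R
  (fun q => \sum_(e : edge 'I_n) relent p (q e)) _ F0 cF
  (continuous_subspaceT cS).
exists q; first exact: set_mem.
apply/eqP; rewrite eq_le; apply/andP; split.
  by apply: ereal_inf_lbound; exists q => //; exact: set_mem.
by apply: le_ereal_inf_tmp => _ [r Fr <-]; rewrite lee_fin qmin//; exact: mem_set.
Qed.

(* Main.v *)
Require Import Defs.
From mathcomp Require Import all_boot all_order all_algebra.
From mathcomp Require Import all_classical all_reals all_analysis.
From mathcomp Require Import ring lra zify.
From mathcomp Require Import fingroup perm.
From mathcomp Require Import fintype finset.
Import Order.TTheory GRing.Theory Num.Theory numFieldNormedType.Exports.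

Set Implicit Arguments.
Unset Strict Implicit.
Unset Printing Implicit Defensive.

Local Open Scope ring_scope.

(** Let mu be the law of G(n, p) conditioned on the lower tail event A.  Its
    entropy relative to G(n, p) is - ln P(A), so each of the two bounds compares
    this entropy with the cost of a product measure.  The copies of H are the
    edges of a hypergraph on the set E of edges of the complete graph, and most
    of the proof is about a hypergraph on a finite set E, with edges of size r
    and with upper bounds on the numbers of edges through given vertices.

    Lower bound (lower_tail_entropy).  A is decreasing, so whatever is known
    about some elements of E, each other one is present with probability at most
    p under mu (decreasing_present, cprob_le).  Reveal the random set on a small
    set W and let q be the conditional marginals off W, and p on W.  Relative
    entropy is superadditive, so the cost of q is on average at most - ln P(A)
    (cprob_entropy).  On A there are never more than eta E[X] edges; so the
    expected number of edges under q is at most that, plus the contribution of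
    the edges meeting W, plus the defect of independence of the unrevealed
    elements, given W.

    The heart is to find W making the defect small on the scale p ^ r, although
    the elements are rare (exists_decoupling_set).  By telescoping
    (cexp_contains_prod_sq) the defect of an edge is controlled by the
    influences of each of its vertices w on each later vertex u, when W and the
    earlier vertices are revealed, the latter being present.  As the revealed
    earlier vertices can be absorbed in W, an influence of w on u that is
    counted for many edges through w and u appears only once in the growth of
    the sum over u of the second moments of the conditional probabilities.  That
    sum is bounded by #|E| p ^ 2, so it grows little at most sizes of a random W
    (exists_slow_window).  The number of edges counting the same influence is
    concentrated by a second moment estimate (pair_count, sum_pair_shift), which
    is where the codegrees have to be small, that is, where p must be large
    compared with n ^ (-1 / m2 H) (subgraph_density, codegree_le).

    Upper bound.  Tilting the measure from p to a q with few expected edges costs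
    the relative entropy of q, divided by the probability of A under q
    (tilting).  If eta is not tiny, that probability is near 1 by a variance
    estimate (upper_tail_chebyshev).  If eta is tiny, the edges of the complete
    graph at which q is not much smaller than p form a graph with few copies of
    H, so by supersaturation they are hardly more than a largest H-free graph;
    as it is enough to forbid all other edges, the cost of q can not be much
    smaller than necessary (upper_tail_supersaturation). *)

(** * Product measures on the subsets of a finite set *)

Lemma le_of_eq (R : realType) (x y : R) : x = y -> x <= y.
Proof. by move->. Qed.

Section ProductMeasure.
Variables (R : realType) (E : finType).
Implicit Types (q : E -> R) (G W S T : {set E}).

Definition bern (a : R) (b : bool) : R := if b then a else 1 - a.

(** For E := edge 'I_n this is gnq_law, by conversion. *)
Definition prodm q G : R := \prod_(e : E) bern (q e) (e \in G).

Lemma bern_ge0 (a : R) b : 0 <= a <= 1 -> 0 <= bern a b.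
Proof. by case: b => /= /andP[? ?] //; rewrite subr_ge0. Qed.

Lemma prodm_ge0 q G : (forall e, 0 <= q e <= 1) -> 0 <= prodm q G.
Proof. by move=> q01; apply: prodr_ge0 => e _; exact: bern_ge0. Qed.

Lemma sum_set_prod (F : E -> bool -> R) :
  \sum_(G : {set E}) \prod_e F e (e \in G) = \prod_e (F e true + F e false).
Proof.
rewrite (bigA_distr _ _ (fun e => F e true) (fun e => F e false)).
apply: eq_bigr => G _; apply: eq_bigr => e _; by case: (e \in G).
Qed.

Lemma sum_prodm q : \sum_(G : {set E}) prodm q G = 1.
Proof.
rewrite (sum_set_prod (fun e => bern (q e))) big1 // => e _ /=.
by rewrite /bern addrC subrK.
Qed.

Lemma prodm_contain q T :
  \sum_(G : {set E}) prodm q G * (T \subset G)%:R = \prod_(e in T) q e.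
Proof.
transitivity (\sum_(G : {set E}) \prod_e
    (bern (q e) (e \in G) * ((e \in T) ==> (e \in G))%:R)).
  apply: eq_bigr => G _; rewrite big_split /= /prodm; congr (_ * _).
  have [TG|] := boolP (T \subset G).
    rewrite big1 // => e _; case: (boolP (e \in T)) => //= eT.
    by rewrite (subsetP TG).
  case/subsetPn => e eT eG; rewrite (bigD1 e) //= eT (negbTE eG) /=.
  by rewrite mul0r.
rewrite (sum_set_prod (fun e b => bern (q e) b * ((e \in T) ==> b)%:R)).
rewrite [RHS]big_mkcond; apply: eq_bigr => e _ /=.
case: (e \in T); rewrite /bern /= ?mulr1 ?mulr0 ?addr0 //.
by rewrite addrC subrK.
Qed.

(** The test G :&: W == S factorizes over the elements of E. *)
Lemma prodm_marginal q q' W S : {in W, q =1 q'} ->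
  \sum_(G : {set E} | G :&: W == S) prodm q G =
  \sum_(G : {set E} | G :&: W == S) prodm q' G.
Proof.
move=> qq'.
have [SW|SW] := boolP (S \subset W); last first.
  rewrite !big1 // => G /eqP GS; by rewrite -GS subsetIr in SW.
have main r : \sum_(G : {set E} | G :&: W == S) prodm r G =
    \prod_(e in W) bern (r e) (e \in S).
  transitivity (\sum_(G : {set E}) \prod_e
      (bern (r e) (e \in G) * ((e \in W) ==> ((e \in G) == (e \in S)))%:R)).
    rewrite big_mkcond; apply: eq_bigr => G _; rewrite big_split /=.
    case: eqP => [<-|ne].
      rewrite [X in _ = _ * X]big1 ?mulr1 // => e _; rewrite inE.
      by case: (e \in W); rewrite //= andbT eqxx.
    have : [exists e, (e \in W) && ((e \in G) != (e \in S))].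
      apply: contra_notT ne => /existsPn h; apply/setP => e; rewrite inE.
      move: (h e); rewrite negb_and negbK => /orP[eW|/eqP ->].
        rewrite (negbTE eW) andbF; apply/esym/negbTE.
        by apply: contra eW; apply: subsetP.
      by case: (boolP (e \in S)) => //= eS; rewrite (subsetP SW).
    case/existsP => e /andP[eW ne']; rewrite [X in _ = _ * X](bigD1 e) //=.
    by rewrite eW (negbTE ne') /= mul0r mulr0.
  rewrite (sum_set_prod (fun e b =>
     bern (r e) b * ((e \in W) ==> (b == (e \in S)))%:R)).
  rewrite [RHS]big_mkcond; apply: eq_bigr => e _ /=.
  case: (e \in W); rewrite /bern /= ?mulr1; last by rewrite addrC subrK.
  by case: (e \in S); rewrite /= ?mulr1 ?mulr0 ?addr0 ?add0r.
by rewrite !main; apply: eq_bigr => e eW; rewrite qq'.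
Qed.

End ProductMeasure.

(** * Conditional expectations *)

Section CondExp.
Variables (R : realType) (E : finType) (mu : {set E} -> R).
Hypothesis mu_ge0 : forall G, 0 <= mu G.
Implicit Types (g h : {set E} -> R) (G W S T Y : {set E}).

(** On the classes of mass 0 this is 0 / 0 = 0; integrals against mu do not see
    them. *)
Definition cexp W g Y : R :=
  (\sum_(G : {set E} | G :&: W == Y :&: W) mu G * g G) /
  (\sum_(G : {set E} | G :&: W == Y :&: W) mu G).

Definition determined W h := forall Y Y', Y :&: W = Y' :&: W -> h Y = h Y'.

Lemma cexp_determined W g : determined W (cexp W g).
Proof. by move=> Y Y' e; rewrite /cexp e. Qed.

Lemma determinedS W W' h : W \subset W' -> determined W h -> determined W' h.
Proof.
move=> sub hW Y Y' e; apply: hW.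
by rewrite -(setIidPr sub) !setIA e.
Qed.

Lemma cexp_ge0 W g Y : (forall G, 0 <= g G) -> 0 <= cexp W g Y.
Proof.
move=> g0; apply: divr_ge0; apply: sumr_ge0 => G _ //.
by apply: mulr_ge0.
Qed.

Lemma cexp_sum W (I : finType) (P : pred I) (g : I -> {set E} -> R) Y :
  cexp W (fun G => \sum_(i | P i) g i G) Y = \sum_(i | P i) cexp W (g i) Y.
Proof.
rewrite /cexp -mulr_suml; congr (_ / _); rewrite exchange_big /=.
by apply: eq_bigr => G _; rewrite mulr_sumr.
Qed.

Lemma cexpB W g h Y : cexp W (fun G => g G - h G) Y = cexp W g Y - cexp W h Y.
Proof.
rewrite /cexp -mulrBl; congr (_ / _); rewrite -sumrB.
by apply: eq_bigr => G _; rewrite mulrBr.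
Qed.

Lemma eq_cexp W g h Y : (forall G, g G = h G) -> cexp W g Y = cexp W h Y.
Proof. by move=> e; rewrite /cexp (eq_bigr _ (fun G _ => congr1 _ (e G))). Qed.

Lemma cexp_le_bound W g Y (c : R) : 0 <= c ->
  (forall G, 0 < mu G -> g G <= c) -> cexp W g Y <= c.
Proof.
move=> c0 gc; rewrite /cexp.
set M := \sum_(G | _) mu G.
have M0 : 0 <= M by apply: sumr_ge0.
have [Mp|] := ltP 0 M; last first.
  move=> Mn; have -> : M = 0 by apply/eqP; rewrite eq_le Mn M0.
  by rewrite invr0 mulr0.
rewrite ler_pdivrMr // mulr_sumr; apply: ler_sum => G _.
have [m|] := ltP 0 (mu G); first by rewrite mulrC ler_wpM2r // gc.
move=> m; have -> : mu G = 0 by apply/eqP; rewrite eq_le m mu_ge0.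
by rewrite mul0r mulr0.
Qed.

Lemma normr_cexp W g Y : `|cexp W g Y| <= cexp W (fun G => `|g G|) Y.
Proof.
rewrite /cexp normrM normfV.
have M0 : 0 <= \sum_(G : {set E} | G :&: W == Y :&: W) mu G by exact: sumr_ge0.
rewrite (ger0_norm M0) ler_wpM2r ?invr_ge0 ?sumr_ge0 // (le_trans (ler_norm_sum _ _ _)) //.
by apply: ler_sum => G _; rewrite normrM (ger0_norm (mu_ge0 _)).
Qed.

Lemma mass_class_eq0 W Y :
  \sum_(G : {set E} | G :&: W == Y :&: W) mu G = 0 -> mu Y = 0.
Proof.
move/eqP; rewrite psumr_eq0 // => /allP /(_ Y).
by rewrite mem_index_enum eqxx => /(_ isT) /implyP /(_ isT) /eqP.
Qed.

Lemma cexpE W g h : determined W h ->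
  \sum_Y mu Y * (h Y * cexp W g Y) = \sum_Y mu Y * (h Y * g Y).
Proof.
move=> hW.
transitivity (\sum_Y \sum_(G | G :&: W == Y :&: W) mu Y * (mu G * g G * h G) /
   (\sum_(G' : {set E} | G' :&: W == G :&: W) mu G')).
  apply: eq_bigr => Y _; rewrite /cexp mulrA mulr_suml mulr_sumr.
  apply: eq_bigr => G /eqP e; rewrite e (hW _ _ e); ring.
rewrite (exchange_big_dep xpredT) //=; apply: eq_bigr => G _.
under eq_bigl => Y do rewrite eq_sym.
rewrite -mulr_suml -mulr_suml.
have [M0|M0] := eqVneq (\sum_(G' : {set E} | G' :&: W == G :&: W) mu G') 0.
  by rewrite M0 (mass_class_eq0 M0) !mul0r.
by field.
Qed.

Lemma cexp_mean W g : \sum_Y mu Y * cexp W g Y = \sum_Y mu Y * g Y.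
Proof.
have := @cexpE W g (fun=> 1) (fun _ _ _ => erefl).
by under eq_bigr do rewrite mul1r; under [RHS]eq_bigr do rewrite mul1r.
Qed.

Lemma cexp_tower W W' g h Y : W \subset W' -> determined W' h ->
  cexp W (fun G => h G * cexp W' g G) Y = cexp W (fun G => h G * g G) Y.
Proof.
move=> sub hW'; rewrite /cexp; congr (_ / _).
have dW : determined W' (fun G => (G :&: W == Y :&: W)%:R * h G).
  move=> G G' e; rewrite (hW' _ _ e).
  by rewrite -(setIidPr sub) !setIA e.
have dE := cexpE g dW.
rewrite [LHS]big_mkcond [RHS]big_mkcond /=.
transitivity (\sum_G mu G * ((G :&: W == Y :&: W)%:R * h G * cexp W' g G)).
  by apply: eq_bigr => G _; case: eqP => _; rewrite ?mul1r ?mul0r ?mulr0.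
by rewrite dE; apply: eq_bigr => G _; case: eqP => _; rewrite ?mul1r ?mul0r ?mulr0.
Qed.

Lemma cexp_pull W g h Y : determined W h ->
  cexp W (fun G => g G * h G) Y = cexp W g Y * h Y.
Proof.
move=> hW; rewrite /cexp mulrAC; congr (_ / _); rewrite mulr_suml.
by apply: eq_bigr => G /eqP e; rewrite (hW _ _ e) mulrA.
Qed.

(** The reason why influences can be summed up: the squares of the changes are
    the increments of a bounded quantity. *)
Lemma cexp_pythagoras W W' g : W \subset W' ->
  \sum_Y mu Y * (cexp W' g Y - cexp W g Y) ^+ 2 =
  \sum_Y mu Y * cexp W' g Y ^+ 2 - \sum_Y mu Y * cexp W g Y ^+ 2.
Proof.
move=> sub.
have e1 := cexpE g (@cexp_determined W g).
have e2 := cexpE g (determinedS sub (@cexp_determined W g)).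
have e3 : \sum_Y mu Y * (cexp W g Y * cexp W' g Y) =
    \sum_Y mu Y * cexp W g Y ^+ 2.
  by rewrite e2 -e1; apply: eq_bigr => Y _; rewrite expr2.
transitivity (\sum_Y mu Y * cexp W' g Y ^+ 2 + \sum_Y mu Y * cexp W g Y ^+ 2
    - 2 * \sum_Y mu Y * (cexp W g Y * cexp W' g Y)); last by rewrite e3; ring.
rewrite mulr_sumr -big_split -sumrB /=; apply: eq_bigr => Y _; ring.
Qed.

End CondExp.

(** * Entropy *)

Lemma ln_le_subr1 (R : realType) (x : R) : 0 < x -> ln x <= x - 1.
Proof.
move=> x0; rewrite -[X in ln X](subrKC 1) le_ln1Dx //; lra.
Qed.

(** Apply ln y <= y - 1 to the ratio of w t / m t to the ratio of the total
    masses. *)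
Lemma log_sum (R : realType) (T : finType) (m w : T -> R) :
  (forall t, 0 <= m t) -> (forall t, 0 <= w t) ->
  (forall t, 0 < m t -> 0 < w t) -> 0 < \sum_t m t ->
  \sum_t m t * ln (w t / m t) <=
  (\sum_t m t) * ln ((\sum_t w t) / (\sum_t m t)).
Proof.
move=> m0 w0 mw; set Z := \sum_t m t; set S := \sum_t w t => Z0.
have S0 : 0 < S.
  have [t mt] : exists t, 0 < m t.
    apply/existsP; apply: contraTT Z0 => /existsPn h; rewrite -leNgt.
    by apply: sumr_le0 => t _; rewrite leNgt h.
  by rewrite (lt_le_trans (mw _ mt)) // /S (bigD1 t) //= lerDl sumr_ge0.
have key t : m t * ln (w t / m t) <= m t * ln (S / Z) + (w t * (Z / S) - m t).
  have [->|mt] := eqVneq (m t) 0.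
    by rewrite !mul0r add0r subr0 mulr_ge0 // divr_ge0 // ltW.
  have {}mt : 0 < m t by rewrite lt0r mt m0.
  have wt := mw _ mt.
  have -> : ln (w t / m t) = ln (S / Z) + ln (w t * Z / (m t * S)).
    rewrite -lnM ?posrE ?divr_gt0 ?mulr_gt0 //; congr ln.
    by field; rewrite ?gt_eqF.
  rewrite mulrDr lerD2l.
  have h : 0 < w t * Z / (m t * S) by rewrite divr_gt0 ?mulr_gt0.
  apply: le_trans (ler_wpM2l (m0 t) (ln_le_subr1 h)) _.
  apply: le_of_eq; field.
  by rewrite ?gt_eqF.
apply: le_trans (ler_sum _ (fun t _ => key t)) _.
rewrite big_split sumrB /= -!mulr_suml -/Z -/S.
have -> : S * (Z / S) = Z by field; rewrite gt_eqF.
by rewrite subrr addr0.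
Qed.

(** * Conditioning a product measure on a decreasing event *)

Section Decreasing.
Variables (R : realType) (E : finType) (p : R) (A : pred {set E}).
Hypothesis p01 : 0 < p < 1.
Hypothesis A_decr : forall G G' : {set E}, G \subset G' -> A G' -> A G.
Implicit Types (g h : {set E} -> R) (G W S T Y U : {set E}).

(** Not normalised: the total mass is the probability of the event. *)
Definition condm G : R := (A G)%:R * prodm (fun=> p) G.
Local Notation mu := condm.

Definition present (u : E) G : R := (u \in G)%:R.
Definition contains T G : R := (T \subset G)%:R.

Let p01' : 0 <= p <= 1.
Proof. by case/andP: p01 => *; rewrite !ltW. Qed.

Lemma condm_ge0 G : 0 <= mu G.
Proof. by rewrite mulr_ge0 // prodm_ge0. Qed.
Hint Resolve condm_ge0 : core.

Lemma sum_toggle (u : E) (F : {set E} -> R) :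
  \sum_G F G = \sum_(G : {set E} | u \notin G) (F G + F (u |: G)).
Proof.
rewrite (bigID (fun G => u \notin G)) big_split /=; congr (_ + _).
rewrite (reindex_onto (fun G => u |: G) (fun G => G :\ u)) /=; last first.
  by move=> G; rewrite negbK => uG; rewrite setD1K.
apply: eq_bigl => G; rewrite negbK setU11 /=; apply/eqP/idP => [<-|uG].
  by rewrite !inE eqxx.
by rewrite setU1K.
Qed.

(** Adding u to a set only costs a factor p/(1-p), and can only leave the
    decreasing event; so u is present with probability at most p whatever
    is known about the other elements. *)
Lemma decreasing_present u h : (forall G, 0 <= h G) ->
  (forall G, h (u |: G) = h (G :\ u)) ->
  \sum_G mu G * (present u G * h G) <= p * \sum_G mu G * h G.
Proof.
move=> h0 hu; rewrite !(sum_toggle u) mulr_sumr; apply: ler_sum => G uG.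
rewrite /present setU11 (negbTE uG) mul0r mulr0 add0r mul1r.
have hE : h (u |: G) = h G.
  by rewrite hu; congr h; apply/setDidPl; rewrite disjoint_sym disjoints1.
rewrite hE -mulrDl mulrA ler_wpM2r //.
rewrite /condm /prodm (bigD1 u) // [X in (A G)%:R * X](bigD1 u) //=.
rewrite setU11 (negbTE uG) /=.
rewrite (eq_bigr (fun e => bern p (e \in G))); last first.
  by move=> e eu; rewrite !inE (negbTE eu).
set r := \prod_(e | _) _.
have r0 : 0 <= r by apply: prodr_ge0 => e _; apply: bern_ge0; exact: p01'.
case/andP: p01 => p0 p1.
have [AuG|_] := boolP (A (u |: G)).
  by rewrite (A_decr (subsetUr _ _) AuG) /=; nra.
rewrite mul0r addr0 mulr_ge0 ?mulr_ge0 //; try exact: ltW.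
by rewrite subr_ge0 ltW.
Qed.

Lemma determined_toggle W h u : determined W h -> u \notin W ->
  forall G, h (u |: G) = h (G :\ u).
Proof.
move=> hW uW G; apply: hW; apply/setP => e; rewrite !inE.
by case: eqVneq => //= ->; rewrite (negbTE uW) ?andbF.
Qed.

Lemma containsU1 u T G : contains (u |: T) G = present u G * contains T G.
Proof. by rewrite /contains /present subUset sub1set -natrM mulnb. Qed.

Lemma contains_determined T : determined T (contains T).
Proof.
move=> Y Y' e; rewrite /contains.
by rewrite -[T \subset Y]andbT -[T \subset Y']andbT -(subxx T) -!subsetI e.
Qed.

Lemma decreasing_contains W U h : (forall G, 0 <= h G) -> determined W h ->
  [disjoint U & W] ->
  \sum_G mu G * (contains U G * h G) <= p ^+ #|U| * \sum_G mu G * h G.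
Proof.
move=> h0 hW; have [k] := ubnP #|U|; elim: k U => // k IH U Uk dis.
have [->|[u uU]] := set_0Vmem U.
  rewrite cards0 expr0 mul1r; apply: le_of_eq.
  by apply: eq_bigr => G _; rewrite /contains sub0set mul1r.
have cU := cardsD1 u U; rewrite uU add1n in cU.
have dis' : [disjoint U :\ u & W].
  by apply: disjointWl dis; exact: subD1set.
have uW : u \notin W by rewrite (disjointFr dis).
have := IH (U :\ u); rewrite -ltnS -cU => /(_ Uk dis') {}IH.
rewrite cU exprS -mulrA.
case/andP: p01 => p0 p1.
have {}IH := ler_wpM2l (ltW p0) IH; refine (le_trans _ IH).
have -> : \sum_G mu G * (contains U G * h G) =
   \sum_G mu G * (present u G * (contains (U :\ u) G * h G)).
  by apply: eq_bigr => G _; rewrite -{1}(setD1K uU) containsU1 !mulrA.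
apply: decreasing_present; first by move=> G; rewrite mulr_ge0.
have hW' : determined ((U :\ u) :|: W) (fun G => contains (U :\ u) G * h G).
  move=> Y Y' e.
  rewrite (determinedS (subsetUl _ _) (@contains_determined _) e).
  by rewrite (determinedS (subsetUr _ _) hW e).
by apply: (determined_toggle hW'); rewrite !inE eqxx.
Qed.

Lemma mass_contains U :
  \sum_G mu G * contains U G <= p ^+ #|U| * \sum_G mu G.
Proof.
have dis : [disjoint U & (set0 : {set E})].
  by rewrite disjoints_subset setC0 subsetT.
have := @decreasing_contains set0 U (fun=> 1) (fun _ => ler01)
  (fun _ _ _ => erefl) dis.
by under eq_bigr do rewrite mulr1; under [X in _ <= _ * X]eq_bigr do rewrite mulr1.
Qed.

Definition cprob W u Y : R := cexp mu W (present u) Y.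

Lemma cprob_ge0 W u Y : 0 <= cprob W u Y.
Proof. by apply: cexp_ge0. Qed.

Lemma cprob_le W u Y : u \notin W -> cprob W u Y <= p.
Proof.
move=> uW; rewrite /cprob /cexp.
set M := \sum_(G | _) mu G.
have M0 : 0 <= M by apply: sumr_ge0.
case/andP: p01 => p0 p1.
have [->|Mn] := eqVneq M 0; first by rewrite invr0 mulr0 ltW.
rewrite ler_pdivrMr; last by rewrite lt0r Mn.
pose h G : R := (G :&: W == Y :&: W)%:R.
have hW : determined W h by move=> G G' e; rewrite /h e.
have h0 G : 0 <= h G by exact: ler0n.
have := decreasing_present h0 (determined_toggle hW uW).
have -> : \sum_G mu G * h G = M.
  rewrite /M [RHS]big_mkcond; apply: eq_bigr => G _; rewrite /h.
  by case: eqP; rewrite ?mulr1 ?mulr0.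
congr (_ <= _); rewrite [RHS]big_mkcond; apply: eq_bigr => G _; rewrite /h.
by case: eqP; rewrite ?mulr1 ?mulr0.
Qed.

Lemma cprob_le1 W u Y : cprob W u Y <= 1.
Proof. by apply: cexp_le_bound => // G _; rewrite lern1 leq_b1. Qed.

Lemma cprob_gt0 W u Y : 0 < mu Y -> u \in Y -> 0 < cprob W u Y.
Proof.
move=> mY uY; have pos (F : {set E} -> R) : (forall G, 0 <= F G) -> 0 < F Y ->
    0 < \sum_(G : {set E} | G :&: W == Y :&: W) F G.
  move=> F0 FY; rewrite (bigD1 Y) //= (lt_le_trans FY) // lerDl.
  exact: sumr_ge0.
rewrite divr_gt0 // pos // => [G|]; first by rewrite mulr_ge0.
by rewrite /present uY mulr1.
Qed.

(** Superadditivity of relative entropy, - ln Z being that of the conditioned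
    measure.  Compare the latter, by the log-sum inequality, with the measure
    that has independent elements of probability p on W and, given these, is
    the product of the conditional marginals. *)
Lemma cprob_entropy W (Z := \sum_G mu G) : 0 < Z ->
  \sum_Y mu Y * (\sum_(u | u \notin W) relent p (cprob W u Y)) <= - (Z * ln Z).
Proof.
move=> Z0; case/andP: (p01) => p0 p1.
have p1' : 0 < 1 - p by rewrite subr_gt0.
pose th u Y := if u \in W then p else cprob W u Y.
have th01 u Y : 0 <= th u Y <= 1.
  rewrite /th; case: ifP => _; first exact: p01'.
  by rewrite cprob_ge0 cprob_le1.
have thp u Y : th u Y <= p.
  by rewrite /th; case: ifPn => // uW; exact: cprob_le.
pose w Y := prodm (th^~ Y) Y.
have w0 Y : 0 <= w Y by exact: prodm_ge0.
have bern_gt0 u Y : 0 < mu Y -> 0 < bern (th u Y) (u \in Y).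
  move=> mY; rewrite /bern; case: ifPn => uY; last first.
    by rewrite subr_gt0 (le_lt_trans (thp _ _)).
  by rewrite /th; case: ifP => // _; exact: cprob_gt0.
have mw Y : 0 < mu Y -> 0 < w Y.
  by move=> mY; apply: prodr_gt0 => u _; exact: bern_gt0.
have sw : \sum_Y w Y = 1.
  rewrite (partition_big (fun G => G :&: W) xpredT) //=.
  transitivity (\sum_S \sum_(G : {set E} | G :&: W == S) prodm (fun=> p) G).
    apply: eq_bigr => S _.
    transitivity (\sum_(G : {set E} | G :&: W == S) prodm (th^~ S) G).
      apply: eq_bigr => G /eqP <-; apply: eq_bigr => u _.
      rewrite /th; case: ifP => // _; congr bern.
      by apply: cexp_determined; rewrite -setIA setIid.
    by apply: prodm_marginal => u uW; rewrite /th uW.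
  have := sum_prodm (fun=> p : R) (E := E).
  by rewrite (partition_big (fun G : {set E} => G :&: W) xpredT).
have := log_sum condm_ge0 w0 mw Z0.
rewrite sw -/Z div1r lnV ?posrE // mulrN; apply: le_trans.
apply: le_of_eq.
transitivity (\sum_Y mu Y * \sum_(u | u \notin W)
    (present u Y * ln (cprob W u Y / p) +
     (1 - present u Y) * ln ((1 - cprob W u Y) / (1 - p)))).
  under eq_bigr do rewrite mulr_sumr.
  under [RHS]eq_bigr do rewrite mulr_sumr.
  rewrite exchange_big [RHS]exchange_big /=; apply: eq_bigr => u uW.
  pose a Y := ln (cprob W u Y / p); pose b Y := ln ((1 - cprob W u Y) / (1 - p)).
  have aW : determined W a by move=> Y Y' e; rewrite /a /cprob (cexp_determined _ _ e).
  have bW : determined W b by move=> Y Y' e; rewrite /b /cprob (cexp_determined _ _ e).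
  have ea := cexpE condm_ge0 (present u) aW.
  have eb := cexpE condm_ge0 (present u) bW.
  transitivity (\sum_Y mu Y * (a Y * cprob W u Y) + \sum_Y mu Y * b Y -
     \sum_Y mu Y * (b Y * cprob W u Y)).
    rewrite -big_split -sumrB; apply: eq_bigr => Y _ /=.
    by rewrite /relent -/(a Y) -/(b Y); ring.
  rewrite ea eb -big_split -sumrB; apply: eq_bigr => Y _ /=.
  by rewrite -/(a Y) -/(b Y); ring.
apply: eq_bigr => Y _.
have [->|mY] := eqVneq (mu Y) 0; first by rewrite !mul0r.
have {}mY : 0 < mu Y by rewrite lt0r mY condm_ge0.
have AY : A Y by move: mY; rewrite /condm; case: (A Y) => //; rewrite mul0r ltxx.
congr (_ * _); rewrite {1}/condm AY mul1r /w /prodm -prodf_div.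
have lnprod (F : E -> R) : (forall e, 0 < F e) ->
    ln (\prod_e F e) = \sum_e ln (F e).
  move=> F0; suff [] : 0 < \prod_e F e /\ ln (\prod_e F e) = \sum_e ln (F e) by [].
  apply: (big_ind2 (fun x y => 0 < x /\ ln x = y)); first by rewrite ln1.
    move=> x1 x2 y1 y2 [x10 <-] [y10 <-]; split; first exact: mulr_gt0.
    by rewrite lnM ?posrE.
  by move=> e _.
rewrite lnprod; last first.
  move=> e; rewrite divr_gt0 ?bern_gt0 // /bern; case: ifP => // _.
rewrite [RHS](bigID (fun u => u \in W)) /= [X in _ = X + _]big1 ?add0r; last first.
  move=> u uW; rewrite /th uW divff ?ln1 // gt_eqF // /bern.
  by case: ifP => // _.
apply: eq_bigr => u uW; rewrite /th (negbTE uW) /bern /present.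
by case: (u \in Y); rewrite /= ?subrr ?subr0 ?mul1r ?mul0r ?addr0 ?add0r.
Qed.

End Decreasing.

(** * Near independence of the conditioned set *)

Section Prefix.
Variables (E : finType) (u0 : E).
Implicit Types s : seq E.

Definition prefix s i : {set E} := [set x in take i s].

Lemma prefix0 s : prefix s 0 = set0.
Proof. by apply/setP => x; rewrite !inE take0. Qed.

Lemma prefixS s i : (i < size s)%N -> prefix s i.+1 = nth u0 s i |: prefix s i.
Proof.
by move=> si; apply/setP => x; rewrite !inE (take_nth u0 si) mem_rcons inE.
Qed.

Lemma card_prefix s i : uniq s -> (i <= size s)%N -> #|prefix s i| = i.
Proof.
move=> us si; rewrite /prefix cardsE (card_uniqP _) ?take_uniq //.
by rewrite size_take; case: ltngtP si => // ->.
Qed.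

Lemma subset_prefix s i j : (i <= j)%N -> prefix s i \subset prefix s j.
Proof.
move=> ij; apply/subsetP => x; rewrite !inE => /(mem_subseq _); apply.
by rewrite -(subnK ij) addnC takeD; exact: prefix_subseq.
Qed.

Lemma nth_prefix s i j : uniq s -> (j < size s)%N ->
  (nth u0 s j \in prefix s i) = (j < i)%N.
Proof.
move=> us js; rewrite inE; case: (ltnP j i) => ij.
  by rewrite -(nth_take u0 ij) mem_nth // size_take; case: ifP => // _; lia.
apply/negbTE; apply/negP => /(nthP u0) [k]; rewrite size_take => ki.
have {ki} [ki ks] : (k < i)%N /\ (k < size s)%N.
  by move: ki; case: ifP; lia.
rewrite nth_take // => /eqP; rewrite nth_uniq // => /eqP kj; lia.
Qed.

End Prefix.

Lemma contains_ge0 (R : realType) (E : finType) (T G : {set E}) :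
  0 <= contains R T G.
Proof. exact: ler0n. Qed.

Section Telescope.
Variables (R : realType) (E : finType) (p : R) (A : pred {set E}).
Hypothesis p01 : 0 < p < 1.
Hypothesis A_decr : forall G G' : {set E}, G \subset G' -> A G' -> A G.
Variable u0 : E.
Implicit Types (G W Y : {set E}) (s : seq E).
Local Notation mu := (condm p A).
Local Notation cprob := (cprob p A).
Let Z := \sum_G mu G.
Let mu_ge0 G : 0 <= mu G. Proof. exact: condm_ge0. Qed.
Hint Resolve mu_ge0 : core.

(** The influence of the i-th entry of s on the conditional probability of the
    j-th, when W and the entries before the i-th are revealed. *)
Definition shift W s i j Y : R :=
  cprob (W :|: prefix s i.+1) (nth u0 s j) Y -
  cprob (W :|: prefix s i) (nth u0 s j) Y.

Definition sqshift W s i j : R :=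
  \sum_Y mu Y * (contains R (prefix s i.+1) Y * shift W s i j Y ^+ 2).

Lemma shift_determined W s i j :
  determined (W :|: prefix s i.+1) (shift W s i j).
Proof.
move=> Y Y' e; rewrite /shift {1 3}/cprob (cexp_determined _ _ e).
congr (_ - _); apply: cexp_determined.
have sub : W :|: prefix s i \subset W :|: prefix s i.+1.
  by apply: setUS; exact: subset_prefix.
by rewrite -(setIidPr sub) !setIA e.
Qed.

(** The shift is determined by W and the first i + 1 entries, so by
    decreasing_contains each of the entries i + 1, ..., j - 1 saves a factor
    p. *)
Lemma prefix_shift W s i j : uniq s -> (j < size s)%N ->
  {in s, forall u, u \notin W} -> (i < j)%N ->
  \sum_Y mu Y * (contains R (prefix s j) Y * `|shift W s i j Y|) <=
  p ^+ (j - i.+1) *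
    \sum_Y mu Y * (contains R (prefix s i.+1) Y * `|shift W s i j Y|).
Proof.
move=> us js sW ij.
pose h Y := contains R (prefix s i.+1) Y * `|shift W s i j Y|.
have h0 Y : 0 <= h Y by rewrite mulr_ge0 ?contains_ge0.
have hW : determined (W :|: prefix s i.+1) h.
  move=> Y Y' e; rewrite /h (@shift_determined W s i j _ _ e).
  by rewrite (determinedS (subsetUr _ _) (@contains_determined R E _) e).
have dis : [disjoint prefix s j :\: prefix s i.+1 & W :|: prefix s i.+1].
  rewrite disjoints_subset; apply/subsetP => x; rewrite !inE.
  by case/andP => xi /mem_take xs; rewrite negb_or sW.
have := decreasing_contains p01 A_decr h0 hW dis.
rewrite cardsDS ?subset_prefix // !card_prefix //; try lia.
apply: le_trans; apply: le_of_eq.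
apply: eq_bigr => Y _; rewrite /h; congr (_ * _).
rewrite mulrA; congr (_ * _); rewrite /contains -natrM mulnb -subUset.
by rewrite setUC setDE setUIr setUCr setIT (setUidPr (subset_prefix _ _)).
Qed.

Lemma cexp_contains_prod W s j : uniq s -> (j <= size s)%N ->
  {in s, forall u, u \notin W} ->
  \sum_Y mu Y * `|cexp mu W (contains R (prefix s j)) Y -
                  \prod_(k < j) cprob W (nth u0 s k) Y| <=
  \sum_(k < j) \sum_(i < k) p ^+ (j - i.+2) *
    \sum_Y mu Y * (contains R (prefix s i.+1) Y * `|shift W s i k Y|).
Proof.
move=> us + sW; case/andP: (p01) => p0 p1; elim: j => [_|j IH js].
  rewrite big_ord0 big1 // => Y _; rewrite big_ord0 prefix0.
  have [->|mY] := eqVneq (mu Y) 0; first by rewrite mul0r.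
  rewrite (_ : cexp _ _ _ _ = 1) ?subrr ?normr0 ?mulr0 //.
  rewrite /cexp; set M := \sum_(G | _) mu G.
  rewrite (_ : \sum_(_ | _) _ = M) ?divff //.
    by apply: contraNneq mY => /(mass_class_eq0 mu_ge0) ->.
  by apply: eq_bigr => G _; rewrite /contains sub0set mulr1.
pose B := \sum_(i < j) p ^+ (j - i.+1) *
   \sum_Y mu Y * (contains R (prefix s i.+1) Y * `|shift W s i j Y|).
apply: (@le_trans _ _ (p * (\sum_Y mu Y * `|cexp mu W (contains R (prefix s j)) Y -
     \prod_(k < j) cprob W (nth u0 s k) Y|) + B)); last first.
  rewrite big_ord_recr /= [X in _ <= _ + X](_ : _ = B) ?lerD2r; last first.
    by apply: eq_bigr => i _; rewrite subSS.
  apply: (le_trans (ler_wpM2l (ltW p0) (IH (ltnW js)))).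
  rewrite mulr_sumr; apply: ler_sum => k _; rewrite mulr_sumr.
  apply: ler_sum => i _; rewrite mulrA -exprS -subSn //.
  by have := ltn_ord i; have := ltn_ord k; lia.
pose v := nth u0 s j.
have vW : v \notin W by rewrite sW // mem_nth.
have main : \sum_Y mu Y * (contains R (prefix s j) Y *
    `|cprob (W :|: prefix s j) v Y - cprob W v Y|) <= B.
  rewrite /B; apply: (@le_trans _ _ (\sum_(i < j) \sum_Y mu Y *
     (contains R (prefix s j) Y * `|shift W s i j Y|))); last first.
    by apply: ler_sum => i _; exact: prefix_shift.
  rewrite exchange_big /=; apply: ler_sum => Y _; rewrite -!mulr_sumr.
  rewrite ler_wpM2l // ler_wpM2l ?contains_ge0 //.
  apply: le_trans (ler_norm_sum _ _ _).
  have := telescope_sumr (fun i => cprob (W :|: prefix s i) v Y) (leq0n j).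
  by rewrite big_mkord prefix0 setU0 => <-.
rewrite mulr_sumr -lerBlDl; apply: le_trans main.
rewrite -[X in _ <= X](cexp_mean mu_ge0 W) -sumrB; apply: ler_sum => Y _.
rewrite mulrCA -mulrBr ler_wpM2l // lerBlDr.
rewrite big_ord_recr /=.
have -> : cexp mu W (contains R (prefix s j.+1)) Y =
    cexp mu W (fun G => contains R (prefix s j) G * cprob (W :|: prefix s j) v G) Y.
  have cW : determined (W :|: prefix s j) (contains R (prefix s j)).
    by apply: determinedS (@contains_determined R E _); exact: subsetUr.
  rewrite (cexp_tower mu_ge0 (present R v) Y (subsetUl _ _) cW).
  by apply: eq_cexp => G; rewrite (prefixS u0) // containsU1 mulrC.
set c := cexp mu W (contains R (prefix s j)) Y.
set P := \prod_(_ < _) _.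
apply: (@le_trans _ _ (`|cexp mu W (fun G => contains R (prefix s j) G *
   (cprob (W :|: prefix s j) v G - cprob W v G)) Y| +
   `|(c - P) * cprob W v Y|)).
  apply: le_trans (ler_normD _ _); apply: le_of_eq.
  congr `|_|; rewrite [X in _ = X + _](_ : _ = cexp mu W (fun G =>
     contains R (prefix s j) G * cprob (W :|: prefix s j) v G -
     contains R (prefix s j) G * cprob W v G) Y); last first.
    by apply: eq_cexp => G; rewrite mulrBr.
  rewrite cexpB (@cexp_pull _ _ _ _ _ (cprob W v)); first by rewrite /c; ring.
  exact: cexp_determined.
apply: lerD.
  apply: le_trans (normr_cexp mu_ge0 _ _ _) _.
  apply: le_of_eq; apply: eq_cexp => G.
  by rewrite normrM ger0_norm ?contains_ge0.
rewrite normrM (ger0_norm (cprob_ge0 A p01 W v Y)) // mulrC ler_wpM2r //.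
exact: cprob_le.
Qed.

(** The defect of independence of the entries of s is controlled by the
    influence of each entry on the probability of each later one.  Influences
    enter squared, so that they can be bounded by the growth of a second
    moment; theta > 0 is free. *)
Lemma cexp_contains_prod_sq W s (theta : R) : uniq s ->
  {in s, forall u, u \notin W} -> 0 < theta ->
  \sum_Y mu Y * `|cexp mu W (contains R [set x in s]) Y -
                  \prod_(k < size s) cprob W (nth u0 s k) Y| <=
  \sum_(k < size s) \sum_(i < k) (theta * p ^+ size s * Z +
    p ^+ (size s - i.+2) / (theta * p) * sqshift W s i k).
Proof.
move=> us sW th0; case/andP: (p01) => p0 p1.
have := cexp_contains_prod us (leqnn _) sW.
rewrite {1}/prefix take_size; move/le_trans; apply.
apply: ler_sum => k _; apply: ler_sum => i _.
have ik := ltn_ord i; have ks := ltn_ord k.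
have tp : 0 < theta * p by rewrite mulr_gt0.
have -> : theta * p ^+ size s * Z = p ^+ (size s - i.+2) *
    (theta * p * (p ^+ i.+1 * Z)).
  have {1}-> : size s = (size s - i.+2 + (1 + i.+1))%N by lia.
  by rewrite !exprD expr1; ring.
rewrite -[_ / _ * _]mulrA -mulrDr ler_wpM2l ?exprn_ge0 ?(ltW p0) //.
have := mass_contains p01 A_decr (prefix s i.+1).
rewrite card_prefix //; last lia.
move/(ler_wpM2l (ltW tp)) => h; refine (le_trans _ (lerD h (lexx _))).
rewrite /sqshift !mulr_sumr -big_split /=; apply: ler_sum => Y _.
rewrite !(mulrCA _ (mu Y)) -mulrDr ler_wpM2l //.
rewrite !(mulrCA _ (contains R (prefix s i.+1) Y)) [_ * contains _ _ _]mulrC.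
rewrite -mulrDr ler_wpM2l ?contains_ge0 //.
rewrite -real_normK ?num_real //; set x := `|_|.
have x0 : 0 <= x by exact: normr_ge0.
have [xt|/ltW tx] := leP x (theta * p).
  by rewrite (le_trans xt) // lerDl mulr_ge0 ?invr_ge0 ?sqr_ge0 // ltW.
have : x <= (theta * p)^-1 * x ^+ 2.
  by rewrite ler_pdivlMl // expr2 ler_wpM2r.
by move/le_trans; apply; rewrite lerDr ltW.
Qed.

End Telescope.

(** * Averaging a bounded potential over the subsets of a given size *)

Section Layers.
Variables (R : realType) (E : finType) (F : {set E} -> R) (B : R).
Hypothesis F_ge0 : forall W, 0 <= F W.
Hypothesis F_le : forall W, F W <= B.
Hypothesis F_mono : forall (W : {set E}) (v : E), v \notin W -> F W <= F (v |: W).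
Implicit Types (W : {set E}) (v : E).
Local Notation N := #|E|.

Definition growth t : R :=
  \sum_(W : {set E} | #|W| == t) \sum_(v | v \notin W) (F (v |: W) - F W).

Definition layer_mean t : R :=
  (\sum_(W : {set E} | #|W| == t) F W) / 'C(N, t)%:R.

Lemma sum_layer_succ t :
  \sum_(W : {set E} | #|W| == t) \sum_(v | v \notin W) F (v |: W) =
  t.+1%:R * \sum_(W : {set E} | #|W| == t.+1) F W.
Proof.
rewrite (exchange_big_dep xpredT) //=.
transitivity (\sum_v \sum_(W : {set E} | (#|W| == t.+1) && (v \in W)) F W).
  apply: eq_bigr => v _.
  rewrite [RHS](reindex_onto (fun W => v |: W) (fun W => W :\ v)) /=; last first.
    by move=> W /andP[_ vW]; rewrite setD1K.
  apply: eq_bigl => W; rewrite setU11 andbT.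
  have [vW|vW] := boolP (v \in W).
    rewrite andbF; apply/esym/negbTE; rewrite negb_and; apply/orP; right.
    by apply/eqP => /setP /(_ v); rewrite !inE eqxx vW.
  by rewrite setU1K // eqxx cardsU1 vW add1n eqSS.
rewrite (exchange_big_dep (fun W : {set E} => #|W| == t.+1)) /=; last first.
  by move=> v W _ /andP[].
rewrite mulr_sumr; apply: eq_bigr => W /eqP Wt.
by rewrite Wt eqxx /= sumr_const Wt mulr_natl.
Qed.

Lemma growth_le t : (t < N)%N ->
  0 <= growth t <= N%:R * 'C(N, t)%:R * (layer_mean t.+1 - layer_mean t).
Proof.
move=> tN.
have g0 : 0 <= growth t.
  by apply: sumr_ge0 => W _; apply: sumr_ge0 => v vW; rewrite subr_ge0 F_mono.
rewrite g0 /=.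
have gE : growth t = (N - t)%:R * 'C(N, t)%:R * (layer_mean t.+1 - layer_mean t).
  have c1 : 'C(N, t)%:R != 0 :> R by rewrite pnatr_eq0 -lt0n bin_gt0 ltnW.
  have c2 : 'C(N, t.+1)%:R != 0 :> R by rewrite pnatr_eq0 -lt0n bin_gt0.
  have cE : (N - t)%:R * 'C(N, t)%:R = t.+1%:R * 'C(N, t.+1)%:R :> R.
    by rewrite -!natrM mul_bin_left.
  rewrite mulrBr {1}cE /layer_mean.
  rewrite /growth; under eq_bigr do rewrite sumrB.
  rewrite sumrB sum_layer_succ; congr (_ - _).
    by rewrite -mulrA (mulrC 'C(_, _)%:R) divfK.
  rewrite -mulrA (mulrC 'C(_, _)%:R) divfK // mulrC mulr_suml.
  apply: eq_bigr => W /eqP Wt; rewrite sumr_const mulr_natr; congr (_ *+ _).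
  have <- : #|~: W| = (N - t)%N by rewrite cardsCs setCK Wt.
  by apply: eq_card => v; rewrite !inE.
rewrite gE; apply: ler_wpM2r.
  move: g0; rewrite gE pmulr_rge0 // mulr_gt0 // ltr0n ?subn_gt0 //.
  by rewrite bin_gt0 ltnW.
by rewrite ler_wpM2r // ler_nat leq_subr.
Qed.

Lemma layer_mean_bounds t : (t <= N)%N -> 0 <= layer_mean t <= B.
Proof.
move=> tN; rewrite divr_ge0 ?sumr_ge0 //=.
have c1 : 0 < 'C(N, t)%:R :> R by rewrite ltr0n bin_gt0.
rewrite ler_pdivrMr // (le_trans (ler_sum _ (fun W _ => F_le W))) //.
by rewrite sumr_const -card_draws cardsE mulr_natr.
Qed.

(** The layer means increase and stay between 0 and B, so the windows of r
    layers that start at M, ..., 2M - 1 have total increase at most r B. *)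
Lemma exists_slow_window r M : (0 < M)%N -> (M.*2 + r <= N)%N ->
  exists2 t, (M <= t < M.*2)%N & forall i, (i < r)%N ->
    growth (t + i) <= 'C(N, t + i)%:R * (N%:R * (r%:R * B) / M%:R).
Proof.
move=> M0 MN; pose c := r%:R * B / M%:R.
have M0' : 0 < M%:R :> R by rewrite ltr0n.
pose a k : R := layer_mean k.+1 - layer_mean k.
have a0 k : (k < N)%N -> 0 <= a k.
  move=> kN; have /andP[g0 /(le_trans g0)] := growth_le kN.
  by rewrite pmulr_rge0 // mulr_gt0 // ltr0n ?bin_gt0 ?(leq_trans _ kN) // ltnW.
suff [t tM ta] : exists2 t, (M <= t < M.*2)%N & \sum_(i < r) a (t + i)%N <= c.
  exists t => // i ir.
  have tiN : (t + i < N)%N by lia.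
  have /andP[_ /le_trans] := growth_le tiN; apply.
  rewrite [X in _ <= X](_ : _ = N%:R * 'C(N, t + i)%:R * c); last by rewrite /c; ring.
  rewrite ler_wpM2l ?mulr_ge0 //.
  apply: le_trans ta; rewrite (bigD1 (Ordinal ir)) //= lerDl.
  by apply: sumr_ge0 => k _; apply: a0; have := ltn_ord k; lia.
apply: contrapT => no.
have big_c t : (M <= t < M.*2)%N -> c < \sum_(i < r) a (t + i)%N.
  by move=> tM; rewrite ltNge; apply/negP => h; apply: no; exists t.
have : \sum_(M <= t < M.*2) c < \sum_(M <= t < M.*2) \sum_(i < r) a (t + i)%N.
  by apply: ltr_sum_nat => //; rewrite -addnn -addn1 leq_add2l.
rewrite ltNge => /negP; apply.
rewrite exchange_big /= sumr_const_nat -addnn addnK.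
have -> : c *+ M = \sum_(i < r) B.
  by rewrite sumr_const card_ord /c -mulr_natr -[in RHS]mulr_natl divfK ?gt_eqF.
apply: ler_sum => i _; have ir := ltn_ord i.
rewrite (eq_bigr (fun t => layer_mean (t.+1 + i)%N - layer_mean (t + i)%N)); last first.
  by move=> t _; rewrite /a addSn.
rewrite (telescope_sumr (fun t => layer_mean (t + i)%N)) ?leq_addr //.
have /andP[_ h1] : 0 <= layer_mean (M + M + i)%N <= B.
  by apply: layer_mean_bounds; lia.
have /andP[h2 _] : 0 <= layer_mean (M + i)%N <= B.
  by apply: layer_mean_bounds; lia.
by rewrite lerBlDr (le_trans h1) // lerDl.
Qed.

End Layers.

(** * A small set whose revelation makes the rest nearly independent *)

Section Potential.
Variables (R : realType) (E : finType) (p : R) (A : pred {set E}).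
Hypothesis p01 : 0 < p < 1.
Hypothesis A_decr : forall G G' : {set E}, G \subset G' -> A G' -> A G.
Implicit Types (G W Y : {set E}) (u v : E).
Local Notation mu := (condm p A).
Local Notation cprob := (cprob p A).
Local Notation Z := (\sum_G mu G).
Let mu_ge0 G : 0 <= mu G. Proof. exact: condm_ge0. Qed.
Hint Resolve mu_ge0 : core.
Let p_gt0 : 0 < p. Proof. by case/andP: p01. Qed.

(** A revealed element counts for p^2 Z, the largest possible contribution of
    an element still hidden, rather than for its second moment, which is of
    order p: this keeps the potential below #|E| p^2 Z. *)
Definition potential W : R :=
  \sum_u (if u \in W then p ^+ 2 * Z else \sum_Y mu Y * cprob W u Y ^+ 2).

Lemma mass_ge0 : 0 <= Z. Proof. exact: sumr_ge0. Qed.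

Lemma second_moment_le W u : u \notin W ->
  \sum_Y mu Y * cprob W u Y ^+ 2 <= p ^+ 2 * Z.
Proof.
move=> uW; rewrite mulr_sumr; apply: ler_sum => Y _; rewrite mulrC ler_wpM2r //.
by rewrite lerXn2r ?nnegrE ?cprob_ge0 ?cprob_le // ltW.
Qed.

Lemma potential_ge0 W : 0 <= potential W.
Proof.
apply: sumr_ge0 => u _; case: ifP => _.
  by rewrite mulr_ge0 ?mass_ge0 // exprn_ge0 // ltW.
by apply: sumr_ge0 => Y _; rewrite mulr_ge0 ?sqr_ge0.
Qed.

Lemma potential_le W : potential W <= #|E|%:R * (p ^+ 2 * Z).
Proof.
rewrite [X in _ <= X](_ : _ = \sum_(u : E) p ^+ 2 * Z).
  by apply: ler_sum => u _; case: ifPn => // uW; exact: second_moment_le.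
by rewrite sumr_const mulr_natl.
Qed.

Lemma potential_growth W v : v \notin W ->
  \sum_(u | u \notin v |: W)
     \sum_Y mu Y * (cprob (v |: W) u Y - cprob W u Y) ^+ 2 <=
  potential (v |: W) - potential W.
Proof.
move=> vW; rewrite -sumrB [X in _ <= X](bigID (fun u => u \in v |: W)) /= -[X in X <= _]add0r.
apply: lerD; last first.
  apply: ler_sum => u uvW; rewrite (negbTE uvW).
  have /negbTE -> : u \notin W by apply: contra uvW; exact: setU1r.
  by rewrite (cexp_pythagoras mu_ge0) // subsetUr.
apply: sumr_ge0 => u ->; case: ifPn => uW; first by rewrite subrr.
by rewrite subr_ge0 second_moment_le.
Qed.

Lemma potential_mono W v : v \notin W -> potential W <= potential (v |: W).
Proof.
move=> vW; rewrite -subr_ge0; apply: le_trans (potential_growth vW).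
by do 2![apply: sumr_ge0 => ? _]; rewrite mulr_ge0 ?sqr_ge0.
Qed.

End Potential.

Section Counting.
Variables (R : realType) (E J : finType) (p : R) (A : pred {set E}).
Hypothesis p01 : 0 < p < 1.
Hypothesis A_decr : forall G G' : {set E}, G \subset G' -> A G' -> A G.
Variables (I : {set J}) (x : J -> {set E}) (r : nat) (kappa : R) (u0 : E).
Hypothesis x_card : {in I, forall S, #|x S| = r}.
Hypothesis x_codeg : forall T : {set E}, (2 <= #|T|)%N ->
  #|[set S in I | T \subset x S]|%:R <=
    kappa * p ^+ #|T|.-1 * (#|I|%:R / #|E|%:R).
Hypothesis kappa_ge0 : 0 <= kappa.
Implicit Types (G W Y : {set E}) (u v w : E) (S : J).
Local Notation mu := (condm p A).
Local Notation cprob := (cprob p A).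
Local Notation Z := (\sum_G mu G).
Local Notation ent i S := (nth u0 (enum (x S)) i).
Local Notation pre i S := (prefix (enum (x S)) i).
Local Notation D := (#|I|%:R / #|E|%:R).
Let mu_ge0 G : 0 <= mu G. Proof. exact: condm_ge0. Qed.
Hint Resolve mu_ge0 : core.
Let p_gt0 : 0 < p. Proof. by case/andP: p01. Qed.

Lemma size_enumx S : S \in I -> size (enum (x S)) = r.
Proof. by move=> SI; rewrite -cardE x_card. Qed.

Lemma mean_degree_ge0 : 0 <= D :> R. Proof. by rewrite divr_ge0. Qed.

Lemma codegree_bound_ge0 n : 0 <= kappa * p ^+ n * D.
Proof.
apply: mulr_ge0; last exact: mean_degree_ge0; apply: mulr_ge0 => //.
by rewrite exprn_ge0 // ltW.
Qed.

Lemma prefix_sub i S : pre i S \subset x S.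
Proof. by apply/subsetP => u; rewrite inE => /mem_take; rewrite mem_enum. Qed.

(** Two edges with the same i-th and j-th entries, whose prefixes meet in O,
    share #|O| + 1 >= 2 vertices; the codegree condition then makes up for
    the p ^- #|O| lost in the overlap. *)
Lemma pair_count i j S : S \in I -> (i < j)%N -> (j < r)%N ->
  \sum_(S' in I | (ent i S' == ent i S) && (ent j S' == ent j S))
     p ^+ #|pre i.+1 S :|: pre i.+1 S'| <=
  (2 ^ r)%:R * kappa * p ^+ (i.+1).*2 * D.
Proof.
move=> SI ij jr; have us S' : uniq (enum (x S')) := enum_uniq _.
have szS := size_enumx SI.
have cS : #|pre i.+1 S| = i.+1 by rewrite card_prefix // szS; lia.
rewrite (partition_big (fun S' => pre i.+1 S :&: pre i.+1 S')
  (fun O : {set E} => (O \subset pre i.+1 S) && (ent i S \in O))) /=; last first.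
  move=> S' /andP[S'I /andP[/eqP ei _]]; rewrite subsetIl inE.
  rewrite nth_prefix ?szS ?ltnSn //=; last lia.
  by rewrite -ei nth_prefix ?ltnSn ?size_enumx //; lia.
apply: (@le_trans _ _ (\sum_(O : {set E} | O \subset pre i.+1 S)
    kappa * p ^+ (i.+1).*2 * D)); last first.
  rewrite sumr_const -[_ *+ _]mulr_natl -!(mulrA (2 ^ r)%:R) ler_wpM2r //.
    exact: codegree_bound_ge0.
  rewrite ler_nat (_ : #|_| = #|powerset (pre i.+1 S)|); last first.
    by apply: eq_card => O; rewrite [RHS]inE.
  rewrite card_powerset cS leq_exp2l //; lia.
rewrite [X in X <= _]big_mkcond [X in _ <= X]big_mkcond /=.
apply: ler_sum => O _; case: ifP => [/andP[OS eO]|_]; last first.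
  case: ifP => // _; exact: codegree_bound_ge0.
rewrite OS.
have O1 : (0 < #|O|)%N by apply/card_gt0P; exists (ent i S).
have Oi : (#|O| <= i.+1)%N by rewrite -cS subset_leq_card.
have jO : ent j S \notin O.
  apply/negP => /(subsetP OS); rewrite nth_prefix ?szS //; lia.
pose T := ent j S |: O.
have cT : #|T| = #|O|.+1 by rewrite cardsU1 jO.
have codeg := x_codeg (T := T); rewrite cT /= in codeg.
apply: (@le_trans _ _ (\sum_(S' in [set S' in I | T \subset x S'])
    p ^+ ((i.+1).*2 - #|O|))).
  rewrite [X in _ <= X]big_mkcond [X in X <= _]big_mkcond /=.
  apply: ler_sum => S' _; case: ifP; last first.
    by move=> _; case: ifP => // _; rewrite exprn_ge0 // ltW.
  case/andP => /andP[S'I /andP[_ /eqP ej]] /eqP eO'.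
  rewrite !inE S'I subUset sub1set -ej -mem_enum mem_nth ?size_enumx //=.
  rewrite -{1}eO' (subset_trans (subsetIr _ _) (prefix_sub _ _)).
  rewrite cardsU eO' cS card_prefix ?size_enumx //; last lia.
  by rewrite addnn.
rewrite sumr_const -[_ *+ _]mulr_natl.
have pk : 0 <= p ^+ ((i.+1).*2 - #|O|) by rewrite exprn_ge0 // ltW.
apply: (le_trans (ler_wpM2r pk (codeg O1))).
have -> : kappa * p ^+ (i.+1).*2 * D =
   kappa * p ^+ #|O| * D * p ^+ ((i.+1).*2 - #|O|); last by [].
have {1}-> : (i.+1).*2 = (#|O| + ((i.+1).*2 - #|O|))%N by lia.
by rewrite exprD; ring.
Qed.

(** The squared influence sqshift of the i-th entry of x S on the j-th, with
    the first i entries absorbed in W. *)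
Definition pair_shift W i j S : R :=
  \sum_Y mu Y * (contains R (pre i.+1 S) Y *
     (cprob (ent i S |: W) (ent j S) Y - cprob W (ent j S) Y) ^+ 2).

(** The number of edges with given i-th and j-th entries w and u and with
    present prefix is at most T most of the time, T being a small multiple of
    the expected number, by the second moment bound pair_count; and the
    influences of w on u, each counted once, are paid by the growth of the
    potential. *)
Lemma sum_pair_shift W i j (T : R) : (i < j)%N -> (j < r)%N -> 0 < T ->
  \sum_(S in I | (ent i S \notin W) && (ent j S \notin W)) pair_shift W i j S <=
  T * \sum_(w | w \notin W) (potential p A (w |: W) - potential p A W) +
  p ^+ 2 / T * (Z * #|I|%:R * ((2 ^ r)%:R * kappa * p ^+ (i.+1).*2 * D)).
Proof.
move=> ij jr T0.
pose cnt (w u : E) Y := \sum_(S in I | (ent i S == w) && (ent j S == u))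
   contains R (pre i.+1 S) Y.
pose d w u Y := (cprob (w |: W) u Y - cprob W u Y) ^+ 2.
have ent_neq S : S \in I -> ent j S != ent i S.
  by move=> SI; rewrite nth_uniq ?enum_uniq ?size_enumx //; lia.
have cnt_ge0 w u Y : 0 <= cnt w u Y.
  by apply: sumr_ge0 => S _; exact: contains_ge0.
have cnt_le w u Y : cnt w u Y <= T + cnt w u Y ^+ 2 / T.
  have [h|/ltW h] := leP (cnt w u Y) T.
    by rewrite (le_trans h) // lerDl divr_ge0 ?sqr_ge0 // ltW.
  apply: (@le_trans _ _ (cnt w u Y ^+ 2 / T)); last by rewrite lerDr ltW.
  by rewrite ler_pdivlMr // expr2 ler_wpM2l.
have d_le w u Y : u \notin w |: W -> d w u Y <= p ^+ 2.
  move=> uwW; have uW : u \notin W by apply: contra uwW; exact: setU1r.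
  have := cprob_ge0 A p01 (w |: W) u Y; have := cprob_ge0 A p01 W u Y.
  have := cprob_le p01 A_decr Y uwW; have := cprob_le p01 A_decr Y uW.
  by rewrite /d; nra.
have d_ge0 w u Y : 0 <= d w u Y by exact: sqr_ge0.
have -> : \sum_(S in I | (ent i S \notin W) && (ent j S \notin W)) pair_shift W i j S =
    \sum_(w | w \notin W) \sum_(u | u \notin w |: W)
       \sum_Y mu Y * (cnt w u Y * d w u Y).
  rewrite (partition_big (fun S => ent i S) (fun w => w \notin W)) /=; last first.
    by move=> S /andP[_ /andP[]].
  apply: eq_bigr => w wW.
  rewrite (partition_big (fun S => ent j S) (fun u => u \notin w |: W)) /=; last first.
    move=> S /andP[/andP[SI /andP[_ jW]] /eqP <-]; rewrite !inE negb_or jW andbT.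
    exact: ent_neq.
  apply: eq_bigr => u uwW.
  have uW : u \notin W by apply: contra uwW; exact: setU1r.
  rewrite exchange_big /=; apply: eq_bigr => Y _.
  rewrite -mulr_sumr /cnt mulr_suml; congr (_ * _).
  apply: eq_big => S.
    case: (S \in I) => //=; case: eqP => [->|_]; rewrite ?andbF //=.
    by case: eqP => [->|_]; rewrite ?andbF // wW uW.
  by case/andP => /andP[_ /eqP <-] /eqP <-.
apply: (@le_trans _ _ (T * (\sum_(w | w \notin W) \sum_(u | u \notin w |: W)
     \sum_Y mu Y * d w u Y) +
   p ^+ 2 / T * (\sum_w \sum_u \sum_Y mu Y * cnt w u Y ^+ 2))).
  apply: (@le_trans _ _ (\sum_(w | w \notin W) \sum_(u | u \notin w |: W)
     (T * (\sum_Y mu Y * d w u Y) +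
      p ^+ 2 / T * (\sum_Y mu Y * cnt w u Y ^+ 2)))).
    apply: ler_sum => w wW; apply: ler_sum => u uW.
    rewrite !mulr_sumr -big_split /=; apply: ler_sum => Y _.
    rewrite !(mulrCA _ (mu Y)) -mulrDr ler_wpM2l //.
    apply: (le_trans (ler_wpM2r (d_ge0 w u Y) (cnt_le w u Y))).
    rewrite mulrDl lerD2l -mulrA [X in _ <= X]mulrAC mulrA mulrC.
    rewrite mulrA ler_wpM2r ?invr_ge0 ?(ltW T0) //.
    by rewrite ler_wpM2r ?sqr_ge0 // d_le.
  rewrite [X in X <= _](eq_bigr (fun w => T * (\sum_(u | u \notin w |: W)
     \sum_Y mu Y * d w u Y) + p ^+ 2 / T * \sum_(u | u \notin w |: W)
     (\sum_Y mu Y * cnt w u Y ^+ 2))); last first.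
    by move=> w _; rewrite big_split /= !mulr_sumr.
  rewrite big_split /= -!mulr_sumr lerD2l ler_wpM2l //.
    by rewrite divr_ge0 ?sqr_ge0 // ltW.
  have pos w u : 0 <= \sum_Y mu Y * cnt w u Y ^+ 2.
    by apply: sumr_ge0 => Y _; rewrite mulr_ge0 ?sqr_ge0.
  rewrite big_mkcond; apply: ler_sum => w _; case: ifP => _; last exact: sumr_ge0.
  rewrite big_mkcond; apply: ler_sum => u _; case: ifP => // _.
apply: lerD.
  rewrite ler_wpM2l ?(ltW T0) //; apply: ler_sum => w wW.
  exact: potential_growth.
rewrite ler_wpM2l //; first by rewrite divr_ge0 ?sqr_ge0 // ltW.
have -> : \sum_w \sum_u \sum_Y mu Y * cnt w u Y ^+ 2 =
   \sum_(S in I) \sum_(S' in I | (ent i S' == ent i S) && (ent j S' == ent j S))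
     \sum_Y mu Y * contains R (pre i.+1 S :|: pre i.+1 S') Y.
  have cE S S' Y : contains R (pre i.+1 S :|: pre i.+1 S') Y =
      contains R (pre i.+1 S) Y * contains R (pre i.+1 S') Y.
    by rewrite /contains subUset -natrM mulnb.
  transitivity (\sum_w \sum_u \sum_(S in I | (ent i S == w) && (ent j S == u))
     \sum_(S' in I | (ent i S' == ent i S) && (ent j S' == ent j S))
     \sum_Y mu Y * contains R (pre i.+1 S :|: pre i.+1 S') Y); last first.
    rewrite [RHS](partition_big (fun S => ent i S) xpredT) //=.
    apply: eq_bigr => w _.
    rewrite [RHS](partition_big (fun S => ent j S) xpredT) //=.
    by apply: eq_bigr => u _; apply: eq_bigl => S; rewrite andbA.
  apply: eq_bigr => w _; apply: eq_bigr => u _.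
  transitivity (\sum_(S in I | (ent i S == w) && (ent j S == u))
     \sum_(S' in I | (ent i S' == w) && (ent j S' == u))
     \sum_Y mu Y * contains R (pre i.+1 S :|: pre i.+1 S') Y); last first.
    by apply: eq_bigr => S /andP[_ /andP[/eqP -> /eqP ->]].
  under [RHS]eq_bigr do rewrite exchange_big /=.
  rewrite [RHS]exchange_big /=; apply: eq_bigr => Y _.
  rewrite expr2 {1}/cnt mulr_suml mulr_sumr; apply: eq_bigr => S _.
  rewrite /cnt !mulr_sumr; apply: eq_bigr => S' _; by rewrite cE.
rewrite [X in _ <= X](_ : _ =
   \sum_(S in I) Z * ((2 ^ r)%:R * kappa * p ^+ (i.+1).*2 * D)); last first.
  by rewrite sumr_const -[RHS]mulr_natl [RHS]mulrCA -[LHS]mulrA.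
apply: ler_sum => S SI.
apply: le_trans (ler_wpM2l (mass_ge0 A p01) (pair_count SI ij jr)).
rewrite mulr_sumr; apply: ler_sum => S' _; rewrite mulrC.
exact: mass_contains.
Qed.

End Counting.

Section Decoupling.
Variables (R : realType) (E J : finType) (p : R) (A : pred {set E}).
Hypothesis p01 : 0 < p < 1.
Hypothesis A_decr : forall G G' : {set E}, G \subset G' -> A G' -> A G.
Variables (I : {set J}) (x : J -> {set E}) (r : nat) (kappa : R) (u0 : E).
Hypothesis x_card : {in I, forall S, #|x S| = r}.
Hypothesis x_codeg : forall T : {set E}, (2 <= #|T|)%N ->
  #|[set S in I | T \subset x S]|%:R <=
    kappa * p ^+ #|T|.-1 * (#|I|%:R / #|E|%:R).
Hypothesis kappa_ge0 : 0 <= kappa.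
Implicit Types (G W Y : {set E}) (u v w : E) (S : J).
Local Notation mu := (condm p A).
Local Notation cprob := (cprob p A).
Local Notation Z := (\sum_G mu G).
Local Notation N := #|E|.
Local Notation ent i S := (nth u0 (enum (x S)) i).
Local Notation pre i S := (prefix (enum (x S)) i).
Let mu_ge0 G : 0 <= mu G. Proof. exact: condm_ge0. Qed.
Hint Resolve mu_ge0 : core.
Let p_gt0 : 0 < p. Proof. by case/andP: p01. Qed.

(** The prefix of length i is absorbed in W, which then ranges over sets of
    size t + i; the edge and the new W determine the old one. *)
Lemma sum_sqshift t i j : (i < j)%N -> (j < r)%N ->
  \sum_(W : {set E} | #|W| == t) \sum_(S in I | [disjoint x S & W])
     sqshift p A u0 W (enum (x S)) i j <=
  \sum_(W : {set E} | #|W| == (t + i)%N)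
    \sum_(S in I | (ent i S \notin W) && (ent j S \notin W))
      pair_shift p A x u0 W i j S.
Proof.
move=> ij jr.
rewrite (exchange_big_dep (mem I)) /=; last by move=> W S _ /andP[].
rewrite [X in _ <= X](exchange_big_dep (mem I)) /=; last by move=> W S _ /andP[].
apply: ler_sum => S SI; have szS : size (enum (x S)) = r by rewrite -cardE x_card.
have preS i' : pre i' S \subset x S.
  by apply/subsetP => u; rewrite inE => /mem_take; rewrite mem_enum.
have ps_ge0 W : 0 <= pair_shift p A x u0 W i j S.
  apply: sumr_ge0 => Y _; apply: mulr_ge0 => //.
  by apply: mulr_ge0; [exact: contains_ge0 | exact: sqr_ge0].
pose Q := [set W : {set E} | (#|W| == t) && [disjoint x S & W]].
apply: (@le_trans _ _ (\sum_(W in Q) pair_shift p A x u0 (W :|: pre i S) i j S)).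
  apply: le_of_eq.
  apply: eq_big => [W|W _]; first by rewrite inE SI.
  apply: eq_bigr => Y _; rewrite /shift (prefixS u0) ?szS; last lia.
  by rewrite setUCA.
rewrite -(big_imset (fun W => pair_shift p A x u0 W i j S)) /=; last first.
  move=> W W'; rewrite !inE => /andP[_ dW] /andP[_ dW'] e.
  have h (V : {set E}) : [disjoint x S & V] -> (V :|: pre i S) :\: pre i S = V.
    move=> dV; rewrite setDUl setDv setU0; apply/setDidPl.
    by rewrite disjoint_sym; apply: disjointWl dV.
  by move: (h _ dW) => <-; rewrite [_ :|: _]e; apply: h.
rewrite [X in X <= _]big_mkcond [X in _ <= X]big_mkcond /=.
apply: ler_sum => W' _; case: ifPn => [/imsetP[W]|_]; last by case: ifP.
rewrite inE => /andP[/eqP Wt dW] ->.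
have mS k : (k < r)%N -> ent k S \in x S by move=> kr; rewrite -mem_enum mem_nth ?szS.
have dWpre : [disjoint W & pre i S] by rewrite disjoint_sym; apply: disjointWl dW.
rewrite cardsU (disjoint_setI0 dWpre) cards0 subn0 Wt.
rewrite card_prefix ?enum_uniq ?szS //; last lia.
have ir : (i < r)%N by exact: ltn_trans jr.
have hi : ent i S \notin pre i S by rewrite nth_prefix ?enum_uniq ?szS ?ltnn.
have hj : ent j S \notin pre i S.
  by rewrite nth_prefix ?enum_uniq ?szS // -leqNgt ltnW.
by rewrite eqxx SI !in_setU !(disjointFr dW) ?mS //= hi hj.
Qed.

(** In sum_pair_shift take T to be th * p ^ i.+1 * (#|I| / #|E|), a multiple of
    the order of the counts. *)
Lemma sum_sqshift_le (M t i j : nat) (th : R) :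
  (i < j)%N -> (j < r)%N -> (0 < M)%N -> (M <= t)%N -> (t + i <= N)%N ->
  0 < th -> (0 < #|I|)%N ->
  growth (potential p A) (t + i) <=
    'C(N, t + i)%:R * (N%:R * (r%:R * (N%:R * (p ^+ 2 * Z))) / M%:R) ->
  \sum_(W : {set E} | #|W| == t) \sum_(S in I | [disjoint x S & W])
     sqshift p A u0 W (enum (x S)) i j <=
  'C(N, t + i)%:R * (#|I|%:R * Z * p ^+ i.+3 *
     (th * r%:R * (N%:R / M%:R) + (2 ^ r)%:R * kappa / th)).
Proof.
move=> ij jr M0 Mt tiN th0 I0 gr; apply: le_trans (sum_sqshift t ij jr) _.
have N0 : 0 < N%:R :> R by rewrite ltr0n; apply/card_gt0P; exists u0.
have I0' : 0 < #|I|%:R :> R by rewrite ltr0n.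
have M0' : 0 < M%:R :> R by rewrite ltr0n.
have pi0 : 0 < p ^+ i.+1 by rewrite exprn_gt0.
pose T := th * p ^+ i.+1 * (#|I|%:R / N%:R).
have T0 : 0 < T by rewrite !mulr_gt0 ?invr_gt0.
apply: (@le_trans _ _ (\sum_(W : {set E} | #|W| == (t + i)%N)
  (T * \sum_(w | w \notin W) (potential p A (w |: W) - potential p A W) +
   p ^+ 2 / T * (Z * #|I|%:R *
      ((2 ^ r)%:R * kappa * p ^+ (i.+1).*2 * (#|I|%:R / N%:R)))))).
  apply: ler_sum => W _.
  exact: (sum_pair_shift p01 A_decr (r := r) u0).
rewrite big_split /= -mulr_sumr -/(growth _ _).
rewrite sumr_const -[X in _ + _ *+ X]cardsE card_draws.
rewrite -[X in _ + X]mulr_natl.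
apply: (le_trans (lerD (ler_wpM2l (ltW T0) gr) (lexx _))).
apply: le_of_eq.
have e2 : p ^+ (i.+1).*2 = p ^+ i.+1 * p ^+ i.+1 by rewrite -addnn exprD.
have e3 : p ^+ i.+3 = p ^+ 2 * p ^+ i.+1 by rewrite -exprD.
rewrite e2 e3 /T; move: pi0 N0 I0' M0' th0 => *; field.
by rewrite !gt_eqF.
Qed.

Lemma sum_defect_le (t : nat) (th be : R) :
  0 < th -> (0 < #|I|)%N -> (t + r <= N)%N ->
  (forall i j, (i < j)%N -> (j < r)%N ->
   \sum_(W : {set E} | #|W| == t) \sum_(S in I | [disjoint x S & W])
     sqshift p A u0 W (enum (x S)) i j <=
   'C(N, t)%:R * (#|I|%:R * Z * p ^+ i.+3 * be)) ->
  0 <= be ->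
  \sum_(W : {set E} | #|W| == t) \sum_(S in I | [disjoint x S & W])
    \sum_Y mu Y * `|cexp mu W (contains R (x S)) Y -
                    \prod_(u in x S) cprob W u Y| <=
  'C(N, t)%:R * (#|I|%:R * p ^+ r * Z) * (r%:R ^+ 2 * (th + be / th)).
Proof.
move=> th0 I0 trN sq be0.
have c0 : 0 <= 'C(N, t)%:R * (#|I|%:R * p ^+ r * Z) * (th + be / th).
  have := ltW th0; have := mass_ge0 A p01; have : 0 <= p ^+ r by rewrite exprn_ge0 // ltW.
  by move=> h1 h2 h3; apply: mulr_ge0; [apply: mulr_ge0 => //; apply: mulr_ge0 => //; apply: mulr_ge0|apply: addr_ge0 => //; apply: divr_ge0].
apply: (@le_trans _ _ (\sum_(j < r) \sum_(i < j)
   'C(N, t)%:R * (#|I|%:R * p ^+ r * Z) * (th + be / th))); last first.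
  apply: (@le_trans _ _ (\sum_(j < r) \sum_(i < r)
     'C(N, t)%:R * (#|I|%:R * p ^+ r * Z) * (th + be / th))).
    apply: ler_sum => j _; rewrite !sumr_const !card_ord.
    by rewrite -[_ *+ j]mulr_natl -[_ *+ r]mulr_natl ler_wpM2r // ler_nat ltnW.
  set c := _ * (th + be / th); rewrite !sumr_const card_ord -mulrnA -[c *+ _]mulr_natl natrM.
  by rewrite /c [X in _ <= X]mulrCA -expr2.
apply: (@le_trans _ _ (\sum_(W : {set E} | #|W| == t) \sum_(S in I | [disjoint x S & W])
  \sum_(j < r) \sum_(i < j) (th * p ^+ r * Z +
    p ^+ (r - i.+2) / (th * p) * sqshift p A u0 W (enum (x S)) i j))).
  apply: ler_sum => W _; apply: ler_sum => S /andP[SI dW].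
  have szS : size (enum (x S)) = r by rewrite -cardE x_card.
  have sW : {in enum (x S), forall u, u \notin W}.
    by move=> u; rewrite mem_enum => uS; rewrite (disjointFr dW).
  have := cexp_contains_prod_sq p01 A_decr u0 (enum_uniq (mem (x S))) sW th0.
  rewrite szS set_enum; apply: le_trans.
  apply: le_of_eq; apply: eq_bigr => Y _.
  rewrite -big_enum /= (big_nth u0) big_mkord.
  by rewrite szS.
under eq_bigr => W _ do rewrite exchange_big /=.
rewrite exchange_big /=; apply: ler_sum => j _.
under eq_bigr => W _ do rewrite exchange_big /=.
rewrite exchange_big /=; apply: ler_sum => i _.
have ij := ltn_ord i; have jr := ltn_ord j.
under eq_bigr => W _ do rewrite big_split /=.
rewrite big_split /= mulrDr; apply: lerD.
  apply: (@le_trans _ _ (\sum_(W : {set E} | #|W| == t) \sum_(S in I)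
     th * p ^+ r * Z)).
    apply: ler_sum => W _; rewrite big_mkcondr; apply: ler_sum => S _.
    case: ifP => // _; rewrite !mulr_ge0 ?mass_ge0 ?exprn_ge0 //; exact: ltW.
  rewrite !sumr_const -[X in _ *+ X <= _]cardsE card_draws -mulrnA -[_ *+ (_ * _)]mulr_natl natrM.
  by apply: le_of_eq; ring.
under eq_bigr => W _ do rewrite -mulr_sumr.
rewrite -mulr_sumr.
have pos : 0 <= p ^+ (r - i.+2) / (th * p).
  by rewrite divr_ge0 ?mulr_ge0 ?exprn_ge0 //; exact: ltW.
apply: (le_trans (ler_wpM2l pos (sq _ _ ij jr))).
apply: le_of_eq.
have -> : p ^+ r = p ^+ (r - i.+2) * p ^+ i.+2 by rewrite -exprD subnK // (leq_ltn_trans ij jr).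
rewrite (exprS p i.+2); move: (p_gt0) (th0) => *; field; by rewrite !gt_eqF.
Qed.

End Decoupling.

Lemma window_size N d r : (4 <= d)%N -> (d <= N)%N -> (2 * r <= N)%N ->
  [/\ (0 < N %/ d)%N, ((N %/ d).*2 + r <= N)%N & (N <= 2 * d * (N %/ d))%N].
Proof.
move=> d4 dN rN; have d0 : (0 < d)%N by apply: leq_trans d4.
have M0 : (0 < N %/ d)%N by rewrite divn_gt0.
have M4 : (4 * (N %/ d) <= N)%N.
  by apply: leq_trans (leq_trunc_div N d); rewrite mulnC leq_mul2l d4 orbT.
have := divn_eq N d; have := ltn_pmod N d0; move: M0 M4.
move: (N %/ d)%N (N %% d)%N => M s M0 M4 sd e; split => //; first by lia.
by rewrite e; nia.
Qed.

Lemma bin_ratio N d M t i : (0 < M)%N -> (N <= 2 * d * M)%N -> (M <= t)%N ->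
  ('C(N, t + i) <= (2 * d) ^ i * 'C(N, t))%N.
Proof.
move=> M0 NM Mt; elim: i => [|i IH]; first by rewrite addn0 expn0 mul1n.
apply: (@leq_trans (2 * d * 'C(N, t + i))); last by rewrite expnS -(mulnA (2 * d)%N) leq_mul2l IH orbT.
rewrite addnS -(leq_pmul2l (ltn0Sn (t + i))) mul_bin_left mulnA leq_mul2r.
apply/orP; right; apply: leq_trans (leq_subr _ _) (leq_trans NM _).
by rewrite mulnC leq_mul2r (leq_trans Mt) ?orbT // -addnS leq_addr.
Qed.

(** W is found among the sets of a size t between about #|E| / d and
    2 #|E| / d given by exists_slow_window, so that passing from sets of size t
    to sets of size t + i changes their number by a bounded factor. *)
Lemma exists_decoupling_set (R : realType) (r : nat) (e : R) : 0 < e ->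
  exists2 kappa : R, 0 < kappa & exists N0 : nat,
  forall (E J : finType) (p : R) (A : pred {set E}) (I : {set J})
    (x : J -> {set E}), 0 < p < 1 ->
  (forall G G' : {set E}, G \subset G' -> A G' -> A G) ->
  (N0 <= #|E|)%N -> (0 < #|I|)%N -> {in I, forall S, #|x S| = r} ->
  (forall T : {set E}, (2 <= #|T|)%N -> #|[set S in I | T \subset x S]|%:R <=
    kappa * p ^+ #|T|.-1 * (#|I|%:R / #|E|%:R)) ->
  exists2 W : {set E}, #|W|%:R <= e * #|E|%:R &
    \sum_(S in I | [disjoint x S & W]) \sum_Y condm p A Y *
       `|cexp (condm p A) W (contains R (x S)) Y -
         \prod_(u in x S) cprob p A W u Y| <=
    e * (#|I|%:R * p ^+ r * \sum_G condm p A G).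
Proof.
move=> e0.
have [d d4 de] : exists2 d, (4 <= d)%N & 2 / d%:R <= e.
  exists (maxn 4 (Num.truncn (2 / e)).+1); first exact: leq_maxl.
  have h : 2 / e < (maxn 4 (Num.truncn (2 / e)).+1)%:R.
    by apply: lt_le_trans (truncnS_gt _) _; rewrite ler_nat leq_maxr.
  rewrite ler_pdivrMr ?ltr0n ?leq_max //.
  by move: h; rewrite ltr_pdivrMr // mulrC => /ltW.
(* th makes the sum of 2 th over the at most r ^ 2 pairs i < j at most e; th'
   makes the last factor in sum_sqshift_le at most th ^ 2, even after the
   change of 'C(N, t + i) to 'C(N, t). *)
pose th := e / (2 * (r%:R ^+ 2 + 1)).
have r1 : 0 < (r%:R ^+ 2 + 1 : R) by rewrite ltr_pwDr // sqr_ge0.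
have th0 : 0 < th by rewrite divr_gt0 // mulr_gt0.
pose q : R := (2 * d%:R) ^+ r * (r%:R * (2 * d%:R) + 1).
have d0 : 0 < d%:R :> R by rewrite ltr0n; lia.
have d1 : 1 <= 2 * d%:R :> R by rewrite -natrM ler1n; lia.
have q0 : 0 < q.
  apply: mulr_gt0; first by rewrite exprn_gt0 // mulr_gt0.
  apply: lt_le_trans ltr01 _.
  by rewrite lerDr mulr_ge0 ?mulr_ge0.
pose th' := th ^+ 2 / q.
have th'0 : 0 < th' by rewrite divr_gt0 // exprn_gt0.
have two_r : 0 < (2 ^ r)%:R :> R by rewrite ltr0n expn_gt0.
exists (th' ^+ 2 / (2 ^ r)%:R); first by rewrite divr_gt0 // exprn_gt0.
exists (maxn d (2 * r)) => E J p A I x p01 A_decr NE I0 x_card x_codeg.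
set kappa := th' ^+ 2 / _ in x_codeg.
have kappa0 : 0 <= kappa by rewrite divr_ge0 // sqr_ge0.
have [u0 _] : exists u0 : E, u0 \in E.
  by apply/card_gt0P; apply: leq_trans NE; rewrite leq_max (leq_trans _ d4).
move: NE; rewrite geq_max => /andP[dN rN].
pose N := #|E|; pose M := (N %/ d)%N.
have [M0 Mr NM] := window_size d4 dN rN.
rewrite -/N -/M in M0 Mr NM.
have M0' : 0 < M%:R :> R by rewrite ltr0n.
have NM' : N%:R / M%:R <= 2 * d%:R :> R.
  by rewrite ler_pdivrMr // -!natrM ler_nat.
have [t /andP[Mt tM] slow] := exists_slow_window (potential_ge0 A p01)
  (potential_le p01 A_decr) (fun W v => @potential_mono _ _ _ _ p01 A_decr W v)
  M0 Mr.
have trN : (t + r <= N)%N by apply: leq_trans Mr; rewrite leq_add2r ltnW.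
have tN : (t <= N)%N by apply: leq_trans trN; exact: leq_addr.
have C0 : 0 < 'C(N, t)%:R :> R by rewrite ltr0n bin_gt0.
set Z := \sum_G condm p A G.
have Z0 : 0 <= Z by exact: mass_ge0.
have p0 : 0 < p by case/andP: p01.
have binom i : 'C(N, t + i)%:R <= (2 * d%:R) ^+ i * 'C(N, t)%:R :> R.
  by rewrite -natrM -natrX -natrM ler_nat (bin_ratio i M0 NM Mt).
have := @sum_defect_le R E J p A p01 A_decr I x r u0 x_card
  t th (th ^+ 2) th0 I0.
move=> /(_ trN) bound.
have {bound} := bound _ (sqr_ge0 _).
rewrite -/N -/Z => bound.
have {}bound : \sum_(W : {set E} | #|W| == t) \sum_(S in I | [disjoint x S & W])
    \sum_Y condm p A Y * `|cexp (condm p A) W (contains R (x S)) Y -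
         \prod_(u in x S) cprob p A W u Y| <=
    \sum_(W : {set E} | #|W| == t) e * (#|I|%:R * p ^+ r * Z).
  apply: le_trans (bound _) _; last first.
    rewrite sumr_const -[X in _ <= _ *+ X]cardsE card_draws -[X in _ <= X]mulr_natl -/N.
    rewrite -mulrA ler_wpM2l ?(ltW C0) // mulrC ler_wpM2r //.
      by apply: mulr_ge0 => //; apply: mulr_ge0 => //; rewrite exprn_ge0 // ltW.
    have -> : th + th ^+ 2 / th = 2 * th by field; rewrite gt_eqF.
    rewrite /th; have -> : r%:R ^+ 2 * (2 * (e / (2 * (r%:R ^+ 2 + 1)))) =
       e * (r%:R ^+ 2 / (r%:R ^+ 2 + 1)) by field; rewrite gt_eqF.
    by rewrite ger_pMr // ler_pdivrMr // mul1r lerDl.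
  move=> i j ij jr; have ir : (i <= r)%N by exact: ltnW (ltn_trans ij jr).
  have tiN : (t + i <= N)%N by apply: leq_trans trN; rewrite leq_add2l.
  have := @sum_sqshift_le R E J p A p01 A_decr I x r kappa u0 x_card x_codeg
    kappa0 M t i j th' ij jr M0 Mt tiN th'0 I0 (slow _ (ltn_trans ij jr)).
  rewrite -/N -/Z => /le_trans; apply.
  have c1 : 0 <= #|I|%:R * Z * p ^+ i.+3.
    by apply: mulr_ge0; [apply: mulr_ge0|rewrite exprn_ge0 // ltW].
  have -> : (2 ^ r)%:R * kappa / th' = th'.
    by rewrite /kappa; field; rewrite !gt_eqF.
  have c2 : th' * r%:R * (N%:R / M%:R) + th' <= th' * (r%:R * (2 * d%:R) + 1).
    by rewrite -mulrA mulrDr mulr1 lerD2r ler_wpM2l ?(ltW th'0) // ler_wpM2l.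
  have c3 : 'C(N, t + i)%:R <= (2 * d%:R) ^+ r * 'C(N, t)%:R :> R.
    apply: le_trans (binom _) _.
    by rewrite ler_wpM2r // ler_weXn2l.
  apply: (@le_trans _ _ ((2 * d%:R) ^+ r * 'C(N, t)%:R * (#|I|%:R * Z * p ^+ i.+3 *
    (th' * (r%:R * (2 * d%:R) + 1))))).
    apply: ler_pM => //; last by rewrite ler_wpM2l.
    apply: mulr_ge0 => //; rewrite addr_ge0 ?(ltW th'0) //.
    by rewrite mulr_ge0 ?divr_ge0 // mulr_ge0 // ltW.
  apply: le_of_eq.
  have -> : th ^+ 2 = th' * q by rewrite /th' divfK ?gt_eqF.
  by rewrite /q; ring.
have [W Wt hW] : exists2 W : {set E}, #|W| == t &
   \sum_(S in I | [disjoint x S & W]) \sum_Y condm p A Y *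
       `|cexp (condm p A) W (contains R (x S)) Y -
         \prod_(u in x S) cprob p A W u Y| <= e * (#|I|%:R * p ^+ r * Z).
  apply: contrapT => no; move: bound; rewrite leNgt => /negP; apply.
  apply: ltr_sum.
    have : (0 < #|[set W : {set E} | #|W| == t]|)%N.
      by rewrite card_draws bin_gt0 -/N.
    case/card_gt0P => W; rewrite inE => Wt.
    by apply/hasP; exists W => //; rewrite mem_index_enum.
  by move=> W Wt; rewrite ltNge; apply/negP => h; apply: no; exists W.
exists W => //; rewrite (eqP Wt).
have h : t%:R <= 2 * M%:R :> R by rewrite -natrM ler_nat mul2n ltnW.
apply: (le_trans h); apply: (@le_trans _ _ (2 / d%:R * N%:R)); last by rewrite ler_wpM2r.
rewrite -mulrA ler_wpM2l // mulrC ler_pdivlMr // -natrM ler_nat.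
exact: leq_trunc_div.
Qed.

(** * The lower bound on the exponent *)

(** Apply ln y <= y - 1 to y = sqrt (p / q), and likewise for 1 - p and 1 - q.
    The sum of the two estimates is the squared Hellinger distance, of which
    one term is kept. *)
Lemma relent_ge_hellinger (R : realType) (p q : R) : 0 < p < 1 ->
  0 <= q <= 1 -> (Num.sqrt p - Num.sqrt q) ^+ 2 <= relent p q.
Proof.
have half (a b : R) : 0 < a -> 0 <= b ->
    2 * b - 2 * (Num.sqrt a * Num.sqrt b) <= b * ln (b / a).
  move=> a0; rewrite le_eqVlt => /orP[/eqP <-|b0].
    by rewrite sqrtr0 !mulr0 mul0r subrr.
  have sa : 0 < Num.sqrt a by rewrite sqrtr_gt0.
  have sb : 0 < Num.sqrt b by rewrite sqrtr_gt0.
  have := ln_le_subr1 (divr_gt0 sa sb) => h.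
  have -> : ln (b / a) = - (2 * ln (Num.sqrt a / Num.sqrt b)).
    rewrite -[in LHS](sqr_sqrtr (ltW a0)) -[in LHS](sqr_sqrtr (ltW b0)).
    rewrite -expr_div_n lnXn ?divr_gt0 // -invf_div lnV ?posrE ?divr_gt0 //.
    by rewrite mulNrn mulr_natl.
  have {}h : b * ln (Num.sqrt a / Num.sqrt b) <= Num.sqrt a * Num.sqrt b - b.
    apply: (le_trans (ler_wpM2l (ltW b0) h)).
    rewrite -{1 4}(sqr_sqrtr (ltW b0)); apply: le_of_eq.
    by field; rewrite gt_eqF.
  by rewrite mulrN mulrCA; lra.
move=> /andP[p0 p1] /andP[q0 q1].
have h1 := half _ _ p0 q0.
have := half (1 - p) (1 - q); rewrite !subr_gt0 !subr_ge0 => /(_ p1 q1) h2.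
have h3 := sqr_ge0 (Num.sqrt (1 - p) - Num.sqrt (1 - q)).
move: h3; rewrite !sqrrB !sqr_sqrtr ?subr_ge0 ?(ltW p0) ?(ltW p1) //.
by move: h1 h2; rewrite /relent; lra.
Qed.

Lemma relent_ge0 (R : realType) (p q : R) : 0 < p < 1 ->
  0 <= q <= 1 -> 0 <= relent p q.
Proof.
by move=> p01 q01; apply: le_trans (relent_ge_hellinger p01 q01); exact: sqr_ge0.
Qed.

Lemma relentpp (R : realType) (p : R) : 0 < p < 1 -> relent p p = 0.
Proof.
move=> /andP[p0 p1]; rewrite /relent !divff ?gt_eqF ?subr_gt0 //.
by rewrite ln1 !mulr0 addr0.
Qed.

Lemma exists_le_mean (R : realType) (T : finType) (m g : T -> R) (c : R) :
  (forall t, 0 <= m t) -> 0 < \sum_t m t ->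
  \sum_t m t * g t <= c * \sum_t m t -> exists2 t, 0 < m t & g t <= c.
Proof.
move=> m0 M0 h; apply: contrapT => no.
have gt t : 0 < m t -> c < g t.
  by move=> mt; rewrite ltNge; apply/negP => gc; apply: no; exists t.
have [t mt] : exists t, 0 < m t.
  apply/existsP; apply: contraTT M0 => /existsPn h'; rewrite -leNgt.
  by apply: sumr_le0 => t _; rewrite leNgt h'.
move: h; rewrite leNgt => /negP; apply; rewrite mulr_sumr.
rewrite (bigD1 t) // [ltRHS](bigD1 t) //=; apply: ltr_leD.
  by rewrite mulrC ltr_pM2l // gt.
apply: ler_sum => s _; rewrite mulrC.
have [ms|ms] := ltP 0 (m s); first by rewrite ler_wpM2l // ltW // gt.
have -> : m s = 0 by apply/eqP; rewrite eq_le ms m0.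
by rewrite !mul0r.
Qed.

Lemma sum_condm_le1 (R : realType) (E : finType) (p : R) (A : pred {set E}) :
  0 < p < 1 -> \sum_G condm p A G <= 1.
Proof.
move=> /andP[p0 p1]; rewrite -(sum_prodm (fun _ : E => p)).
apply: ler_sum => G _; rewrite /condm.
have h : 0 <= prodm (fun=> p) G by apply: prodm_ge0 => e; rewrite !ltW.
by case: (A G); rewrite ?mul1r ?mul0r.
Qed.

Lemma sum_condm_eq1 (R : realType) (E : finType) (p : R) (A : pred {set E}) :
  0 < p < 1 -> \sum_G condm p A G = 1 -> forall G, A G.
Proof.
move=> p01 Z1 G; apply: contraT => AG; case/andP: (p01) => p0 p1.
have := sum_prodm (fun _ : E => p); rewrite -Z1 => /eqP.
rewrite -subr_eq0 -sumrB psumr_eq0 => [/allP /(_ G)|G' _].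
  rewrite mem_index_enum /condm (negbTE AG) mul0r subr0 => /(_ isT) /eqP h.
  have : 0 < prodm (fun _ : E => p) G.
    by apply: prodr_gt0 => e _; rewrite /bern; case: ifP; rewrite ?subr_gt0.
  by rewrite h ltxx.
rewrite /condm; have h : 0 <= prodm (fun=> p) G' by apply: prodm_ge0 => e; rewrite !ltW.
by case: (A G'); rewrite ?mul1r ?mul0r ?subrr ?subr0.
Qed.

Lemma card_meeting (R : realType) (E J : finType) (I : {set J})
    (x : J -> {set E}) (c : R) (W : {set E}) :
  (forall u, #|[set S in I | u \in x S]|%:R <= c) ->
  #|[set S in I | ~~ [disjoint x S & W]]|%:R <= #|W|%:R * c.
Proof.
move=> deg; apply: (@le_trans _ _ (\sum_(u in W) #|[set S in I | u \in x S]|%:R)).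
  rewrite -natr_sum ler_nat.
  have sub : [set S in I | ~~ [disjoint x S & W]] \subset
      \bigcup_(u in W) [set S in I | u \in x S].
    apply/subsetP => S; rewrite inE => /andP[SI /pred0Pn[u /andP[uS uW]]].
    by apply/bigcupP; exists u => //; rewrite inE SI.
  apply: leq_trans (subset_leq_card sub) _.
  elim/big_ind2: _ => [|n1 A1 n2 A2 h1 h2|//]; first by rewrite cards0.
  by apply: leq_trans (leq_add h1 h2); rewrite cardsU leq_subr.
apply: (le_trans (ler_sum _ (fun u _ => deg u))).
by rewrite sumr_const mulr_natl.
Qed.

(** A set Y can be chosen for which, given Y :&: W, both the total relative
    entropy of the conditional marginals and their defect of independence are
    near their averages.  The hidden edges then have expected number at most
    b by the mere fact that the event forces at most b edges. *)
Theorem lower_tail_entropy (R : realType) (r : nat) (K e : R) : 0 <= K -> 0 < e ->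
  exists2 kappa : R, 0 < kappa & exists N0 : nat,
  forall (E J : finType) (p : R) (A : pred {set E}) (I : {set J})
    (x : J -> {set E}) (b : R), 0 < p < 1 ->
  (forall G G' : {set E}, G \subset G' -> A G' -> A G) ->
  (N0 <= #|E|)%N -> (0 < #|I|)%N -> {in I, forall S, #|x S| = r} ->
  (forall u, #|[set S in I | u \in x S]|%:R <= K * (#|I|%:R / #|E|%:R)) ->
  (forall T : {set E}, (2 <= #|T|)%N -> #|[set S in I | T \subset x S]|%:R <=
    kappa * p ^+ #|T|.-1 * (#|I|%:R / #|E|%:R)) ->
  0 < \sum_G condm p A G ->
  (forall G, A G -> #|[set S in I | x S \subset G]|%:R <= b) ->
  exists q : E -> R, [/\ forall u, 0 <= q u <= p,
    \sum_u relent p (q u) <= (1 + e) * - ln (\sum_G condm p A G) &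
    \sum_(S in I) \prod_(u in x S) q u <= b + e * (#|I|%:R * p ^+ r)].
Proof.
move=> K0 e0.
(* The first term serves the defect of independence, the second the edges
   meeting W. *)
pose e' := Num.min (e ^+ 2 / (2 * (1 + e))) (e / (2 * (K + 1))).
have e1 : 0 < 1 + e by rewrite addr_gt0.
have K1 : 0 < K + 1 by rewrite ltr_wpDl.
have e'0 : 0 < e'.
  by rewrite lt_min !divr_gt0 ?exprn_gt0 // mulr_gt0.
have e'1 : (1 + e) / e * e' <= e / 2.
  apply: (@le_trans _ _ ((1 + e) / e * (e ^+ 2 / (2 * (1 + e))))).
    by rewrite ler_wpM2l ?ge_min ?lexx // divr_ge0 // ltW.
  by apply: le_of_eq; field; rewrite !gt_eqF.
have e'2 : e' * K <= e / 2.
  apply: (@le_trans _ _ (e / (2 * (K + 1)) * (K + 1))).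
    by rewrite ler_pM ?ge_min ?lexx ?orbT ?lerDl // ltW.
  by apply: le_of_eq; field; rewrite !gt_eqF.
have [kappa kappa0 [N0 dec]] := exists_decoupling_set r e'0.
exists kappa => //; exists N0.+1 => E J p A I x b p01 A_decr NE I0 xc deg codeg Z0 Ab.
have {dec} := dec E J p A I x p01 A_decr (ltnW NE) I0 xc codeg.
have NE0 : 0 < #|E|%:R :> R by rewrite ltr0n; case: #|E| NE.
move: Z0; set mu := condm p A; set Z := \sum_G mu G => Z0.
have mu_ge0 G : 0 <= mu G by exact: condm_ge0.
case/andP: (p01) => p0 p1.
have I0' : 0 < #|I|%:R :> R by rewrite ltr0n.
have Ipr : 0 < #|I|%:R * p ^+ r by rewrite mulr_gt0 // exprn_gt0.
have pr1 : p ^+ r <= 1 by rewrite exprn_ile1 // ltW.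
case=> W We err_le; set err := (X in X <= _) in err_le.
pose D := - ln Z.
have D0 : 0 <= D by rewrite oppr_ge0 ln_le0 // sum_condm_le1.
(* If D = 0 then the event is certain and there are at most b edges in all. *)
have [D_eq0|Dn0] := eqVneq D 0.
  exists (fun=> p); split.
  - by move=> u; rewrite (ltW p0) lexx.
  - by rewrite big1 ?mulr_ge0 ?(ltW e1) // => u _; rewrite relentpp.
  have Z1 : Z = 1.
    apply/eqP; move/eqP: D_eq0; rewrite /D oppr_eq0 => /eqP lnZ.
    by rewrite -(lnK (x := Z)) ?posrE // lnZ expR0.
  have := Ab setT (sum_condm_eq1 p01 Z1 _).
  rewrite (_ : [set S in I | x S \subset setT] = I); last first.
    by apply/setP => S; rewrite inE subsetT andbT.
  move=> Ib; rewrite (eq_bigr (fun=> p ^+ r)); last first.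
    by move=> S SI; rewrite prodr_const xc.
  rewrite sumr_const -[_ *+ _]mulr_natl.
  have h : #|I|%:R * p ^+ r <= #|I|%:R by rewrite ger_pMr.
  by apply: (le_trans h); rewrite (le_trans Ib) // lerDl mulr_ge0 // ltW.
have {Dn0} D0' : 0 < D by rewrite lt0r Dn0.
pose Ent Y := \sum_(u | u \notin W) relent p (cprob p A W u Y).
pose Err Y := \sum_(S in I | [disjoint x S & W])
   `|cexp mu W (contains R (x S)) Y - \prod_(u in x S) cprob p A W u Y|.
have Err0 Y : 0 <= Err Y by apply: sumr_ge0.
have cp01 u Y : 0 <= cprob p A W u Y <= 1 by rewrite cprob_ge0 ?cprob_le1.
have Ent0 Y : 0 <= Ent Y by apply: sumr_ge0 => u _; exact: relent_ge0.
(* With this weight, the mean of Ent + lam Err is at most (1 + e) D. *)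
pose lam := e * D / (e' * (#|I|%:R * p ^+ r)).
have lam0 : 0 < lam by rewrite divr_gt0 ?mulr_gt0 ?exprn_gt0.
have mean_le : \sum_Y mu Y * (Ent Y + lam * Err Y) <= (1 + e) * D * Z.
  have h1 := cprob_entropy p01 A_decr W Z0.
  have h2 : \sum_Y mu Y * Err Y <= e' * (#|I|%:R * p ^+ r * Z).
    apply: le_trans err_le; rewrite /err exchange_big /=.
    by apply: ler_sum => Y _; rewrite mulr_sumr.
  have -> : \sum_Y mu Y * (Ent Y + lam * Err Y) =
      \sum_Y mu Y * Ent Y + lam * \sum_Y mu Y * Err Y.
    by rewrite mulr_sumr -big_split /=; apply: eq_bigr => Y _; ring.
  apply: le_trans (lerD h1 (ler_wpM2l (ltW lam0) h2)) _.
  rewrite -/mu -/Z; apply: le_of_eq; rewrite /lam /D.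
  by move: (e'0) (I0') (p0) => *; field; rewrite !gt_eqF ?exprn_gt0.
have [Y mY hY] := exists_le_mean mu_ge0 Z0 mean_le.
have EntY : Ent Y <= (1 + e) * D.
  by apply: le_trans hY; rewrite lerDl mulr_ge0 // ltW.
have ErrY : Err Y <= e / 2 * (#|I|%:R * p ^+ r).
  have h : lam * Err Y <= (1 + e) * D by apply: le_trans hY; rewrite lerDr.
  apply: (@le_trans _ _ ((1 + e) / e * e' * (#|I|%:R * p ^+ r))).
    move: h; rewrite mulrC -ler_pdivlMr //; move/le_trans; apply.
    rewrite /lam; apply: le_of_eq.
    by move: (D0') (e0) (e'0) (I0') (p0) => *; field; rewrite !gt_eqF ?exprn_gt0.
  by rewrite ler_wpM2r // ltW.
pose q u := if u \in W then p else cprob p A W u Y.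
have qp u : 0 <= q u <= p.
  rewrite /q; case: ifPn => uW; first by rewrite (ltW p0) lexx.
  by rewrite cprob_ge0 ?cprob_le.
exists q; split => //.
  rewrite (bigID (fun u => u \in W)) /= big1 ?add0r; last first.
    by move=> u uW; rewrite /q uW relentpp.
  apply: le_trans EntY; apply: le_of_eq.
  by apply: eq_bigr => u uW; rewrite /q (negbTE uW).
rewrite (bigID (fun S => [disjoint x S & W])) /=.
have h1 : \sum_(S in I | [disjoint x S & W]) \prod_(u in x S) q u <= b + Err Y.
  apply: (@le_trans _ _ (\sum_(S in I | [disjoint x S & W])
     cexp mu W (contains R (x S)) Y + Err Y)).
    rewrite -big_split /=; apply: ler_sum => S /andP[SI dW].
    rewrite (eq_bigr (fun u => cprob p A W u Y)); last first.
      by move=> u uS; rewrite /q (disjointFr dW).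
    set P := \prod_(_ in _) _; rewrite -lerBlDl distrC.
    exact: ler_norm.
  rewrite lerD2r -cexp_sum.
  have AY : A Y by move: mY; rewrite /mu /condm; case: (A Y) => //; rewrite mul0r ltxx.
  apply: cexp_le_bound => //; first by apply: le_trans (Ab _ AY).
  move=> G mG.
  have AG : A G by move: mG; rewrite /mu /condm; case: (A G) => //; rewrite mul0r ltxx.
  apply: le_trans (Ab _ AG); rewrite -sum1_card natr_sum.
  rewrite [X in _ <= X](_ : _ = \sum_(S in I) contains R (x S) G).
    by rewrite big_mkcondr; apply: ler_sum => S _; case: ifP => // _.
  rewrite big_mkcond [RHS]big_mkcond; apply: eq_bigr => S _; rewrite inE /contains.
  by case: (S \in I); case: (_ \subset _).
have h2 : \sum_(S in I | ~~ [disjoint x S & W]) \prod_(u in x S) q u <=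
   e / 2 * (#|I|%:R * p ^+ r).
  apply: (@le_trans _ _ (\sum_(S in I | ~~ [disjoint x S & W]) p ^+ r)).
    apply: ler_sum => S /andP[SI _]; rewrite -(xc _ SI) -prodr_const.
    by apply: ler_prod => u _; exact: qp.
  rewrite sumr_const -[_ *+ _]mulr_natl mulrA ler_wpM2r ?exprn_ge0 ?(ltW p0) //.
  have := card_meeting W deg; rewrite cardsE => /le_trans; apply.
  apply: (@le_trans _ _ (e' * #|E|%:R * (K * (#|I|%:R / #|E|%:R)))).
    by rewrite ler_wpM2r // mulr_ge0 // divr_ge0.
  rewrite [X in X <= _](_ : _ = e' * K * #|I|%:R); last by field; rewrite gt_eqF.
  by rewrite ler_wpM2r.
apply: le_trans (lerD h1 h2) _.
by move: ErrY; clear; lra.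
Qed.

(** * The upper bound on the exponent *)

Section Tilting.
Variables (R : realType) (E : finType) (p : R).
Hypothesis p01 : 0 < p < 1.
Implicit Types (G : {set E}) (u : E) (q : E -> R).

Lemma prodm_single q u (phi : bool -> R) :
  \sum_G prodm q G * phi (u \in G) = q u * phi true + (1 - q u) * phi false.
Proof.
have h := prodm_contain q [set u]; rewrite big_set1 in h.
have h1 := sum_prodm q.
transitivity (\sum_G (prodm q G * ([set u] \subset G)%:R * (phi true - phi false) +
   prodm q G * phi false)).
  by apply: eq_bigr => G _; rewrite sub1set; case: (u \in G) => /=; ring.
by rewrite big_split /= -!mulr_suml h h1; ring.
Qed.

(** The cost of tilting: moving from p to q turns the event into a likely one,
    and the log-sum inequality compares the tilted measure with the measure
    that gives mass 1 to the event and to its complement. *)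
Lemma tilting q (A : pred {set E}) : (forall u, 0 <= q u <= p) ->
  0 < \sum_G condm p A G ->
  - ln (\sum_G condm p A G) * (\sum_(G | A G) prodm q G) <=
  1 + \sum_u relent p (q u).
Proof.
move=> qp Z0; set Z := \sum_G condm p A G in Z0 *.
case/andP: (p01) => p0 p1.
have q01 u : 0 <= q u <= 1.
  by have /andP[-> h] := qp u; rewrite (le_trans h) // ltW.
have q1 u : q u < 1 by have /andP[_ h] := qp u; exact: le_lt_trans p1.
pose w G := prodm (fun=> p) G * (if A G then Z^-1 else 1).
have P0 G : 0 < prodm (fun _ : E => p) G.
  by apply: prodr_gt0 => u _; rewrite /bern; case: ifP; rewrite ?subr_gt0.
have w0 G : 0 < w G by rewrite mulr_gt0 //; case: (A G); rewrite ?invr_gt0.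
have Q0 G : 0 <= prodm q G by exact: prodm_ge0.
have := log_sum Q0 (fun G => ltW (w0 G)) (fun G _ => w0 G).
rewrite sum_prodm => /(_ ltr01); rewrite divr1 mul1r => main.
have w2 : \sum_G w G <= 2.
  have -> : (2 : R) = 1 + 1 by [].
  rewrite (bigID A) /=; apply: lerD.
    rewrite (eq_bigr (fun G => prodm (fun=> p) G * Z^-1)); last first.
      by move=> G AG; rewrite /w AG.
    rewrite -mulr_suml ler_pdivrMr // mul1r /Z big_mkcond; apply: ler_sum => G _.
    by rewrite /condm; case: (A G); rewrite ?mul1r ?mul0r.
  rewrite -(sum_prodm (fun _ : E => p)) big_mkcond; apply: ler_sum => G _.
  by rewrite /w; case: ifP => [/negbTE ->|_]; rewrite ?mulr1 // ltW.
have w_pos : 0 < \sum_G w G.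
  by rewrite (bigD1 setT) //= ltr_pwDl // sumr_ge0 // => G _; exact: ltW.
have ln2 : ln (\sum_G w G) <= 1.
  by apply: le_trans (ln_le_subr1 w_pos) _; rewrite lerBlDr.
have {main} main := le_trans main ln2.
suff e : \sum_G prodm q G * ln (w G / prodm q G) =
    - \sum_u relent p (q u) - ln Z * \sum_(G | A G) prodm q G.
  by move: main; rewrite e mulNr; lra.
transitivity (\sum_G (prodm q G * (\sum_u ln (bern p (u \in G) / bern (q u) (u \in G))) +
   prodm q G * (if A G then - ln Z else 0))).
  apply: eq_bigr => G _; rewrite -mulrDr.
  have [->|QG] := eqVneq (prodm q G) 0; first by rewrite !mul0r.
  congr (_ * _).
  have b0 u : 0 < bern (q u) (u \in G).
    rewrite lt0r bern_ge0 // andbT; apply: contraNneq QG => h.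
    by rewrite /prodm (bigD1 u) //= h mul0r.
  have Qp : 0 < prodm q G by rewrite lt0r QG Q0.
  have bp u : 0 < bern p (u \in G).
    by rewrite /bern; case: ifP; rewrite ?subr_gt0.
  have -> : ln (w G / prodm q G) =
     ln (prodm (fun=> p) G / prodm q G) + (if A G then - ln Z else 0).
    rewrite /w; case: (A G); rewrite ?mulr1 ?addr0 //.
    rewrite mulrAC [LHS]lnM ?posrE ?invr_gt0 ?divr_gt0 //.
    by rewrite (lnV (x := Z)) ?posrE.
  congr (_ + _); rewrite /prodm -prodf_div.
  apply: (@proj2 (0 < \prod_u (bern p (u \in G) / bern (q u) (u \in G)))).
  apply: (big_ind2 (fun x y => 0 < x /\ ln x = y)); first by rewrite ln1.
    move=> x1 x2 y1 y2 [x10 <-] [y10 <-]; split; first exact: mulr_gt0.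
    by rewrite lnM ?posrE.
  by move=> u _; rewrite divr_gt0.
rewrite big_split /=; congr (_ + _).
  under eq_bigr do rewrite mulr_sumr.
  rewrite exchange_big /= -sumrN; apply: eq_bigr => u _.
  rewrite (prodm_single q u (fun b => ln (bern p b / bern (q u) b))) /=.
  have inv (a b : R) : 0 < a -> 0 <= b -> b * ln (a / b) = - (b * ln (b / a)).
    move=> a0; rewrite le_eqVlt => /orP[/eqP <-|b0]; first by rewrite !mul0r oppr0.
    by rewrite -invf_div lnV ?posrE ?divr_gt0 // mulrN.
  by rewrite !inv ?subr_gt0 ?subr_ge0 ?(ltW (q1 u)) // -?opprD //; case/andP: (q01 u).
rewrite -mulNr mulr_sumr [RHS]big_mkcond /=; apply: eq_bigr => G _.
by case: (A G); rewrite ?mulr0 // mulrC.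
Qed.

Lemma relent_min q u : 0 <= q u <= 1 -> relent p (Num.min (q u) p) <= relent p (q u).
Proof.
move=> q01; have [//|_] := leP (q u) p; rewrite relentpp //; exact: relent_ge0.
Qed.

Lemma sum_prodm_subset G0 :
  \sum_(G : {set E} | G \subset G0) prodm (fun=> p) G = (1 - p) ^+ #|~: G0|.
Proof.
transitivity (\sum_(G : {set E}) \prod_u (bern p (u \in G) *
    ((u \in G) ==> (u \in G0))%:R)).
  rewrite big_mkcond; apply: eq_bigr => G _; rewrite big_split /=.
  case: ifPn => [GG|/subsetPn[u uG uG0]].
    rewrite [X in _ = _ * X]big1 ?mulr1 // => u _.
    by case: (boolP (u \in G)) => //= uG; rewrite (subsetP GG).
  by rewrite [X in _ = _ * X](bigD1 u) //= uG (negbTE uG0) /= mul0r mulr0.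
rewrite (sum_set_prod (fun u b => bern p b * (b ==> (u \in G0))%:R)).
rewrite -prodr_const [RHS]big_mkcond; apply: eq_bigr => u _ /=.
rewrite inE; case: (u \in G0); rewrite ?mulr1 ?mulr0 ?add0r //.
by rewrite addrC subrK.
Qed.

(** Write q = a p with a < s ^ 2.  The main term is - (1 - q) ln (1 - p), and the
    error terms are controlled by a ln a >= - 2 sqrt a >= - 2 s and by
    p <= - ln (1 - p). *)
Lemma relent_near0 (s q : R) : 0 < s <= 1 -> 0 <= q -> q < s ^+ 2 * p ->
  (1 - 4 * s) * - ln (1 - p) <= relent p q.
Proof.
case/andP: (p01) => p0 p1 /andP[s0 s1] q0 qs.
have lp : p <= - ln (1 - p).
  by rewrite lerNr; apply: le_trans (ln_le_subr1 _) _; rewrite ?subr_gt0 //; lra.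
have s2 : s ^+ 2 <= s by rewrite expr2 ler_piMl // ltW.
have qp : q <= s ^+ 2 by rewrite (le_trans (ltW qs)) // ler_piMr ?sqr_ge0 // ltW.
have q1 : q < 1 by apply: lt_le_trans qs _; rewrite mulr_ile1 ?sqr_ge0 ?(ltW p0) ?(ltW p1) // (le_trans s2).
have h1 : - (2 * s * p) <= q * ln (q / p).
  move: q0; rewrite le_eqVlt => /orP[/eqP <-|q0].
    by rewrite mul0r oppr_le0 !mulr_ge0 // ltW.
  pose a := Num.sqrt (q / p).
  have a2 : a ^+ 2 = q / p by rewrite sqr_sqrtr // divr_ge0 // ltW.
  have a0 : 0 < a by rewrite sqrtr_gt0 divr_gt0.
  have as_ : a < s.
    by rewrite -(ltr_pXn2r (n := 2)) ?nnegrE ?(ltW a0) ?(ltW s0) // a2 ltr_pdivrMr.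
  have := ln_sublinear (x := a^-1); rewrite invr_gt0 => /(_ a0).
  rewrite lnV ?posrE // => h.
  have -> : q = a ^+ 2 * p by rewrite a2 divfK // gt_eqF.
  rewrite mulfK ?gt_eqF // lnXn // -[ln a *+ 2]mulr_natl.
  have {}h : - a <= a ^+ 2 * ln a.
    have h' : - a^-1 <= ln a by lra.
    have := ler_wpM2l (sqr_ge0 a) h'; congr (_ <= _).
    by field; rewrite gt_eqF.
  have : - s <= a ^+ 2 * ln a by apply: le_trans h; rewrite lerN2 ltW.
  move/(ler_wpM2r (ltW p0)); lra.
have h2 : - (s * p) + (1 - s) * - ln (1 - p) <= (1 - q) * ln ((1 - q) / (1 - p)).
  rewrite ln_div ?posrE ?subr_gt0 // mulrBr.
  have : - q <= (1 - q) * ln (1 - q).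
    have iv : 0 < (1 - q)^-1 by rewrite invr_gt0 subr_gt0.
    have := ln_le_subr1 iv; rewrite lnV ?posrE ?subr_gt0 // => h.
    have h' : 1 - (1 - q)^-1 <= ln (1 - q) by lra.
    have q1' : 0 <= 1 - q by rewrite subr_ge0 ltW.
    have := ler_wpM2l q1' h'; congr (_ <= _); field.
    by rewrite gt_eqF // subr_gt0.
  have : q <= s * p by rewrite (le_trans (ltW qs)) // ler_wpM2r // ltW.
  have : (1 - s) * - ln (1 - p) <= (1 - q) * - ln (1 - p).
    rewrite ler_wpM2r ?(le_trans _ lp) ?(ltW p0) // lerD2l lerN2.
    exact: le_trans s2.
  rewrite !mulrN; lra.
rewrite /relent; have h3 := ler_wpM2l (ltW s0) lp.
move: h1 h2; set l := - ln (1 - p) in lp h3 *; nra.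
Qed.

End Tilting.

Section UpperTail.
Variables (R : realType) (E J : finType) (p : R).
Hypothesis p01 : 0 < p < 1.
Variables (I : {set J}) (x : J -> {set E}) (r : nat) (K : R).
Hypothesis x_card : {in I, forall S, #|x S| = r}.
Hypothesis x_deg : forall T : {set E}, (0 < #|T|)%N ->
  #|[set S in I | T \subset x S]|%:R <=
    K * p ^+ #|T|.-1 * (#|I|%:R / #|E|%:R).
Hypothesis K0 : 0 <= K.
Implicit Types (G : {set E}) (u : E) (q : E -> R) (S : J).
Local Notation edges_in G := (\sum_(S in I) contains R (x S) G).
Let p_gt0 : 0 < p. Proof. by case/andP: p01. Qed.
Let p_lt1 : p < 1. Proof. by case/andP: p01. Qed.

Lemma x_deg1 u : #|[set S in I | u \in x S]|%:R <= K * (#|I|%:R / #|E|%:R).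
Proof.
have := x_deg (T := [set u]); rewrite cards1 expr0 mulr1 => /(_ isT).
by under eq_finset do rewrite sub1set.
Qed.

Lemma mean_X q : \sum_G prodm q G * edges_in G = \sum_(S in I) \prod_(u in x S) q u.
Proof.
under eq_bigr do rewrite mulr_sumr.
by rewrite exchange_big /=; apply: eq_bigr => S _; rewrite -prodm_contain.
Qed.

(** For overlaps O of any size >= 1 the codegree bound makes up for the factor
    p ^- #|O|, up to the 1 / p in the result. *)
Lemma overlap_count S : S \in I ->
  \sum_(S' in I | ~~ [disjoint x S & x S']) p ^+ #|x S :|: x S'| <=
  (2 ^ r)%:R * K * p ^+ r.*2 / p * (#|I|%:R / #|E|%:R).
Proof.
move=> SI; have bd0 : 0 <= K * p ^+ r.*2 / p * (#|I|%:R / #|E|%:R).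
  have pr : 0 <= p ^+ r.*2 by rewrite exprn_ge0 // ltW.
  apply: mulr_ge0; last by rewrite divr_ge0.
  by apply: divr_ge0; [apply: mulr_ge0 | exact: ltW].
rewrite (partition_big (fun S' => x S :&: x S')
  (fun O : {set E} => (O \subset x S) && (O != set0))) /=; last first.
  by move=> S' /andP[_ h]; rewrite subsetIl /= setI_eq0.
apply: (@le_trans _ _ (\sum_(O : {set E} | O \subset x S)
    K * p ^+ r.*2 / p * (#|I|%:R / #|E|%:R))); last first.
  rewrite sumr_const -[_ *+ _]mulr_natl -!(mulrA (2 ^ r)%:R) ler_wpM2r //.
  rewrite ler_nat (_ : #|_| = #|powerset (x S)|); last first.
    by apply: eq_card => O; rewrite [RHS]inE.
  by rewrite card_powerset x_card.
rewrite [X in X <= _]big_mkcond [X in _ <= X]big_mkcond /=.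
apply: ler_sum => O _; case: ifP => [/andP[OS O0]|_]; last by case: ifP.
rewrite OS; rewrite -card_gt0 in O0.
have Or : (#|O| <= r)%N by rewrite -(x_card SI) subset_leq_card.
apply: (@le_trans _ _ (\sum_(S' in [set S' in I | O \subset x S'])
    p ^+ (r.*2 - #|O|))).
  rewrite [X in _ <= X]big_mkcond [X in X <= _]big_mkcond /=.
  apply: ler_sum => S' _; case: ifP; last first.
    by move=> _; case: ifP => // _; rewrite exprn_ge0 // ltW.
  case/andP => /andP[S'I _] /eqP eO.
  rewrite inE S'I -{1}eO subsetIr /=.
  by rewrite cardsU eO !x_card // addnn.
rewrite sumr_const -[_ *+ _]mulr_natl.
have pk : 0 <= p ^+ (r.*2 - #|O|) by rewrite exprn_ge0 // ltW.
apply: (le_trans (ler_wpM2r pk (x_deg O0))).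
apply: le_of_eq.
have -> : p ^+ r.*2 = p * p ^+ #|O|.-1 * p ^+ (r.*2 - #|O|).
  rewrite -exprS -exprD prednK // subnKC // (leq_trans Or) //.
  by rewrite -addnn leq_addr.
move: (p_gt0) (p ^+ #|O|.-1) (p ^+ (r.*2 - #|O|)) (#|E|%:R^-1 : R) => ? a c y.
by field; rewrite gt_eqF.
Qed.

(** Disjoint edges are independent and only the overlapping pairs of
    overlap_count contribute. *)
Lemma variance_X q (m := \sum_(S in I) \prod_(u in x S) q u) :
  (forall u, 0 <= q u <= p) ->
  \sum_G prodm q G * (edges_in G - m) ^+ 2 <=
  (2 ^ r)%:R * K * (#|I|%:R * p ^+ r) ^+ 2 / (#|E|%:R * p).
Proof.
move=> qp.
have q0 u : 0 <= q u by case/andP: (qp u).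
have qle u : q u <= p by case/andP: (qp u).
have prod_le (T : {set E}) : \prod_(u in T) q u <= p ^+ #|T|.
  by rewrite -prodr_const; apply: ler_prod => u _; exact: qp.
have -> : \sum_G prodm q G * (edges_in G - m) ^+ 2 =
  \sum_(S in I) \sum_(S' in I) (\prod_(u in x S :|: x S') q u -
     \prod_(u in x S) q u * \prod_(u in x S') q u).
  transitivity (\sum_G prodm q G * (edges_in G) ^+ 2 - m ^+ 2).
    transitivity (\sum_G (prodm q G * (edges_in G) ^+ 2 - 2 * m * (prodm q G * edges_in G) +
       prodm q G * m ^+ 2)); first by apply: eq_bigr => G _; ring.
    by rewrite big_split /= sumrB -mulr_sumr -mulr_suml mean_X sum_prodm -/m; ring.
  under [RHS]eq_bigr do rewrite sumrB -mulr_sumr.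
  rewrite sumrB -mulr_suml -/m expr2; congr (_ - _).
  under eq_bigr => G _ do rewrite expr2 mulr_suml mulr_sumr.
  rewrite exchange_big /=; apply: eq_bigr => S _.
  under eq_bigr => G _ do rewrite mulr_sumr mulr_sumr.
  rewrite exchange_big /=; apply: eq_bigr => S' _.
  rewrite -prodm_contain; apply: eq_bigr => G _.
  by rewrite /contains subUset -natrM mulnb.
apply: (@le_trans _ _ (\sum_(S in I)
    (2 ^ r)%:R * K * p ^+ r.*2 / p * (#|I|%:R / #|E|%:R))); last first.
  rewrite sumr_const -[_ *+ _]mulr_natl -muln2 exprM invfM.
  move: (p_gt0) => ?; move: (#|E|%:R^-1) => y.
  by apply: le_of_eq; field; rewrite gt_eqF.
apply: ler_sum => S SI; apply: le_trans (overlap_count SI).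
rewrite [X in _ <= X]big_mkcondr; apply: ler_sum => S' S'I.
case: ifPn => [_|/negbNE dis].
  apply: le_trans (prod_le _); rewrite gerBl.
  by rewrite mulr_ge0 // prodr_ge0.
rewrite subr_le0; apply: le_of_eq.
rewrite -bigU //=; by apply: eq_bigl => u; rewrite !inE.
Qed.

Lemma chebyshev_X q (a : R) (m := \sum_(S in I) \prod_(u in x S) q u) :
  (forall u, 0 <= q u <= p) -> m < a ->
  (\sum_(G | a < edges_in G) prodm q G) * (a - m) ^+ 2 <=
  (2 ^ r)%:R * K * (#|I|%:R * p ^+ r) ^+ 2 / (#|E|%:R * p).
Proof.
move=> qp ma; apply: le_trans (variance_X qp); rewrite mulr_suml big_mkcond.
have Q0 G : 0 <= prodm q G.
  apply: prodm_ge0 => u; have /andP[-> h] := qp u.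
  by rewrite (le_trans h) // ltW.
apply: ler_sum => G _; case: ifPn => [aX|_]; last by rewrite mulr_ge0 ?sqr_ge0.
rewrite ler_wpM2l // ler_sqr ?nnegrE ?subr_ge0; [|exact: ltW|].
  by rewrite lerD2r ltW.
by rewrite (le_trans (ltW ma)) // ltW.
Qed.

(** If the mean drops by a factor 1 - e then a positive fraction of the q u
    is well below p: otherwise most edges would avoid all those u. *)
Lemma relent_cost (e : R) q (g := e / (2 * (K + r%:R + 1))) :
  0 < e <= 1 -> (0 < #|I|)%N -> (0 < #|E|)%N -> (forall u, 0 <= q u <= 1) ->
  \sum_(S in I) \prod_(u in x S) q u <= (1 - e) * (#|I|%:R * p ^+ r) ->
  g ^+ 3 / 4 * (#|E|%:R * p) <= \sum_u relent p (q u).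
Proof.
move=> /andP[e0 e1] I0 E0 q01 mean_le.
have I0' : 0 < #|I|%:R :> R by rewrite ltr0n.
have E0' : 0 < #|E|%:R :> R by rewrite ltr0n.
have Kr1 : 1 <= K + r%:R + 1 by rewrite lerDr addr_ge0.
have Kr0 : 0 < K + r%:R + 1 by exact: lt_le_trans Kr1.
have g0 : 0 < g by rewrite divr_gt0 // mulr_gt0.
have g1 : g <= 1 / 2.
  rewrite ler_pdivrMr ?mulr_gt0 // (le_trans e1) //.
  by rewrite mulrA mul1r mulVf ?mul1r.
have gK : g * (K + r%:R + 1) = e / 2 by rewrite /g; field; rewrite gt_eqF.
(* If B were small, the mean would be at least (1 - K g) (1 - g) ^ r > 1 - e
   times its value at p. *)
pose B := [set u | q u < (1 - g) * p].
have [Bsmall|Blarge] := leP #|B|%:R (g * #|E|%:R).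
  exfalso; move: mean_le; apply/negP; rewrite -ltNge.
  have g1' : 0 <= 1 - g by rewrite subr_ge0 (le_trans g1) // ler_pdivrMr // mul1r ler1n.
  have pr0 : 0 < p ^+ r by rewrite exprn_gt0.
  apply: (@lt_le_trans _ _ (\sum_(S in I | [disjoint x S & B]) ((1 - g) * p) ^+ r)); last first.
    rewrite big_mkcondr; apply: ler_sum => S SI; case: ifPn => dB; last first.
      by apply: prodr_ge0 => u _; case/andP: (q01 u).
    rewrite -(x_card SI) -prodr_const; apply: ler_prod => u uS.
    rewrite mulr_ge0 ?(ltW p_gt0) //=.
    by have := disjointFr dB uS; rewrite inE => /negbT; rewrite -leNgt.
  rewrite sumr_const -[ltRHS]mulr_natl exprMn.
  have bern : 1 - r%:R * g <= (1 - g) ^+ r.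
    elim: (r) => [|k IH]; first by rewrite mul0r subr0 expr0.
    rewrite exprS; apply: (@le_trans _ _ ((1 - g) * (1 - k%:R * g))); last by rewrite ler_wpM2l.
    rewrite -natr1; have : 0 <= k%:R * g ^+ 2 by rewrite mulr_ge0 ?sqr_ge0.
    by lra.
  have count : #|I|%:R * (1 - K * g) <= #|[pred S in I | [disjoint x S & B]]|%:R.
    have := card_meeting B x_deg1.
    have -> : #|[set S in I | ~~ [disjoint x S & B]]|%:R =
       #|I|%:R - #|[pred S in I | [disjoint x S & B]]|%:R :> R.
      rewrite -(cardID (fun S => [disjoint x S & B]) (mem I)) natrD addrAC.
      rewrite (_ : #|[predI mem I & _]| = #|[pred S in I | [disjoint x S & B]]|); last first.
        by apply: eq_card => S; rewrite !inE.
      rewrite subrr add0r; congr _%:R.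
      by apply: eq_card => S; rewrite !inE andbC.
    move=> h; have h2 : #|B|%:R * (K * (#|I|%:R / #|E|%:R)) <= K * g * #|I|%:R.
      have c0 : 0 <= K * (#|I|%:R / #|E|%:R) by rewrite mulr_ge0 // divr_ge0.
      apply: (le_trans (ler_wpM2r c0 Bsmall)).
      by apply: le_of_eq; field; rewrite gt_eqF.
    by move: (le_trans h h2); rewrite mulrBr mulr1; lra.
  have Kg0 : 0 <= K * g by rewrite mulr_ge0 // ltW.
  have rg0 : 0 <= r%:R * g by rewrite mulr_ge0 // ltW.
  have sumg : K * g + r%:R * g <= e / 2 by rewrite -gK; nra.
  have prod1 : 1 - e < (1 - K * g) * (1 - r%:R * g) by nra.
  have c1 : 0 <= 1 - K * g by nra.
  have c2 : 0 <= 1 - r%:R * g by nra.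
  apply: (@lt_le_trans _ _ (#|I|%:R * (1 - K * g) * ((1 - r%:R * g) * p ^+ r))).
    rewrite [ltLHS]mulrC [ltRHS](_ : _ =
      #|I|%:R * p ^+ r * ((1 - K * g) * (1 - r%:R * g))); last by ring.
    by rewrite ltr_pM2l // mulr_gt0.
  apply: ler_pM => //; [|apply: mulr_ge0 => //; exact: ltW|].
    by rewrite mulr_ge0.
  by rewrite ler_wpM2r // ltW.
apply: (@le_trans _ _ (\sum_(u in B) (g / 2) ^+ 2 * p)).
  rewrite sumr_const -[X in _ <= X]mulr_natl.
  rewrite [X in X <= _](_ : _ = g * #|E|%:R * ((g / 2) ^+ 2 * p)); last by field.
  by rewrite ler_wpM2r ?(ltW Blarge) // mulr_ge0 ?sqr_ge0 // ltW.
rewrite big_mkcond; apply: ler_sum => u _; case: ifPn => [|_]; last exact: relent_ge0.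
rewrite inE => qu; apply: le_trans (relent_ge_hellinger p01 (q01 u)).
have sp : 0 < Num.sqrt p by rewrite sqrtr_gt0.
have q0 : 0 <= q u by case/andP: (q01 u).
have g2 : 0 <= 1 - g / 2 by lra.
have sq : Num.sqrt (q u) <= (1 - g / 2) * Num.sqrt p.
  rewrite -(ler_pXn2r (n := 2)) ?nnegrE ?sqrtr_ge0 ?mulr_ge0 ?(ltW sp) //.
  rewrite exprMn !sqr_sqrtr ?(ltW p_gt0) //; apply: (le_trans (ltW qu)).
  rewrite ler_wpM2r ?(ltW p_gt0) //; have := sqr_ge0 (g / 2); nra.
rewrite -[p in X in X <= _](sqr_sqrtr (ltW p_gt0)) -exprMn ler_sqr ?nnegrE; first lra.
  by rewrite mulr_ge0 // ltW // divr_gt0.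
by rewrite subr_ge0 (le_trans sq) // ler_piMl ?(ltW sp) //; lra.
Qed.

End UpperTail.

Lemma sum_contains (R : realType) (E J : finType) (I : {set J})
    (x : J -> {set E}) (G : {set E}) :
  \sum_(S in I) contains R (x S) G = #|[set S in I | x S \subset G]|%:R.
Proof.
rewrite -sum1_card natr_sum big_mkcond [RHS]big_mkcond; apply: eq_bigr => S _.
by rewrite inE /contains; case: (S \in I); case: (_ \subset _).
Qed.

(** Unless eta is tiny, the measure tilted to the minimum of q and p satisfies
    the lower tail event with probability near 1, by Chebyshev; and the
    additive 1 in the cost of tilting is negligible, as the cost is of order
    #|E| p. *)
Theorem upper_tail_chebyshev (R : realType) (r : nat) (K e eta0 : R) :
  0 <= K -> 0 < e <= 1 / 2 -> 0 < eta0 ->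
  exists2 L0 : R, 0 < L0 &
  forall (E J : finType) (p : R) (I : {set J}) (x : J -> {set E}) (eta : R)
    (q : E -> R) (A := fun G : {set E} => #|[set S in I | x S \subset G]|%:R <=
                               eta * (#|I|%:R * p ^+ r)),
  0 < p < 1 -> (0 < #|I|)%N -> (0 < #|E|)%N -> L0 <= #|E|%:R * p ->
  {in I, forall S, #|x S| = r} ->
  (forall T : {set E}, (0 < #|T|)%N -> #|[set S in I | T \subset x S]|%:R <=
    K * p ^+ #|T|.-1 * (#|I|%:R / #|E|%:R)) ->
  eta0 <= eta <= 1 -> (forall u, 0 <= q u <= 1) ->
  \sum_(S in I) \prod_(u in x S) q u <= (1 - e) * (eta * (#|I|%:R * p ^+ r)) ->
  0 < \sum_G condm p A G ->
  - ln (\sum_G condm p A G) <= (1 + e) * \sum_u relent p (q u).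
Proof.
move=> K0 /andP[e0 e2] eta00.
have Kr0 : 0 < K + r%:R + 1 by rewrite ltr_wpDl ?addr_ge0.
pose g := e / (2 * (K + r%:R + 1)).
have g0 : 0 < g by rewrite divr_gt0 // mulr_gt0.
pose c := g ^+ 3 / 4.
have c0 : 0 < c by rewrite divr_gt0 // exprn_gt0.
pose L1 := (2 ^ r)%:R * K / (e * eta0) ^+ 2 * (4 / e).
pose L2 := 8 / e / c.
have L10 : 0 <= L1.
  apply: mulr_ge0; last by rewrite divr_ge0 // ltW.
  by apply: divr_ge0; [apply: mulr_ge0 | exact: sqr_ge0].
have L20 : 0 < L2 by apply: divr_gt0 => //; apply: divr_gt0.
exists (L1 + L2); first by rewrite ltr_wpDl.
move=> E J p I x eta q A p01 I0 E0 LNp xc deg /andP[eta0e eta1] q01 mean_le Z0.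
case/andP: (p01) => p0 p1.
have I0' : 0 < #|I|%:R :> R by rewrite ltr0n.
have E0' : 0 < #|E|%:R :> R by rewrite ltr0n.
have Np0 : 0 < #|E|%:R * p by rewrite mulr_gt0.
set Z := \sum_G _ in Z0 *.
set D := \sum_u relent p (q u).
pose m0 : R := #|I|%:R * p ^+ r.
have m00 : 0 < m0 by rewrite mulr_gt0 // exprn_gt0.
have eta_pos : 0 < eta by exact: lt_le_trans eta0e.
pose q' u := Num.min (q u) p.
have q'p u : 0 <= q' u <= p.
  by rewrite /q' ge_min lexx orbT andbT le_min (ltW p0) andbT; case/andP: (q01 u).
have q'q u : q' u <= q u by rewrite /q' ge_min lexx.
have q'01 u : 0 <= q' u <= 1.
  by case/andP: (q'p u) => -> /le_trans -> //; exact: ltW.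
pose m := \sum_(S in I) \prod_(u in x S) q' u.
have m_le : m <= (1 - e) * (eta * m0).
  apply: le_trans mean_le; apply: ler_sum => S _; apply: ler_prod => u _.
  by rewrite q'q andbT; case/andP: (q'p u).
have D'_le : \sum_u relent p (q' u) <= D.
  by apply: ler_sum => u _; exact: relent_min.
have D'_ge : 8 / e <= \sum_u relent p (q' u).
  have mean' : m <= (1 - e) * (#|I|%:R * p ^+ r).
    apply: (le_trans m_le); rewrite ler_wpM2l ?ler_piMl ?(ltW m00) //.
    by rewrite subr_ge0 (le_trans e2) // ler_pdivrMr // mul1r ler1n.
  have e1 : 0 < e <= 1 by rewrite e0 (le_trans e2) // ler_pdivrMr // mul1r ler1n.
  apply: le_trans (relent_cost p01 xc deg K0 e1 I0 E0 q'01 mean').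
  rewrite -/g -/c [X in _ <= X]mulrC -ler_pdivrMr // (le_trans _ LNp) // lerDr //.
have bad_le : \sum_(G : {set E} | ~~ A G) prodm q' G <= e / 4.
  have ma : m < eta * m0.
    apply: (le_lt_trans m_le); rewrite -[ltRHS]mul1r.
    have em0 : 0 < eta * m0 by exact: mulr_gt0.
    by rewrite (ltr_pM2r em0) gtrBl.
  have := chebyshev_X p01 xc deg K0 q'p ma; rewrite -/m -/m0.
  have -> : \sum_(G | eta * m0 < \sum_(S in I) contains R (x S) G) prodm q' G =
     \sum_(G : {set E} | ~~ A G) prodm q' G.
    by apply: eq_bigl => G; rewrite sum_contains /A -ltNge.
  set b := \sum_(G | _) _ => h.
  have b0 : 0 <= b by apply: sumr_ge0 => G _; exact: prodm_ge0.
  have gap : (e * eta0 * m0) ^+ 2 <= (eta * m0 - m) ^+ 2.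
    rewrite ler_sqr ?nnegrE ?subr_ge0 ?(ltW ma) //; last first.
      by rewrite ltW // mulr_gt0 // mulr_gt0.
    have : e * eta0 * m0 <= e * eta * m0.
      by rewrite ler_wpM2r ?(ltW m00) // ler_wpM2l // ltW.
    by move: m_le; lra.
  have {h} h : b * (e * eta0 * m0) ^+ 2 <=
      (2 ^ r)%:R * K * m0 ^+ 2 / (#|E|%:R * p).
    by apply: le_trans h; rewrite ler_wpM2l.
  have em : 0 < (e * eta0 * m0) ^+ 2 by rewrite exprn_gt0 // mulr_gt0 // mulr_gt0.
  move: h; rewrite -ler_pdivlMr // => /le_trans; apply.
  have L1Np : L1 <= #|E|%:R * p by rewrite (le_trans _ LNp) // lerDl ltW.
  have -> : (2 ^ r)%:R * K * m0 ^+ 2 / (#|E|%:R * p) / (e * eta0 * m0) ^+ 2 =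
      L1 * (e / 4) / (#|E|%:R * p).
    by rewrite /L1; move: (e0) => *; field; rewrite !gt_eqF.
  by rewrite ler_pdivrMr // mulrC ler_wpM2l // divr_ge0 // ltW.
have good_ge : 1 - e / 4 <= \sum_(G : {set E} | A G) prodm q' G.
  have := sum_prodm q'; rewrite (bigID A) /= => tot.
  by rewrite lerBlDr; refine (le_trans _ (lerD (lexx _) bad_le)); rewrite tot.
have := tilting p01 q'p Z0; rewrite -/Z; set Q := \sum_(G | A G) _ => tilt.
set D' := \sum_u relent p (q' u) in D'_le D'_ge tilt.
have Q0 : 0 < 1 - e / 4 by lra.
have lnZ : 0 <= - ln Z by rewrite oppr_ge0 ln_le0 // sum_condm_le1.
have h1 : - ln Z * (1 - e / 4) <= 1 + D'.
  by apply: le_trans tilt; rewrite ler_wpM2l.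
have h2 : 1 <= e / 8 * D'.
  have := ler_wpM2l (ltW (divr_gt0 e0 (ltr0n _ 8))) D'_ge.
  by have -> : e / 8 * (8 / e) = 1 by field; rewrite gt_eqF.
have D'0 : 0 <= D' by apply: le_trans D'_ge; rewrite divr_ge0 // ltW.
apply: (@le_trans _ _ ((1 + e) * D')); last by rewrite ler_wpM2l // addr_ge0 // ltW.
rewrite -(ler_pM2r Q0); apply: (le_trans h1).
have h3 : 0 <= e * (1 / 2 - e) by rewrite mulr_ge0 ?subr_ge0 // ltW.
have h4 := mulr_ge0 h3 D'0; have h5 := mulr_ge0 (ltW e0) D'0.
by move: h2 h4 h5; clear; lra.
Qed.

(** When eta is tiny, the u with q u not much smaller than p span few edges,
    hence by supersaturation are hardly more than a largest edge-free set G0;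
    the others each cost almost - ln (1 - p).  And all subsets of G0 belong to
    the lower tail event. *)
Theorem upper_tail_supersaturation (R : realType) (r : nat) (K e : R) :
  0 < K -> 0 < e <= 1 / 2 ->
  exists2 g : R, 0 < g &
  forall (E J : finType) (p : R) (I : {set J}) (x : J -> {set E}) (zeta eta : R)
    (G0 : {set E}) (q : E -> R)
    (A := fun G : {set E} => #|[set S in I | x S \subset G]|%:R <=
                               eta * (#|I|%:R * p ^+ r)),
  0 < p < 1 -> (0 < #|I|)%N -> (0 < #|E|)%N ->
  {in I, forall S, #|x S| = r} ->
  (forall u, #|[set S in I | u \in x S]|%:R <= K * (#|I|%:R / #|E|%:R)) ->
  [set S in I | x S \subset G0] = set0 ->
  (forall G : {set E}, #|[set S in I | x S \subset G]|%:R <= zeta * #|I|%:R ->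
     #|G|%:R <= #|G0|%:R + e / (4 * K) * #|E|%:R) ->
  0 <= eta <= g ^+ r * zeta -> (forall u, 0 <= q u <= 1) ->
  \sum_(S in I) \prod_(u in x S) q u <= eta * (#|I|%:R * p ^+ r) ->
  - ln (\sum_G condm p A G) <= (1 + e) * \sum_u relent p (q u).
Proof.
move=> K0 /andP[e0 e2].
pose s := e / 16.
have s01 : 0 < s <= 1 by rewrite divr_gt0 //= ler_pdivrMr //; lra.
have s0 : 0 < s by case/andP: s01.
exists (s ^+ 2); first by rewrite exprn_gt0.
move=> E J p I x zeta eta G0 q A p01 I0 E0 xc deg G0free super /andP[eta0 eta_le] q01 mean_le.
case/andP: (p01) => p0 p1.
have I0' : 0 < #|I|%:R :> R by rewrite ltr0n.
have E0' : 0 < #|E|%:R :> R by rewrite ltr0n.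
set g := s ^+ 2 in eta_le.
have g0 : 0 < g by rewrite exprn_gt0.
pose B := [set u | q u < g * p].
pose l := - ln (1 - p).
have l0 : 0 <= l by rewrite oppr_ge0 ln_le0 // gerBl ltW.
have gp0 : 0 < g * p by rewrite mulr_gt0.
have few : #|[set S in I | x S \subset ~: B]|%:R <= zeta * #|I|%:R.
  have : #|[set S in I | x S \subset ~: B]|%:R * (g * p) ^+ r <= eta * (#|I|%:R * p ^+ r).
    apply: le_trans mean_le; rewrite mulr_natl -sumr_const.
    rewrite big_mkcond [X in _ <= X]big_mkcond; apply: ler_sum => S _.
    rewrite inE; case: (boolP (S \in I)) => //= SI; case: ifP => [SB|_]; last first.
      by apply: prodr_ge0 => u _; case/andP: (q01 u).
    rewrite -(xc _ SI) -prodr_const; apply: ler_prod => u uS.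
    rewrite (ltW gp0) /=.
    by have := subsetP SB u uS; rewrite !inE -leNgt.
  rewrite exprMn [X in X <= _]mulrA [X in _ <= X]mulrA ler_pM2r ?exprn_gt0 // => h.
  have {}h : #|[set S in I | x S \subset ~: B]|%:R * g ^+ r <= g ^+ r * (zeta * #|I|%:R).
    by apply: (le_trans h); rewrite mulrA ler_wpM2r.
  by move: h; rewrite mulrC ler_pM2l // exprn_gt0.
have B_large := super _ few.
have cB : #|~: B|%:R = #|E|%:R - #|B|%:R :> R.
  by rewrite -(cardsC B) natrD addrC addKr.
have cG : #|~: G0|%:R = #|E|%:R - #|G0|%:R :> R.
  by rewrite -(cardsC G0) natrD addrAC subrr add0r.
(* No edge lies in G0, so all edges meet the complement. *)
have cover : #|E|%:R <= K * #|~: G0|%:R.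
  have := card_meeting (~: G0) deg.
  have -> : [set S in I | ~~ [disjoint x S & ~: G0]] = I.
    apply/setP => S; rewrite inE; case: (boolP (S \in I)) => //= SI.
    rewrite disjoints_subset setCK; apply/negP => h.
    by have := in_set0 S; rewrite -G0free inE SI h.
  have -> : #|~: G0|%:R * (K * (#|I|%:R / #|E|%:R)) =
      #|I|%:R * (K * #|~: G0|%:R / #|E|%:R) by field; rewrite gt_eqF.
  by rewrite -[X in X <= _]mulr1 ler_pM2l // ler_pdivlMr // mul1r.
have D_ge : (1 - e / 4) * l * #|B|%:R <= \sum_u relent p (q u).
  apply: (@le_trans _ _ (\sum_(u in B) (1 - 4 * s) * l)).
    rewrite sumr_const -[X in _ <= X]mulr_natr /s.
    by rewrite [4 * (e / 16)](_ : _ = e / 4) //; field.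
  rewrite big_mkcond; apply: ler_sum => u _; case: ifPn => [|_]; last exact: relent_ge0.
  by rewrite inE => qu; apply: relent_near0 => //; case/andP: (q01 u).
have Z_ge : (1 - p) ^+ #|~: G0| <= \sum_G condm p A G.
  rewrite -(sum_prodm_subset p G0) big_mkcond; apply: ler_sum => G _.
  have P0 : 0 <= prodm (fun=> p) G by apply: prodm_ge0 => u; rewrite !ltW.
  case: ifPn => [GG|_]; last by rewrite mulr_ge0.
  rewrite /condm [A G](_ : _ = true) ?mul1r //.
  rewrite /A (_ : [set S in I | x S \subset G] = set0); last first.
    apply/eqP; rewrite -subset0 -G0free; apply/subsetP => S; rewrite !inE.
    by case/andP => -> /subset_trans; apply.
  by rewrite cards0 mulr_ge0 // mulr_ge0 // exprn_ge0 // ltW.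
have p1' : 0 < 1 - p by rewrite subr_gt0.
have lnZ_le : - ln (\sum_G condm p A G) <= #|~: G0|%:R * l.
  rewrite /l mulrN lerN2 mulr_natl -lnXn //.
  by rewrite ler_ln ?posrE ?exprn_gt0 // (lt_le_trans _ Z_ge) // exprn_gt0.
apply: (le_trans lnZ_le).
have B_ge : (1 - e / 4) * #|~: G0|%:R <= #|B|%:R.
  have h : e / (4 * K) * #|E|%:R <= e / 4 * #|~: G0|%:R.
    have ek : 0 <= e / (4 * K) by rewrite divr_ge0 // ?mulr_ge0 // ltW.
    have := ler_wpM2l ek cover; congr (_ <= _).
    by field; rewrite gt_eqF.
  by move: B_large; rewrite cB; move: h; rewrite cG; lra.
have e4 : 0 <= 1 - e / 4 by lra.
have h1 : (1 - e / 4) ^+ 2 * (#|~: G0|%:R * l) <= \sum_u relent p (q u).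
  apply: le_trans D_ge.
  have := ler_wpM2l (mulr_ge0 e4 l0) B_ge; congr (_ <= _); ring.
have h2 : 1 <= (1 + e) * (1 - e / 4) ^+ 2.
  have : 0 <= e * (1 / 2 - e) by rewrite mulr_ge0 ?subr_ge0 // ltW.
  have : 0 <= e ^+ 3 by rewrite exprn_ge0 // ltW.
  by rewrite !exprS expr0; nra.
have h3 : 0 <= #|~: G0|%:R * l by rewrite mulr_ge0.
have e1 : 0 <= 1 + e by rewrite addr_ge0 // ltW.
apply: le_trans (ler_wpM2l e1 h1).
by rewrite [X in _ <= X]mulrA ler_peMl.
Qed.

(** * Counting copies of a graph *)

Section Counts.
Variables (V : finType) (H : graph V).
Local Notation v := #|V|.
Local Notation r := #|H|.

Definition span (W : finType) (F : graph W) : {set W} := \bigcup_(e in F) val e.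

Lemma card_edge (W : finType) (e : edge W) : #|val e| = 2%N.
Proof. by apply/eqP; case: e. Qed.

Lemma edge_sub_span (W : finType) (F : graph W) e : e \in F -> val e \subset span F.
Proof. exact: bigcup_sup. Qed.

Lemma card_span_le (W : finType) (F : graph W) : (#|span F| <= 2 * #|F|)%N.
Proof.
rewrite mulnC -sum_nat_const /span.
elim/big_ind2: _ => [|A1 n1 A2 n2 h1 h2|e _]; rewrite ?cards0 ?card_edge //.
by apply: leq_trans (leq_add h1 h2); rewrite cardsU leq_subr.
Qed.

Lemma card_span_gt2 (W : finType) (F : graph W) : (2 <= #|F|)%N -> (3 <= #|span F|)%N.
Proof.
move=> F2; rewrite ltnNge; apply/negP => h.
have eqs e : e \in F -> val e = span F.
  move=> eF; apply/eqP; rewrite eqEcard edge_sub_span //.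
  by rewrite card_edge.
move: F2; rewrite ltnNge => /negP; apply; apply/card_le1P => e eF e'.
rewrite inE; apply/idP/eqP => [e'F|-> //].
by apply: val_inj; rewrite !eqs.
Qed.

Lemma card_span_ge2 (W : finType) (F : graph W) : (0 < #|F|)%N -> (2 <= #|span F|)%N.
Proof.
by case/card_gt0P => e eF; rewrite -(card_edge e) subset_leq_card ?edge_sub_span.
Qed.

Lemma card_graph (n : nat) : #|{: edge 'I_n}| = 'C(n, 2).
Proof.
by rewrite card_sig -[n in RHS]card_ord -card_draws cardsE.
Qed.

Variable n : nat.
Implicit Types (f : {ffun V -> 'I_n}) (S : {set 'I_n} * graph 'I_n).

Definition all_copies : {set {set 'I_n} * graph 'I_n} := [set S | isograph H S].

Definition copy_at f : {set 'I_n} * graph 'I_n :=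
  (f @: [set: V],
   [set e : edge 'I_n | val e \in [set f @: val e' | e' : edge V in H]]).

Lemma isographP S : reflect (exists2 f : {ffun V -> 'I_n}, injectiveb f & S = copy_at f) (isograph H S).
Proof.
apply: (iffP existsP) => [[f /and3P[fi /eqP S1 /eqP S2]]|[f fi ->]].
  exists f => //; rewrite [S]surjective_pairing S1 /copy_at; congr pair.
  apply/setP => e; rewrite inE -S2; apply/idP/imsetP => [eS|[e' e'S /val_inj -> //]].
  by exists e.
exists f; rewrite fi eqxx /=; apply/eqP/setP => y; apply/imsetP/idP => [[e]|].
  by rewrite inE => h ->.
case/imsetP => e' e'H ->.
have c2 : #|f @: val e'| == 2%N by rewrite card_imset ?card_edge //; exact/injectiveP.
by exists (exist _ (f @: val e') c2) => //; rewrite inE /=; apply/imsetP; exists e'.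
Qed.

Lemma copiesE (G : graph 'I_n) : copies H G = #|[set S in all_copies | S.2 \subset G]|.
Proof.
rewrite /copies; apply: eq_card => S; rewrite !inE /subgraph.
case: (isographP S) => [[f fi ->]|_]; rewrite ?andbF //= !andbT.
case: (_ \subset G) => //=.
apply/forall_inP => e; rewrite inE => /imsetP[e' _ ->].
by apply: imsetS; exact: subsetT.
Qed.

Lemma imset_edge_inj (f : {ffun V -> 'I_n}) : injective f -> injective (fun e' : edge V => f @: val e').
Proof. by move=> fi e1 e2 /(imset_inj fi) /val_inj. Qed.

Lemma card_copy S : S \in all_copies -> #|S.2| = r.
Proof.
rewrite inE => /existsP[f /and3P[/injectiveP fi _ /eqP S2]].
rewrite -(card_imset (mem S.2) val_inj) -(card_imset (mem H) (imset_edge_inj fi)).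
by rewrite -S2.
Qed.

(** At most v ^ v embeddings give the same copy, as all of them map V to its
    vertex set. *)
Lemma card_all_copies_ge : (n ^_ v <= #|all_copies| * v ^ v)%N.
Proof.
have <- : #|[set f : {ffun V -> 'I_n} | injectiveb f]| = n ^_ v.
  by rewrite card_inj_ffuns card_ord.
pose P := [set f : {ffun V -> 'I_n} | injectiveb f].
rewrite -/P -sum1_card (partition_big copy_at (mem all_copies)) /=; last first.
  by move=> f; rewrite !inE => fi; apply/isographP; exists f.
rewrite -sum_nat_const; apply: leq_sum => S SI.
have Sv : #|S.1| = v.
  move: SI; rewrite inE => /isographP[f /injectiveP fi ->].
  by rewrite card_imset // cardsT.
rewrite sum1_card -{1}Sv -(card_ffun_on V (mem S.1)).
apply: subset_leq_card; apply/subsetP => f; rewrite inE => /andP[_ /eqP <-].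
by apply/ffun_onP => y; apply: imset_f; rewrite inE.
Qed.

(** An embedding f whose image contains T maps a subgraph F with #|T| edges
    onto T, hence its span, as large as the span of T, into that of T. *)
Lemma codegree_copies (T : graph 'I_n) :
  (#|[set S in all_copies | T \subset S.2]| <=
   \sum_(F : graph V | (F \subset H) && (#|F| == #|T|)) v ^ v * n ^ (v - #|span F|))%N.
Proof.
pose Q F := [set f : {ffun V -> 'I_n} | [forall y in span F, f y \in span T] &&
   (#|span T| <= v)%N].
apply: (@leq_trans #|[set f : {ffun V -> 'I_n} | injectiveb f & T \subset (copy_at f).2]|).
  have sub : [set S in all_copies | T \subset S.2] \subset
      copy_at @: [set f : {ffun V -> 'I_n} | injectiveb f & T \subset (copy_at f).2].
    apply/subsetP => S; rewrite !inE => /andP[/isographP[f fi ->] TS].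
    by apply: imset_f; rewrite inE fi.
  exact: leq_trans (subset_leq_card sub) (leq_imset_card _ _).
apply: (@leq_trans #|\bigcup_(F : graph V | (F \subset H) && (#|F| == #|T|)) Q F|).
  apply: subset_leq_card; apply/subsetP => f; rewrite inE => /andP[/injectiveP fi TS].
  pose F : graph V := [set e in H | f @: val e \in [set val e' | e' : edge 'I_n in T]].
  have eF : [set f @: val e | e : edge V in F] = [set val e' | e' : edge 'I_n in T].
    apply/setP => y; apply/imsetP/imsetP => [[e]|[e' e'T ->]].
      by rewrite inE => /andP[_ /imsetP[e' e'T ->]] ->; exists e'.
    have := subsetP TS _ e'T; rewrite inE => /imsetP[e eH e'e].
    by exists e => //; rewrite inE eH -e'e imset_f.
  have spanE : f @: span F = span T.
    apply/setP => y; apply/imsetP/bigcupP => [[z /bigcupP[e eF' ze] ->]|[e' e'T ye']].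
      have : f @: val e \in [set val e' | e' : edge 'I_n in T] by rewrite -eF imset_f.
      by case/imsetP => e' e'T ee'; exists e' => //; rewrite -ee' imset_f.
    have : val e' \in [set f @: val e | e : edge V in F] by rewrite eF imset_f.
    case/imsetP => e eF' e'e; move: ye'; rewrite e'e => /imsetP[z ze ->].
    by exists z => //; apply/bigcupP; exists e.
  apply/bigcupP; exists F.
    apply/andP; split; first by apply/subsetP => e; rewrite inE => /andP[].
    rewrite -(card_imset (mem F) (imset_edge_inj fi)) -(card_imset (mem T) val_inj).
    by rewrite -eF.
  rewrite inE; apply/andP; split.
    by apply/forall_inP => y yF; rewrite -spanE imset_f.
  by rewrite -spanE card_imset // max_card.
apply: (@leq_trans (\sum_(F : graph V | (F \subset H) && (#|F| == #|T|)) #|Q F|)).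
  elim/big_ind2: _ => [|A1 n1 A2 n2 h1 h2|//]; first by rewrite cards0.
  by apply: leq_trans (leq_add h1 h2); rewrite cardsU leq_subr.
apply: leq_sum => F _.
have [Tv|Tv] := leqP #|span T| v; last first.
  rewrite (_ : Q F = set0) ?cards0 //; apply/setP => f.
  by rewrite !inE leqNgt Tv andbF.
pose fam (y : V) : pred 'I_n := fun z => (y \in span F) ==> (z \in span T).
apply: (@leq_trans #|family fam|).
  apply: subset_leq_card; apply/subsetP => f; rewrite inE => /andP[/forall_inP h _].
  by apply/familyP => y; apply/implyP; exact: h.
rewrite card_family foldrE big_map big_enum /=.
rewrite (bigID (fun y => y \in span F)) /=.
rewrite (eq_bigr (fun=> #|span T|)); last first.
  by move=> y yF; apply: eq_card => z; rewrite {1}/in_mem /= /fam yF.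
rewrite prod_nat_const [X in (_ * X)%N](eq_bigr (fun=> n)); last first.
  move=> y yF; rewrite -[RHS]card_ord; apply: eq_card => z.
  by rewrite {1}/in_mem /= /fam (negbTE yF).
rewrite prod_nat_const leq_mul //.
  have pw k : (#|span T| ^ k <= v ^ k)%N.
    by elim: k => // k IH; rewrite !expnS leq_mul.
  apply: leq_trans (pw _) _; case: (posnP v) => [v0|v0]; last first.
    by rewrite leq_pexp2l // max_card.
  by rewrite (_ : #|_| = 0%N) ?v0 //; apply/eqP; rewrite -leqn0 -v0 max_card.
have -> : #|[predC span F]| = (v - #|span F|)%N.
  by rewrite -(cardC (mem (span F))) addKn.
by [].
Qed.

End Counts.

(** * Codegrees and the 2-density *)

Section Sizes.
Variables (V : finType) (H : graph V) (n : nat).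
Hypothesis H0 : H != set0.
Local Notation v := #|V|.

Lemma card_vertices_ge2 : (2 <= v)%N.
Proof.
case/set0Pn: H0 => e eH; rewrite -(card_edge e); exact: max_card.
Qed.

Hypothesis nv : (2 * v <= n)%N.
Local Notation I := (all_copies H n).
Local Notation N := #|{: edge 'I_n}|.

Let n_pos : (0 < n)%N.
Proof.
by apply: leq_trans nv; rewrite muln_gt0 /=; exact: ltnW card_vertices_ge2.
Qed.

Lemma pow_le_copies : (n ^ v <= (2 * v) ^ v * #|I|)%N.
Proof.
rewrite expnMn -mulnA; apply: (@leq_trans (2 ^ v * n ^_ v)); last first.
  rewrite leq_mul2l (mulnC (v ^ v)%N) card_all_copies_ge orbT //.
rewrite ffact_prod -[X in (2 ^ X)%N]card_ord -[X in (n ^ X)%N]card_ord.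
rewrite -!prod_nat_const -big_split /=; apply: leq_prod => i _.
have h : (2 * i <= n)%N by apply: leq_trans nv; rewrite leq_mul2l ltnW ?orbT.
by move: h; clear; lia.
Qed.

Lemma card_copies_gt0 : (0 < #|I|)%N.
Proof.
have := pow_le_copies; case: #|I| => //; rewrite muln0 leqn0 expn_eq0.
by rewrite (gtn_eqF n_pos).
Qed.

Lemma card_edges_bounds : (n ^ 2 <= 4 * N)%N /\ (N <= n ^ 2)%N.
Proof.
have n4 : (4 <= n)%N by apply: leq_trans nv; have := card_vertices_ge2; lia.
rewrite card_graph bin2; split; last first.
  by apply: leq_trans (half_leq (leqnn _)) _; rewrite -divn2; nia.
by have := odd_double_half (n * n.-1); case: odd; lia.
Qed.

Lemma pow2_le_copies (R : realType) : n%:R ^+ (v - 2) <= ((2 * v) ^ v)%:R * (#|I|%:R / N%:R) :> R.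
Proof.
have [h1 h2] := card_edges_bounds.
have N0 : (0 < N)%N.
  by rewrite lt0n; apply: contraTneq h1 => ->; rewrite muln0 -ltnNge expn_gt0 n_pos.
rewrite mulrA ler_pdivlMr ?ltr0n // -natrX -!natrM ler_nat.
apply: leq_trans pow_le_copies; apply: leq_trans (leq_mul (leqnn _) h2) _.
by rewrite -expnD subnK // card_vertices_ge2.
Qed.

End Sizes.

Section Density.
Variables (R : realType) (V : finType) (H : graph V) (n : nat) (p L : R).
Hypothesis H0 : H != set0.
Hypothesis n0 : (0 < n)%N.
Hypothesis p01 : 0 < p < 1.
Hypothesis L1 : 1 <= L.
Hypothesis Lp : L * n%:R `^ (- (1 / m2 R H)) <= p.
Local Notation v := #|V|.
Local Notation r := #|H|.
Let p_gt0 : 0 < p. Proof. by case/andP: p01. Qed.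
Let L_gt0 : 0 < L. Proof. exact: lt_le_trans L1. Qed.
Let n_ge1 : 1 <= n%:R :> R. Proof. by rewrite ler1n. Qed.
Let n_gt0 : 0 < n%:R :> R. Proof. by rewrite ltr0n. Qed.

Lemma m2_ge (F : graph V) : F \subset H -> (2 <= #|F|)%N ->
  (#|F|%:R - 1) / (#|span F|%:R - 2) <= m2 R H.
Proof.
move=> FH F2; rewrite /m2 (leq_trans F2 (subset_leq_card FH)).
apply: (@le_bigmax_cond _ _ _ 0 (span F, F)
  (fun S : {set V} * graph V => subgraph H S && (2 <= #|S.2|)%N)
  (fun S => (#|S.2|%:R - 1) / (#|S.1|%:R - 2))).
rewrite /= F2 andbT /subgraph /= FH /=; apply/forall_inP => e eF.
exact: edge_sub_span.
Qed.

(** The right-hand side is the order of the expected number of copies of F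
    through a given edge; the 2-density is the exponent at which all of these
    numbers become large. *)
Lemma subgraph_density (F : graph V) : F \subset H -> (2 <= #|F|)%N ->
  L <= p ^+ #|F|.-1 * n%:R ^+ (#|span F| - 2).
Proof.
move=> FH F2; have sF := card_span_gt2 F2; have mF := m2_ge FH F2.
move: (Lp) mF; set m := m2 R H => Lp' mF; set s := #|F| in F2 mF *.
set w := #|span F| in sF mF *.
have sE : s%:R - 1 = s.-1%:R :> R by rewrite -[in LHS](prednK (ltnW F2)) -natr1 addrK.
have wE : w%:R - 2 = (w - 2)%:R :> R by rewrite natrB // ltnW.
rewrite sE wE in mF.
have s0 : 0 < s.-1%:R :> R by rewrite ltr0n -ltnS prednK // ltnW.
have w0 : 0 < (w - 2)%:R :> R by rewrite ltr0n subn_gt0.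
have m0 : 0 < m by apply: lt_le_trans mF; rewrite divr_gt0.
have sm : s.-1%:R / m <= (w - 2)%:R.
  by rewrite ler_pdivrMr // mulrC -ler_pdivrMr.
have h : (L * n%:R `^ (- (1 / m))) ^+ s.-1 <= p ^+ s.-1.
  by rewrite lerXn2r ?nnegrE ?mulr_ge0 ?powR_ge0 // ltW.
apply: (@le_trans _ _ ((L * n%:R `^ (- (1 / m))) ^+ s.-1 * n%:R ^+ (w - 2))); last first.
  by rewrite ler_wpM2r // exprn_ge0.
rewrite exprMn -mulrA; apply: (@le_trans _ _ (L ^+ s.-1 * 1)).
  rewrite mulr1 -[X in X <= _]expr1 ler_weXn2l //.
  by rewrite -ltnS prednK // ltnW.
rewrite ler_wpM2l ?exprn_ge0 ?(ltW L_gt0) //.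
rewrite -!powR_mulrn ?powR_ge0 ?(ltW n_gt0) // -powRrM -powRD; last first.
  by apply/implyP => _; rewrite gt_eqF.
rewrite -[X in X <= _](powRr0 n%:R) ler_powR //.
by rewrite mulNr div1r mulrC addrC subr_ge0.
Qed.

Lemma L_le_n2p : L <= n%:R ^+ 2 * p.
Proof.
have [H2|H1] := leqP 2 r; last first.
  have m2E : m2 R H = 1 / 2 by rewrite /m2 leqNgt H1.
  move: Lp; rewrite m2E.
  have -> : 1 / (1 / 2) = 2 :> R by field.
  rewrite powRN -[2]/(2%:R) powR_mulrn ?(ltW n_gt0) //.
  by rewrite ler_pdivrMr ?exprn_gt0 // mulrC.
have [F FH F2] : exists2 F : graph V, F \subset H & #|F| = 2%N.
  case/card_gt1P: H2 => e1 [e2 [e1H e2H e12]].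
  exists [set e1; e2]; last by rewrite cards2 e12.
  by apply/subsetP => e; rewrite !inE => /orP[/eqP ->|/eqP ->].
have := subgraph_density FH; rewrite F2 => /(_ isT); rewrite expr1 => /le_trans.
apply; rewrite mulrC ler_wpM2r ?(ltW p_gt0) // ler_weXn2l //.
by have := card_span_le F; rewrite F2 leq_subLR.
Qed.

Hypothesis nv : (2 * v <= n)%N.
Local Notation I := (all_copies H n).
Local Notation N := #|{: edge 'I_n}|.

(** A copy through T pins down a subgraph F with #|T| edges, hence has
    n ^ (#|span F| - 2) times fewer choices of vertices than a copy through a
    single edge.  By subgraph_density this number is at least L times
    p ^- #|T|.-1. *)
Lemma codegree_le (T : graph 'I_n) (K := (2 ^ r * v ^ v * (2 * v) ^ v)%N) :
  (0 < #|T|)%N ->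
  #|[set S in I | T \subset S.2]|%:R <=
    K%:R / (if (2 <= #|T|)%N then L else 1) * p ^+ #|T|.-1 * (#|I|%:R / N%:R).
Proof.
move=> T0; set L' := if _ then _ else _.
have L'0 : 0 < L' by rewrite /L'; case: ifP.
have term (F : graph V) : F \subset H -> #|F| = #|T| ->
    (v ^ v * n ^ (v - #|span F|))%:R <=
    (v ^ v)%:R / L' * p ^+ #|T|.-1 * (((2 * v) ^ v)%:R * (#|I|%:R / N%:R)) :> R.
  move=> FH FT; have sv : (#|span F| <= v)%N by exact: max_card.
  have s2 : (2 <= #|span F|)%N by rewrite card_span_ge2 // FT.
  have dens : L' <= p ^+ #|T|.-1 * n%:R ^+ (#|span F| - 2).
    rewrite /L' -FT; case: ifPn => [F2|]; first exact: subgraph_density.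
    rewrite -ltnNge ltnS => F1; have -> : #|F| = 1%N by move: T0; rewrite -FT; case: #|F| F1 => [|[]].
    by rewrite expr0 mul1r exprn_ege1.
  have c0 : 0 <= (v ^ v)%:R / L' * p ^+ #|T|.-1.
    by rewrite mulr_ge0 ?divr_ge0 ?exprn_ge0 // ltW.
  apply: le_trans (ler_wpM2l c0 (pow2_le_copies H0 nv R)).
  have -> : (v - 2)%N = ((v - #|span F|) + (#|span F| - 2))%N.
    by rewrite addnBA // subnK.
  rewrite exprD natrM (natrX _ n).
  rewrite [X in _ <= X](_ : _ = (v ^ v)%:R * n%:R ^+ (v - #|span F|) *
     (p ^+ #|T|.-1 * n%:R ^+ (#|span F| - 2) / L')); last first.
    have reorder (a b c d l : R) : a / l * b * (c * d) = a * c * (b * d / l) by ring.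
    exact: reorder.
  rewrite ler_peMr ?mulr_ge0 ?exprn_ge0 //.
  by rewrite ler_pdivlMr // mul1r.
have := codegree_copies H T; rewrite -(ler_nat R) => /le_trans; apply.
rewrite natr_sum.
apply: (@le_trans _ _ (\sum_(F : graph V | F \subset H)
  ((v ^ v)%:R / L' * p ^+ #|T|.-1 * (((2 * v) ^ v)%:R * (#|I|%:R / N%:R))))).
  rewrite big_mkcondr; apply: ler_sum => F FH; case: eqP => [FT|_]; first exact: term.
  apply: mulr_ge0; last by apply: mulr_ge0 => //; exact: divr_ge0.
  apply: mulr_ge0; last by rewrite exprn_ge0 // ltW.
  by rewrite divr_ge0 // ltW.
rewrite sumr_const [X in _ *+ X <= _](_ : _ = #|powerset H|); last first.
  by apply: eq_card => F; rewrite [RHS]inE.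
rewrite card_powerset -[X in X <= _]mulr_natl /K !natrM.
have reorder (a b c d e l : R) : a * (b / l * d * (c * e)) = a * b * c / l * d * e.
  by ring.
by rewrite reorder.
Qed.

Lemma L_le_Np : L / 4 <= N%:R * p.
Proof.
have [h1 _] := card_edges_bounds H0 nv.
rewrite ler_pdivrMr //; apply: (le_trans L_le_n2p).
rewrite [X in _ <= X]mulrAC ler_wpM2r ?(ltW p_gt0) //.
by rewrite -natrX -natrM ler_nat mulnC.
Qed.

End Density.

(** * Supersaturation *)

Section Sampling.
Variables (V : finType) (H : graph V).
Hypothesis H0 : H != set0.
Local Notation v := #|V|.

(** The extremal number ex(n, H). *)
Definition turan (n : nat) : nat := \max_(G : graph 'I_n | copies H G == 0%N) #|G|.

Lemma copies_set0 n : copies H (set0 : graph 'I_n) = 0%N.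
Proof.
rewrite copiesE; apply/eqP; rewrite cards_eq0 -subset0; apply/subsetP => S.
rewrite !inE subset0 => /andP[SI /eqP S0].
have := @card_copy _ H n S; rewrite inE => /(_ SI); rewrite S0 cards0 => /esym/eqP.
by rewrite cards_eq0 (negbTE H0).
Qed.

Lemma turan_attained n : exists2 G : graph 'I_n, copies H G = 0%N & #|G| = turan n.
Proof.
have [|G /eqP G0 GE] := @eq_bigmax_cond _ (fun G : graph 'I_n => copies H G == 0%N)
  (fun G => #|G|).
  by apply/card_gt0P; exists set0; rewrite unfold_in copies_set0.
by exists G.
Qed.

Variables (m n : nat).
Hypothesis m2n : (2 * m <= n)%N.
Hypothesis n0 : (0 < n)%N.
Implicit Types (g : {ffun 'I_m -> 'I_n}) (G : graph 'I_n).
Local Notation N := #|{: edge 'I_n}|.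
Let inj : {set {ffun 'I_m -> 'I_n}} := [set g : {ffun 'I_m -> 'I_n} | injectiveb g].

Definition pullback g G : graph 'I_m :=
  [set e' : edge 'I_m | g @: val e' \in [set val e | e : edge 'I_n in G]].

Lemma perm_edge (e1 e2 : edge 'I_n) : exists s : {perm 'I_n}, s @: val e1 = val e2.
Proof.
have /eqP/cards2P[a [b [ab ->]]] := card_edge e1.
have /eqP/cards2P[c [d [cd ->]]] := card_edge e2.
exists (tperm a c * tperm (tperm a c b) d)%g.
rewrite imsetU !imset_set1 !permM tpermL tpermL tpermD //; last by rewrite eq_sym.
by rewrite -{2}(tpermL a c) (inj_eq perm_inj) eq_sym.
Qed.

(** By symmetry each edge of 'I_n is as likely as any other to be the image of
    a given edge under a random injection. *)
Lemma card_inj_edge (e' : edge 'I_m) (e : edge 'I_n) :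
  (N * #|[set g in inj | g @: val e' == val e]| = #|inj|)%N.
Proof.
have le (e1 e2 : edge 'I_n) : (#|[set g in inj | g @: val e' == val e1]| <=
                 #|[set g in inj | g @: val e' == val e2]|)%N.
  have [s se] := perm_edge e1 e2.
  pose comp (g : {ffun 'I_m -> 'I_n}) : {ffun 'I_m -> 'I_n} := [ffun z => s (g z)].
  have comp_inj : injective comp.
    move=> g1 g2 /ffunP h; apply/ffunP => z; have := h z.
    by rewrite !ffunE => /perm_inj.
  rewrite -(card_imset _ comp_inj); apply: subset_leq_card; apply/subsetP => g2.
  case/imsetP => g; rewrite !inE => /andP[/injectiveP gi /eqP ge] ->{g2}.
  apply/andP; split.
    by apply/injectiveP => z1 z2; rewrite !ffunE => /perm_inj /gi.
  rewrite -se -ge -imset_comp; apply/eqP; apply: eq_imset => z.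
  by rewrite /= ffunE.
transitivity (\sum_(e1 : edge 'I_n) #|[set g in inj | g @: val e' == val e1]|)%N.
  rewrite -sum_nat_const; apply: eq_bigr => e1 _; apply/eqP.
  by rewrite eqn_leq !le.
rewrite -[RHS]sum1_card.
transitivity (\sum_(e1 : edge 'I_n) \sum_(g in inj | g @: val e' == val e1) 1)%N.
  by apply: eq_bigr => e1 _; rewrite -sum1_card; apply: eq_bigl => g; rewrite inE.
rewrite (exchange_big_dep (mem inj)) /=; last by move=> e1 g _ /andP[].
apply: eq_bigr => g gi; have := gi; rewrite inE => /injectiveP gi'.
have c2 : #|g @: val e'| == 2%N by rewrite card_imset ?card_edge.
rewrite (big_pred1 (exist _ (g @: val e') c2)) // => e1.
rewrite (introT (injectiveP g) gi') /=; apply/eqP/eqP => [h|-> //].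
by apply: val_inj; rewrite -[LHS]h.
Qed.

Lemma sum_pullback G :
  (N * \sum_(g in inj) #|pullback g G| = 'C(m, 2) * #|G| * #|inj|)%N.
Proof.
have -> : (\sum_(g in inj) #|pullback g G| =
    \sum_(e' : edge 'I_m) \sum_(e in G) #|[set g in inj | g @: val e' == val e]|)%N.
  transitivity (\sum_(g in inj) \sum_(e' : edge 'I_m) \sum_(e in G)
      (g @: val e' == val e))%N.
    apply: eq_bigr => g _; rewrite -sum1_card big_mkcond; apply: eq_bigr => e' _.
    rewrite inE; case: imsetP => [[e eG ->]|no].
      rewrite (bigD1 e) //= eqxx big1 ?addn0 // => e1 /andP[_ ne].
      by rewrite val_eqE eq_sym (negbTE ne).
    rewrite big1 // => e eG; apply/eqP; rewrite eqb0; apply/negP => /eqP h.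
    by apply: no; exists e.
  rewrite exchange_big; apply: eq_bigr => e' _; rewrite exchange_big.
  apply: eq_bigr => e _; rewrite -sum1_card big_mkcond [RHS]big_mkcond.
  by apply: eq_bigr => g _; rewrite inE; case: (g \in inj); case: (_ == _).
rewrite big_distrr /= (eq_bigr (fun=> #|G| * #|inj|)%N); last first.
  move=> e' _; rewrite big_distrr /= (eq_bigr (fun=> #|inj|)); last first.
    by move=> e _; rewrite card_inj_edge.
  by rewrite sum_nat_const.
by rewrite sum_nat_const card_graph mulnA.
Qed.

Let bad G := [set g in inj | copies H (pullback g G) != 0%N].

Lemma bad_le G : (#|bad G| <=
  if (v <= m)%N then m ^ v * (copies H G * (v ^ v * n ^ (m - v))) else 0)%N.
Proof.
pose Q (f : {ffun V -> 'I_m}) (S : {set 'I_n} * graph 'I_n) :=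
  [set g : {ffun 'I_m -> 'I_n} | [forall y, g (f y) \in S.1]].
pose C := [set S in all_copies H n | S.2 \subset G].
have sub : bad G \subset \bigcup_(f : {ffun V -> 'I_m} | injectiveb f) \bigcup_(S in C) Q f S.
  apply/subsetP => g; rewrite inE => /andP[].
  rewrite inE => /injectiveP gi; rewrite -lt0n copiesE => /card_gt0P[S'].
  rewrite !inE => /andP[/isographP[f fi ->] fG].
  apply/bigcupP; exists f => //.
  pose gf : {ffun V -> 'I_n} := [ffun y => g (f y)].
  have gfi : injectiveb gf.
    apply/injectiveP => y1 y2; rewrite !ffunE => /gi; move: y1 y2.
    exact/injectiveP.
  apply/bigcupP; exists (copy_at H gf); last first.
    by rewrite inE; apply/forallP => y; apply/imsetP; exists y; rewrite ?ffunE.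
  rewrite !inE; apply/andP; split; first by apply/isographP; exists gf.
  apply/subsetP => e; rewrite inE => /imsetP[h hH eE].
  have c2 : #|f @: val h| == 2%N.
    by rewrite card_imset ?card_edge //; exact/injectiveP.
  have := subsetP fG (exist _ (f @: val h) c2).
  rewrite !inE /= imset_f // => /(_ isT).
  rewrite -imset_comp; have -> : (g \o f) @: val h = val e.
    by rewrite eE; apply: eq_imset => y; rewrite /= ffunE.
  by case/imsetP => e1 e1G /val_inj ->.
apply: leq_trans (subset_leq_card sub) _.
have cup (T U : finType) (P : pred T) (F : T -> {set U}) :
    (#|\bigcup_(t | P t) F t| <= \sum_(t | P t) #|F t|)%N.
  elim/big_ind2: _ => [|A1 n1 A2 n2 h1 h2|//]; first by rewrite cards0.
  by apply: leq_trans (leq_add h1 h2); rewrite cardsU leq_subr.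
apply: leq_trans (cup _ _ _ _) _.
have [vm|mv] := leqP v m; last first.
  rewrite big1 // => f /injectiveP fi.
  by have := leq_card f fi; rewrite card_ord leqNgt mv.
have -> : (m ^ v)%N = #|{: {ffun V -> 'I_m}}| by rewrite card_ffun card_ord.
rewrite -sum_nat_const big_mkcond; apply: leq_sum => f _; case: ifP => // /injectiveP fi.
apply: leq_trans (cup _ _ _ _) _.
rewrite copiesE -/C -sum_nat_const; apply: leq_sum => S SC.
have Sv : #|S.1| = v.
  move: SC; rewrite !inE => /andP[/isographP[f' /injectiveP fi' ->] _].
  by rewrite card_imset // cardsT.
pose fam (z : 'I_m) : pred 'I_n := fun w => (z \in f @: [set: V]) ==> (w \in S.1).
apply: (@leq_trans #|family fam|).
  apply: subset_leq_card; apply/subsetP => g; rewrite inE => /forallP h.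
  by apply/familyP => z; apply/implyP => /imsetP[y _ ->]; exact: h.
rewrite card_family foldrE big_map big_enum /=.
rewrite (bigID (fun z => z \in f @: [set: V])) /=.
have cf : #|f @: [set: V]| = v by rewrite card_imset // cardsT.
rewrite (eq_bigr (fun=> v)); last first.
  move=> z zf; rewrite -Sv; apply: eq_card => w.
  by rewrite {1}/in_mem /= /fam zf.
rewrite prod_nat_const [X in (_ * X)%N](eq_bigr (fun=> n)); last first.
  move=> z zf; rewrite -[RHS]card_ord; apply: eq_card => w.
  by rewrite {1}/in_mem /= /fam (negbTE zf).
rewrite prod_nat_const cf leq_mul // .
have -> : #|[predC f @: [set: V]]| = (m - v)%N.
  by rewrite -[m in RHS]card_ord -(cardC (mem (f @: [set: V]))) cf addKn.
by [].
Qed.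

(** Sampling m vertices: a random pullback of G has on average the density of
    G, and at most that of a largest copy-free graph unless it contains a
    copy, which is unlikely if G contains few. *)
Lemma sampling_bound G :
  ('C(m, 2) * #|G| * #|inj| <= N * (#|inj| * turan m + #|bad G| * 'C(m, 2)))%N.
Proof.
rewrite -sum_pullback leq_mul2l; apply/orP; right.
have -> : (#|inj| * turan m = \sum_(g in inj) turan m)%N by rewrite sum_nat_const.
have -> : (#|bad G| * 'C(m, 2) =
    \sum_(g in inj) if copies H (pullback g G) != 0%N then 'C(m, 2) else 0)%N.
  by rewrite -big_mkcondr -sum_nat_const; apply: eq_bigl => g; rewrite inE.
rewrite -big_split /=; apply: leq_sum => g _; case: ifPn => [_|].
  by apply: leq_trans (leq_addl _ _); rewrite -card_graph max_card.
rewrite negbK addn0 => h.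
exact: (leq_bigmax_cond (F := fun G : graph 'I_m => #|G|) _ h).
Qed.

Lemma card_inj_ge : (n ^ m <= 2 ^ m * #|inj|)%N.
Proof.
rewrite card_inj_ffuns !card_ord ffact_prod.
rewrite -[X in (2 ^ X)%N]card_ord -[X in (n ^ X)%N]card_ord.
rewrite -!prod_nat_const -big_split /=; apply: leq_prod => i _.
have h : (2 * i <= n)%N by apply: leq_trans m2n; rewrite leq_mul2l ltnW ?orbT.
by move: h; clear; lia.
Qed.

End Sampling.

Lemma card_all_copies_le (V : finType) (H : graph V) (n : nat) :
  (#|all_copies H n| <= n ^ #|V|)%N.
Proof.
have -> : (n ^ #|V|)%N = #|{: {ffun V -> 'I_n}}| by rewrite card_ffun card_ord.
apply: leq_trans (leq_imset_card (copy_at H (n := n)) predT).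
apply: subset_leq_card; apply/subsetP => S; rewrite inE => /isographP[f _ ->].
exact: imset_f.
Qed.

(** The sample size m is one at which the extremal density is almost the
    infimum of all extremal densities; this gives uniformity in n. *)
Theorem supersaturation (R : realType) (V : finType) (H : graph V) (d : R) :
  H != set0 -> 0 < d -> exists2 zeta : R, 0 < zeta & exists n1 : nat,
  forall n, (n1 <= n)%N -> exists2 G0 : graph 'I_n, copies H G0 = 0%N &
  forall G : graph 'I_n, (copies H G)%:R <= zeta * #|all_copies H n|%:R ->
    #|G|%:R <= #|G0|%:R + d * #|{: edge 'I_n}|%:R.
Proof.
move=> H0 d0.
pose a n : R := (turan H n)%:R / 'C(n, 2)%:R.
pose A : set R := [set a n | n in [set n | (2 <= n)%N]]%classic.
have a0 n : 0 <= a n by rewrite divr_ge0.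
have hA : has_inf A.
  split; first by exists (a 2); exists 2.
  by exists 0 => _ [n _ <-].
have d2 : 0 < d / 2 by rewrite divr_gt0.
have [_ [m m2 <-] am] := inf_adherent d2 hA.
have v2 := card_vertices_ge2 H0.
have m0 : (0 < m)%N by exact: ltnW.
have Cm : (0 < 'C(m, 2))%N by rewrite bin_gt0.
pose c := (m ^ #|V| * #|V| ^ #|V| * 2 ^ m)%N.
have c0 : (0 < c)%N by rewrite !muln_gt0 !expn_gt0 m0 (ltnW v2).
have c0' : 0 < c%:R :> R by rewrite ltr0n.
exists (d / 2 / c%:R); first by rewrite divr_gt0.
exists (2 * m)%N => n nm.
have n2 : (2 <= n)%N by lia.
have n0 : (0 < n)%N by exact: ltnW.
have [G0 G00 G0E] := turan_attained H0 n.
exists G0 => // G few.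
have N0 : (0 < 'C(n, 2))%N by rewrite bin_gt0.
rewrite card_graph.
pose inj := [set g : {ffun 'I_m -> 'I_n} | injectiveb g].
pose bad := [set g in inj | copies H (pullback g G) != 0%N].
have i_ge : (n ^ m <= 2 ^ m * #|inj|)%N by exact: card_inj_ge.
have i0 : (0 < #|inj|)%N.
  by move: i_ge; case: #|inj| => //; rewrite muln0 leqn0 expn_eq0 (gtn_eqF n0).
have samp : ('C(m, 2) * #|G| * #|inj| <=
    'C(n, 2) * (#|inj| * turan H m + #|bad| * 'C(m, 2)))%N.
  by rewrite -(card_graph n); exact: sampling_bound.
have bad_small : #|bad|%:R <= d / 2 * #|inj|%:R :> R.
  have := @bad_le _ H m n G; rewrite -/inj -/bad; case: (leqP #|V| m) => [vm h|_ h]; last first.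
    by move: h; rewrite leqn0 => /eqP ->; rewrite mulr_ge0 // ltW.
  have {}h : #|bad|%:R <= (m ^ #|V| * #|V| ^ #|V|)%:R * (n ^ (m - #|V|))%:R *
      (copies H G)%:R :> R.
    by rewrite -!natrM ler_nat (leq_trans h) // mulnCA mulnC !mulnA.
  have In : #|all_copies H n|%:R <= (n ^ #|V|)%:R :> R.
    by rewrite ler_nat card_all_copies_le.
  have e0 : 0 <= d / 2 / c%:R by rewrite divr_ge0 // ltW.
  apply: (le_trans h); apply: le_trans (ler_wpM2l _ few) _; first exact: mulr_ge0.
  apply: le_trans (ler_wpM2l _ (ler_wpM2l e0 In)) _; first exact: mulr_ge0.
  have reorder (x y z w : R) : x * y * (z * w) = x * z * (y * w) by ring.
  rewrite reorder -natrM -expnD subnK //.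
  have k0 : 0 <= (m ^ #|V| * #|V| ^ #|V|)%:R * (d / 2 / c%:R) by exact: mulr_ge0.
  have i_ge' : (n ^ m)%:R <= (2 ^ m)%:R * #|inj|%:R :> R by rewrite -natrM ler_nat.
  apply: le_trans (ler_wpM2l k0 i_ge') _.
  have cE : c%:R = (m ^ #|V| * #|V| ^ #|V|)%:R * (2 ^ m)%:R :> R by rewrite /c natrM.
  have cancel (x y z : R) : 0 < x * y -> x * (d / 2 / (x * y)) * (y * z) = d / 2 * z.
    move/lt0r_neq0; rewrite mulf_eq0 negb_or => /andP[x0 y0].
    by field; rewrite x0 y0.
  by move: c0'; rewrite cE => /cancel ->.
have an : a m <= a n + d / 2.
  apply: (le_trans (ltW am)); rewrite lerD2r.
  by apply: inf_lbound; [case: hA|exists n].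
have Cm' : 0 < 'C(m, 2)%:R :> R by rewrite ltr0n.
have Cn' : 0 < 'C(n, 2)%:R :> R by rewrite ltr0n.
have i0' : 0 < #|inj|%:R :> R by rewrite ltr0n.
have amE : (turan H m)%:R = a m * 'C(m, 2)%:R by rewrite /a divfK // gt_eqF.
have anE : #|G0|%:R = a n * 'C(n, 2)%:R :> R by rewrite G0E /a divfK // gt_eqF.
have samp' : 'C(m, 2)%:R * #|G|%:R * #|inj|%:R <=
    'C(n, 2)%:R * (#|inj|%:R * (turan H m)%:R + #|bad|%:R * 'C(m, 2)%:R) :> R.
  by rewrite -!natrM -natrD -natrM ler_nat.
rewrite anE -mulrDl -(ler_pM2r (mulr_gt0 Cm' i0')).
apply: (@le_trans _ _ ('C(n, 2)%:R * (#|inj|%:R * (turan H m)%:R +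
    d / 2 * #|inj|%:R * 'C(m, 2)%:R))).
  apply: le_trans (_ : 'C(m, 2)%:R * #|G|%:R * #|inj|%:R <= _).
    by rewrite mulrCA mulrA.
  apply: (le_trans samp'); rewrite ler_wpM2l ?(ltW Cn') // lerD2l.
  by rewrite ler_wpM2r // ltW.
rewrite amE; apply: (@le_trans _ _ ('C(n, 2)%:R * ((a m + d / 2) *
    ('C(m, 2)%:R * #|inj|%:R)))).
  by apply: le_of_eq; ring.
rewrite mulrA ler_wpM2r ?mulr_ge0 // mulrC ler_wpM2r //.
by move: an; clear; lra.
Qed.

(** * Lower tails of subgraph counts *)

Section Translation.
Variables (R : realType) (V : finType) (H : graph V) (n : nat).
Local Notation I := (all_copies H n).

Lemma gnq_mean_copies (q : edge 'I_n -> R) :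
  gnq_mean q (fun G => (copies H G)%:R) = \sum_(S in I) \prod_(u in S.2) q u.
Proof.
rewrite -(mean_X I (fun S => S.2) q); apply: eq_bigr => G _; congr (_ * _).
by rewrite sum_contains copiesE.
Qed.

Lemma gnq_mean_copies_const (p : R) :
  gnq_mean (fun=> p) (fun G : graph 'I_n => (copies H G)%:R) = #|I|%:R * p ^+ #|H|.
Proof.
rewrite gnq_mean_copies (eq_bigr (fun=> p ^+ #|H|)); last first.
  by move=> S SI; rewrite prodr_const (card_copy SI).
by rewrite sumr_const mulr_natl.
Qed.

Lemma gnq_prE (p : R) (A : pred (graph 'I_n)) :
  gnq_pr (fun=> p) A = \sum_G condm p A G.
Proof.
rewrite /gnq_pr big_mkcond; apply: eq_bigr => G _; rewrite /condm.
by case: (A G); rewrite ?mul1r ?mul0r.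
Qed.

End Translation.

(** The constant L forces n above all thresholds, as L <= n ^ 2 p < n ^ 2; it
    makes K / L at most the codegree constant kappa of the lower bound; and it
    makes #|E| p, which is at least L / 4, as large as the variance estimate
    requires.  For the upper bound the two regimes of eta meet at
    g ^ r * zeta. *)
Theorem lower_tail_bounds (R : realType) (V : finType) (H : graph V) (e : R) :
  H != set0 -> 0 < e <= 1 / 2 ->
  exists2 L : R, 0 < L & forall (n : nat) (p : R), (0 < n)%N -> 0 < p < 1 ->
    L * n%:R `^ (- (1 / m2 R H)) <= p -> forall eta : R, 0 <= eta <= 1 ->
  let m0 : R := #|all_copies H n|%:R * p ^+ #|H| in
  let Z := \sum_G condm p (fun G : graph 'I_n => (copies H G)%:R <= eta * m0) G in
  let mean (q : edge 'I_n -> R) := \sum_(S in all_copies H n) \prod_(u in S.2) q u in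
  [/\ 0 < m0, 0 < Z,
      exists q, [/\ forall u, 0 <= q u <= 1, mean q <= (eta + e) * m0 &
                    \sum_u relent p (q u) <= (1 + e) * - ln Z] &
      forall q, (forall u, 0 <= q u <= 1) -> mean q <= (1 - e) * (eta * m0) ->
        - ln Z <= (1 + e) * \sum_u relent p (q u)].
Proof.
have sum_ge (a b c d : R) : 0 <= a -> 0 <= b -> 0 <= c -> 0 <= d ->
    [/\ a <= a + b + c + d, b <= a + b + c + d, c <= a + b + c + d &
       d <= a + b + c + d] by move=> *; split; lra.
have n_sum_ge (a b c : nat) : [/\ a <= a + b + c + 1, b <= a + b + c + 1 &
    c <= a + b + c + 1]%N by split; lia.
move=> H0 e02; have /andP[e0 e2] := e02.
pose v := #|V|; pose r := #|H|; pose K := (2 ^ r * v ^ v * (2 * v) ^ v)%N.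
have v0 : (0 < v)%N by apply: ltnW; exact: card_vertices_ge2 H0.
have K0 : 0 < K%:R :> R.
  by rewrite ltr0n !muln_gt0 !expn_gt0 muln_gt0 v0.
have [kappa kappa0 [N0 lower]] := lower_tail_entropy r (ltW K0) e0.
have [g g0 small] := upper_tail_supersaturation r K0 e02.
have d0 : 0 < e / (4 * K%:R) by rewrite divr_gt0 // mulr_gt0.
have [zeta zeta0 [n1 super]] := supersaturation H0 d0.
have eta00 : 0 < g ^+ r * zeta by rewrite mulr_gt0 // exprn_gt0.
have [L0 L00 large] := upper_tail_chebyshev r (ltW K0) e02 eta00.
pose n2 := (2 * v + n1 + 4 * N0 + 1)%N.
pose L : R := 1 + K%:R / kappa + 4 * L0 + n2%:R ^+ 2.
have [vn2 n1n2 N0n2] := n_sum_ge (2 * v)%N n1 (4 * N0)%N.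
rewrite -/n2 in vn2 n1n2 N0n2.
have Kk0 : 0 <= K%:R / kappa by rewrite divr_ge0 // ltW.
have L04 : 0 <= 4 * L0 by rewrite mulr_ge0 // ltW.
have n20 : 0 <= n2%:R ^+ 2 :> R by exact: sqr_ge0.
have [L1 KL L0L n2L] := sum_ge _ _ _ _ ler01 Kk0 L04 n20.
rewrite -/L in L1 KL L0L n2L.
have L_gt0 : 0 < L by exact: lt_le_trans L1.
exists L => // n p n0 p01 Lp eta /andP[eta0 eta1] m0 Z mean.
have /andP[p0 p1] := p01.
have n2n : (n2 <= n)%N.
  have h : n2%:R ^+ 2 <= n%:R ^+ 2 :> R.
    apply: (le_trans n2L); apply: le_trans (L_le_n2p n0 p01 L1 Lp) _.
    by rewrite ler_piMr ?sqr_ge0 // ltW.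
  by move: h; rewrite ler_sqr ?nnegrE // ler_nat.
have nv : (2 * #|V| <= n)%N.
  exact: leq_trans n2n.
have nn1 : (n1 <= n)%N by exact: leq_trans n2n.
have N0N : (N0 <= #|{: edge 'I_n}|)%N.
  have [h _] := card_edges_bounds H0 nv.
  have h1 : (4 * N0 <= n)%N by exact: leq_trans n2n.
  have h2 : (n <= n ^ 2)%N by rewrite -{1}[n]expn1 leq_pexp2l.
  by rewrite -(leq_pmul2l (isT : 0 < 4)%N) (leq_trans h1) // (leq_trans h2).
have I0 : (0 < #|all_copies H n|)%N by exact: card_copies_gt0 H0 nv.
have E0 : (0 < #|{: edge 'I_n}|)%N.
  have [h _] := card_edges_bounds H0 nv.
  by rewrite lt0n; apply: contraTneq h => ->; rewrite muln0 -ltnNge expn_gt0 n0.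
have ID0 : 0 <= #|all_copies H n|%:R / #|{: edge 'I_n}|%:R :> R by rewrite divr_ge0.
have cc : {in all_copies H n, forall S : {set 'I_n} * graph 'I_n, #|S.2| = r} by move=> S SI; rewrite (card_copy SI).
have deg (T : graph 'I_n) : (0 < #|T|)%N ->
    #|[set S in all_copies H n | T \subset S.2]|%:R <=
    K%:R * p ^+ #|T|.-1 * (#|all_copies H n|%:R / #|{: edge 'I_n}|%:R).
  move=> T0; apply: le_trans (codegree_le H0 n0 p01 L1 Lp nv T0) _.
  rewrite -/r -/v -/K ler_wpM2r // ler_wpM2r ?exprn_ge0 ?(ltW p0) //.
  rewrite ler_pdivrMr; last by case: ifP.
  by rewrite ler_peMr ?(ltW K0) //; case: ifP.
have deg1 u : #|[set S in all_copies H n | u \in S.2]|%:R <=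
    K%:R * (#|all_copies H n|%:R / #|{: edge 'I_n}|%:R) :> R.
  exact: (@x_deg1 R _ _ p (all_copies H n) (fun S => S.2) K%:R deg u).
have codeg (T : graph 'I_n) : (2 <= #|T|)%N ->
    #|[set S in all_copies H n | T \subset S.2]|%:R <=
    kappa * p ^+ #|T|.-1 * (#|all_copies H n|%:R / #|{: edge 'I_n}|%:R).
  move=> T2; apply: le_trans (codegree_le H0 n0 p01 L1 Lp nv (ltnW T2)) _.
  rewrite T2 -/r -/v -/K ler_wpM2r // ler_wpM2r ?exprn_ge0 ?(ltW p0) //.
  by rewrite ler_pdivrMr // mulrC -ler_pdivrMr.
have m00 : 0 < m0 by rewrite mulr_gt0 ?ltr0n // exprn_gt0.
pose A (G : graph 'I_n) := #|[set S in all_copies H n | S.2 \subset G]|%:R <= eta * m0.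
have ZE : Z = \sum_G condm p A G.
  by apply: eq_bigr => G _; rewrite /condm copiesE.
have Z0 : 0 < \sum_G condm p A G.
  have A0 : A set0.
    by rewrite /A -copiesE copies_set0 // mulr_ge0 // ltW.
  rewrite (bigD1 set0) //= ltr_pwDl //; last by apply: sumr_ge0 => G _; exact: condm_ge0.
  rewrite /condm A0 mul1r prodr_gt0 // => u _.
  by rewrite /bern; case: ifP; rewrite ?subr_gt0.
rewrite ZE; split => //.
- have A_decr (G G' : graph 'I_n) : G \subset G' -> A G' -> A G.
    move=> GG'; apply: le_trans; rewrite ler_nat subset_leq_card //.
    apply/subsetP => S; rewrite !inE => /andP[-> /= SG]; exact: subset_trans GG'.
  have [q [qp ent mean_q]] := lower _ _ p A _ (fun S => S.2) (eta * m0) p01 A_decr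
    N0N I0 cc deg1 codeg Z0 (fun G AG => AG).
  exists q; split => //; last by rewrite mulrDl.
  by move=> u; have /andP[-> /le_trans -> //] := qp u; exact: ltW.
- move=> q q01 mean_q.
  have [eta_small|/ltW eta_large] := leP eta (g ^+ r * zeta).
    have [G0 G0free super'] := super n nn1.
    apply: (small _ _ p _ (fun S => S.2) zeta eta G0 q p01 I0 E0 cc deg1) => //.
    + by apply/eqP; rewrite -cards_eq0 -copiesE G0free.
    + by move=> G; rewrite -copiesE; exact: super'.
    + by rewrite eta0.
    + have em0 : 0 <= eta * m0 by exact: mulr_ge0 eta0 (ltW m00).
      apply: (le_trans mean_q); apply: ler_piMl => //.
      by rewrite gerBl ltW.
  have LNp : L0 <= #|{: edge 'I_n}|%:R * p.
    apply: le_trans (L_le_Np H0 n0 p01 L1 Lp nv).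
    by rewrite ler_pdivlMr // mulrC.
  apply: (large _ _ p _ (fun S => S.2) eta q p01 I0 E0 LNp cc deg) => //.
  by rewrite eta_large.
Qed.

Theorem theorem2 (R : realType) (V : finType) (H : graph V)
    (H_nonempty : H != finset.set0) (p0 : R) (p0_lt1 : p0 < 1)
    (eps : R) (eps_gt0 : 0 < eps) :
  exists2 L : R, 0 < L &
    forall (n : nat) (p : R), (0 < n)%N -> 0 < p < 1 ->
      L * n%:R `^ (- (1 / m2 R H)) <= p <= p0 ->
      let N : graph 'I_n -> R := fun G => (copies H G)%:R in
      let EX := gnq_mean (fun=> p) N in
      forall eta : R, 0 <= eta <= 1 ->
        ((1 - eps)%:E * Phi H n p (eta + eps)
           <= - lne (gnq_pr (fun=> p) (fun G => (N G <= eta * EX)%R))%:E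
           <= (1 + eps)%:E * Phi H n p ((1 - eps) * eta)%R)%E.
Proof.
pose e := Num.min eps (1 / 2).
have e0 : 0 < e by rewrite lt_min eps_gt0 divr_gt0.
have e_eps : e <= eps by rewrite ge_min lexx.
have e2 : e <= 1 / 2 by rewrite ge_min lexx orbT.
have e02 : 0 < e <= 1 / 2 by rewrite e0.
have [L L0 bounds] := lower_tail_bounds H_nonempty e02.
exists L => // n p n0 p01 /andP[Lp _] N EX eta eta01.
have [] := bounds n p n0 p01 Lp eta eta01.
rewrite /EX /N gnq_mean_copies_const; set m0 := _ * p ^+ _ => m00.
rewrite gnq_prE; set Z := \sum_G _ => Z0 [q [q01 q_mean q_ent]] upper.
have lnE : lne Z%:E = (ln Z)%:E by rewrite lne_EFin.
rewrite lnE -EFinN; set D := - ln Z in q_ent upper *.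
have D0 : 0 <= D by rewrite oppr_ge0 ln_le0 // sum_condm_le1.
have /andP[eta0 eta1] := eta01.
apply/andP; split.
  have Phi_ge0 : (0 <= Phi H n p (eta + eps))%E.
    apply: le_ereal_inf_tmp => _ [q' [q'01 _] <-]; rewrite lee_fin.
    by apply: sumr_ge0 => u _; exact: relent_ge0.
  have [eps1|eps1] := leP 1 eps.
    apply: (@le_trans _ _ 0%E); last by rewrite lee_fin.
    by rewrite mule_le0_ge0 // lee_fin subr_le0.
  have Phi_le : (Phi H n p (eta + eps) <= ((1 + e) * D)%:E)%E.
    apply: (@le_trans _ _ (\sum_u relent p (q u))%:E); last by rewrite lee_fin.
    apply: ereal_inf_lbound; exists q => //; split => //=.
    rewrite gnq_mean_copies gnq_mean_copies_const -/m0 (le_trans q_mean) //.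
    by rewrite ler_wpM2r ?(ltW m00) // lerD2l.
  have eps1' : (0 <= (1 - eps)%:E)%E by rewrite lee_fin subr_ge0 ltW.
  apply: le_trans (lee_wpmul2l eps1' Phi_le) _.
  rewrite -EFinM lee_fin mulrA ler_piMl //.
  have : (1 - eps) * (1 + e) <= (1 - eps) * (1 + eps).
    by rewrite ler_wpM2l ?subr_ge0 ?(ltW eps1) // lerD2l.
  by have := sqr_ge0 eps; clear; lra.
have eps0 : 0 < 1 + eps by rewrite addr_gt0.
rewrite -(lee_pdivrMl _ _ eps0).
apply: le_ereal_inf_tmp => _ [q' [q'01 q'_mean] <-].
rewrite -EFinM lee_fin ler_pdivrMl //.
have q'_mean' : \sum_(S in all_copies H n) \prod_(u in S.2) q' u <= (1 - e) * (eta * m0).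
  move: q'_mean; rewrite gnq_mean_copies gnq_mean_copies_const -/m0.
  move/le_trans; apply; rewrite -mulrA.
  by apply: ler_wpM2r; [exact: mulr_ge0 eta0 (ltW m00) | rewrite lerD2l lerN2].
apply: (le_trans (upper q' q'01 q'_mean')).
rewrite ler_wpM2r ?lerD2l //.
by apply: sumr_ge0 => u _; exact: relent_ge0.
Qed.
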